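(* Suppose Assumption 1 (stated in the context) holds. Then $$Z_n:=\frac{T_{m,n,p}-n}{\sqrt{n}}-2\sqrt{m\log p}\;\to\;0$$ in probability as $n\to\infty$. Furthermore, $$\lim_{n\to\infty}\mathbb{E}\left[e^{\alpha|Z_n|}\mathbf{1}_{\{|Z_n|\geq\delta\}}\right]=0$$ for all $\alpha>0$ and $\delta>0$.
   Context: Let $n\to\infty$, and let $p=p_n\to\infty$ and $m=m_n$ be integer sequences ($2\le m\le p$). Let $X=(x_{ij})_{1\le i\le n,1\le j\le p}$ have independent $N(0,1)$ entries and let $W=(w_{ij})_{1\le i,j\le p}=X^{\intercal}X$. For $S\subset\{1,\dots,p\}$ let $W_S=(w_{ij})_{i,j\in S}$, let $|S|$ be the cardinality of $S$, and let $\lambda_1(A)$ denote the largest eigenvalue of a symmetric matrix $A$. Define $$T_{m,n,p}=\max_{S\subset\{1,\dots,p\},\,|S|=m}\lambda_1(W_S).$$ Assumption 1: either $m\ge 2$ is a fixed integer and $\log p=o(n^{1/2})$; or $m\to\infty$ with $$m=o\left(\min\left\{\frac{(\log p)^{1/3}}{\log\log p},\;\frac{n^{1/4}}{(\log n)^{3/2}(\log p)^{1/2}}\right\}\right).$$ *)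

(* Defs.v *)
From HB Require Import structures.
From mathcomp Require Import all_boot all_order all_algebra.
From mathcomp Require Import all_classical all_reals all_analysis.
Set Implicit Arguments.
Unset Strict Implicit.
Unset Printing Implicit Defensive.
Import Order.TTheory GRing.Theory Num.Theory.
Import numFieldNormedType.Exports.
Local Open Scope classical_set_scope.
Local Open Scope ring_scope.

Definition mutually_independent d (T : measurableType d) (R : realType)
    (P : probability T R) (I : finType) (X : I -> {RV P >-> R}) : Prop :=
  forall (J : {set I}) (B : I -> set R), (forall i, measurable (B i)) ->
    P (\bigcap_(i in [set` J]) X i @^-1` B i) =
      (\prod_(i in J) P (X i @^-1` B i))%E.

(* Equality of laws is required on Borel sets only: outside the sigma-algebra
   the values of a measure are unspecified. *)
Definition standard_normal d (T : measurableType d) (R : realType)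
    (P : probability T R) (X : {RV P >-> R}) : Prop :=
  forall B : set R, measurable B -> distribution P X B = normal_prob 0 1 B.

(* The set of (real) eigenvalues is finite, and it is nonempty for a symmetric
   matrix of positive size, so this supremum is then a maximum. *)
Definition largest_eigenvalue (R : realType) k (A : 'M[R]_k) : R :=
  sup [set a | eigenvalue A a].

Definition principal_submatrix (R : realType) p (W : 'M[R]_p)
    (S : {set 'I_p}) : 'M[R]_#|S| :=
  \matrix_(i, j) W (enum_val i) (enum_val j).

(* There are finitely many S, and at least one when m <= p, so this supremum is
   then a maximum. *)
Definition max_subset_eigenvalue (R : realType) (m n p : nat)
    (X : 'M[R]_(n, p)) : R :=
  sup [set largest_eigenvalue (principal_submatrix (X^T *m X) S)
        | S in [set S : {set 'I_p} | #|S| = m]].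

Definition centered_statistic (R : realType) (m n p : nat)
    (X : 'M[R]_(n, p)) : R :=
  (max_subset_eigenvalue m X - n%:R) / Num.sqrt n%:R
    - 2 * Num.sqrt (m%:R * ln p%:R).

Definition growth_condition (R : realType) (m p : nat -> nat) : Prop :=
  ((exists m0, (2 <= m0)%N /\ forall n, m n = m0) /\
     (fun n => ln (p n)%:R : R) =o_\oo (fun n => Num.sqrt n%:R : R))
  \/
  (m @ \oo --> \oo /\
     (fun n => (m n)%:R : R) =o_\oo
       (fun n => Num.min
          ((ln (p n)%:R `^ 3^-1) / ln (ln (p n)%:R))
          (n%:R `^ 4^-1 / ((ln n%:R `^ (3 / 2)) * (ln (p n)%:R `^ 2^-1))) : R)).

(* The variables of the sequence may live on different probability spaces. *)
Definition cvg_in_probability (R : realType) (d : nat -> measure_display)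
    (T : forall n, measurableType (d n)) (P : forall n, probability (T n) R)
    (Y : forall n, T n -> R) (c : R) : Prop :=
  forall e : R, 0 < e ->
    P n [set w | e <= `|Y n w - c|] @[n --> \oo] --> 0%E.

(* Main.v *)
(** Write L = sqrt (m ln p), so that Z = (T - n) / sqrt n - 2 L.  For a unit
    vector u supported on m columns, |X u|^2 is chi-square with n degrees of
    freedom.

    Upper tail: on each support the supremum over the sphere is controlled by
    (2 K + 1)^m grid points, and a union bound over the supports yields
    E exp (L Z) <= exp (o(L)).  Since L tends to infinity,
    exp (alpha Z) <= exp (L Z - (L - alpha) delta) on {Z >= delta} is enough.

    Lower tail: split the columns into B >= L^2 disjoint families, each made of m
    blocks of q columns.  In one family, consider the q^m vectors with entry
    1 / sqrt m on one column of each block.  Two of them have inner product k / m,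
    where k is the number of blocks on which they agree, and the second moment
    method shows that with probability at least 1/2 one of them has
    |X u|^2 > n + sqrt n (2 L - delta).  The families are independent, so
    P (Z <= - delta) <= 2^(-B), which is negligible against the exponential
    moment E exp (- a Z) <= exp (2 a L + a^2). *)

Require Import Defs.
From HB Require Import structures.
From mathcomp Require Import all_boot all_order all_algebra.
From mathcomp Require Import all_classical all_reals all_analysis.
From mathcomp Require Import measurable_realfun.
From mathcomp Require Import ring lra.
Set Implicit Arguments.
Unset Strict Implicit.
Unset Printing Implicit Defensive.
Import Order.TTheory GRing.Theory Num.Theory.
Import numFieldNormedType.Exports.
Local Open Scope classical_set_scope.
Local Open Scope ring_scope.

(** The exponent L is critical for the upper tail: at tilt L / sqrt n, the p^m ordered supports and
    the chi-square moment each contribute exp (L^2), and the centring by 2 L contributes exp (- 2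
    L^2). What remains is the entropy of the grid, m times a logarithm of order ln ln p, and the
    cubic term L^3 / sqrt n of the cumulant. Both are o(L) because m^3 = o(ln p) and m ln p = o(sqrt
    n), the two consequences of Assumption 1 on which the estimates rest.

    For the lower tail a constant probability of success is not enough, since the exponential moment
    costs exp (c L). This forces independent repetitions; their price is q = p / (B m) columns per
    block instead of p, that is m ln (2 B m) = o(L) in the exponent. Taking one column in each block
    makes the sum over pairs factor. Pairs agreeing on 1 <= k <= m - 1 blocks leave a gain ln q / (4
    m), and m^3 = o(ln p) is again what puts it above a multiple of L. *)

Lemma integral_EFinZl d (T : measurableType d) (R : realType)
    (mu : {measure set T -> \bar R}) (c : R) (f : T -> R) :
  measurable_fun setT f -> (forall x, 0 <= f x) -> 0 <= c ->
  (\int[mu]_x (c%:E * (f x)%:E) = c%:E * \int[mu]_x (f x)%:E)%E.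
Proof.
move=> mf f0 c0; rewrite ge0_integralZl ?lee_fin//.
- exact/measurable_EFinP.
- by move=> x _; rewrite lee_fin.
Qed.

(** * Functions of disjoint sets of independent variables *)

Section independence.
Context d (T : measurableType d) (R : realType) (P : probability T R).

(** Both sides are finite measures in [A], the right one being a multiple of [P], so agreement on
    the generating pi-system propagates to the sigma-algebra. *)
Lemma indep_generated (G : set (set T)) (E : set T) :
    G `<=` measurable -> setI_closed G -> G setT -> measurable E ->
    (forall A, G A -> P (A `&` E) = (P A * P E)%E) ->
  forall A, <<s G >> A -> P (A `&` E) = (P A * P E)%E.
Proof.
move=> mG IG GT mE GE A sA.
have PEfin : P E \is a fin_num by exact: fin_num_measure.
have PE0 : 0 <= fine (P E) by rewrite fine_ge0.
pose m1 : {measure set T -> \bar R} := mrestr P mE.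
pose m2 : {measure set T -> \bar R} := mscale (NngNum PE0) P.
have m1E B : m1 B = P (B `&` E) by [].
have m2E B : m2 B = (P B * P E)%E by rewrite /m2/= /mscale/= fineK// muleC.
rewrite -m1E -m2E.
apply: (g_sigma_algebra_measure_unique G mG (fun _ => setT)) => //.
- by rewrite bigcup_const//; exists 0%N.
- by move=> B GB; rewrite m1E m2E; exact: GE.
- by move=> k; rewrite (le_lt_trans _ (ltry 1))// m1E; exact: probability_le1 (measurableI _ _ measurableT mE).
Qed.

Context (I : finType) (X : I -> {RV P >-> R}).

Definition cylinder (J : {set I}) : set (set T) :=
  [set A | exists2 B : I -> set R, (forall i, measurable (B i)) &
     A = \bigcap_(i in [set` J]) X i @^-1` B i].

Lemma cylinder_measurable (J : {set I}) : cylinder J `<=` measurable.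
Proof.
move=> _ [B mB ->]; apply: fin_bigcap_measurable => // i _.
by rewrite -[_ @^-1` _]setTI; apply: measurable_funP.
Qed.

Lemma cylinder_setI_closed (J : {set I}) : setI_closed (cylinder J).
Proof.
move=> _ _ [B mB ->] [C mC ->]; exists (fun i => B i `&` C i).
  by move=> i; exact: measurableI.
by rewrite -bigcapI; apply: eq_bigcapr => i _; rewrite preimage_setI.
Qed.

Lemma cylinder_setT (J : {set I}) : cylinder J setT.
Proof.
exists (fun _ => setT) => //; apply/seteqP; split => // t _ i _ //.
Qed.

Lemma cylinder_subset (J J' : {set I}) : J \subset J' ->
  cylinder J `<=` cylinder J'.
Proof.
move=> /fintype.subsetP JJ' _ [B mB ->]; exists (fun i => if i \in J then B i else setT).
  by move=> i; case: ifP.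
apply/seteqP; split => t /= h i /= iJ; last first.
  by have := h i (JJ' _ iJ); rewrite /= iJ.
by case: ifPn => // iJ1; exact: h.
Qed.

Lemma cylinder_preimage (J : {set I}) i (B : set R) : i \in J ->
  measurable B -> cylinder J (X i @^-1` B).
Proof.
move=> iJ mB; exists (fun k => if k == i then B else setT).
  by move=> k; case: ifP.
apply/seteqP; split => t /= h.
  by move=> k _ /=; case: eqP => // ->.
by have := h i iJ; rewrite /= eqxx.
Qed.

(* [f] is measurable with respect to the sigma-algebra generated by the
   variables of index in [J]. *)
Definition depends_on (J : {set I}) (f : T -> R) :=
  measurable_fun [set: g_sigma_algebraType (cylinder J)]
    (f : g_sigma_algebraType (cylinder J) -> R).

Lemma depends_on_sub (J J' : {set I}) f : J \subset J' ->
  depends_on J f -> depends_on J' f.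
Proof.
move=> JJ' mf _ B mB; rewrite setTI.
have /= := mf measurableT B mB; rewrite setTI.
by apply: sub_sigma_algebra2; exact: cylinder_subset.
Qed.

Lemma depends_on_id (J : {set I}) i : i \in J -> depends_on J (X i).
Proof.
move=> iJ _ B mB; rewrite setTI; apply: sub_sigma_algebra.
exact: cylinder_preimage.
Qed.

Lemma depends_on_measurable (J : {set I}) f : depends_on J f ->
  measurable_fun [set: T] f.
Proof.
move=> mf _ B mB; have := mf measurableT B mB; rewrite !setTI => sB.
exact: (smallest_sub (@sigma_algebra_measurable _ T) (@cylinder_measurable J)).
Qed.

Lemma depends_on_comp (J : {set I}) f (g : R -> R) : measurable_fun setT g ->
  depends_on J f -> depends_on J (g \o f).
Proof. by move=> mg mf; exact: measurableT_comp. Qed.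

Lemma depends_on_cst (J : {set I}) (c : R) : depends_on J (fun=> c).
Proof. exact: measurable_cst. Qed.

Lemma depends_onD (J : {set I}) f g : depends_on J f -> depends_on J g ->
  depends_on J (fun t => f t + g t).
Proof. by move=> mf mg; exact: measurable_funD. Qed.

Lemma depends_onM (J : {set I}) f g : depends_on J f -> depends_on J g ->
  depends_on J (fun t => f t * g t).
Proof. by move=> mf mg; exact: measurable_funM. Qed.

Lemma depends_on_sum (J : {set I}) (K : finType) (A : {pred K}) (f : K -> T -> R) :
  (forall k, k \in A -> depends_on J (f k)) ->
  depends_on J (fun t => \sum_(k in A) f k t).
Proof.
move=> mf; rewrite (_ : (fun _ => _) = \sum_(k in A) f k); last first.
  by apply/funext => t; rewrite fct_sumE.
elim/big_ind : _ => [|f1 f2|//]; first exact: depends_on_cst.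
exact: depends_onD.
Qed.

Context (indepX : mutually_independent X).

Lemma indep_cylinder (J J' : {set I}) A A' : [disjoint J & J']%B ->
  cylinder J A -> cylinder J' A' -> P (A `&` A') = (P A * P A')%E.
Proof.
move=> dJ [B mB ->] [B' mB' ->].
pose C i := if i \in J then B i else B' i.
have mC i : measurable (C i) by rewrite /C; case: ifP.
rewrite (_ : _ `&` _ = \bigcap_(i in [set` J :|: J']) X i @^-1` C i); last first.
  apply/seteqP; split => t /=.
    move=> [h1 h2] i /=; rewrite inE /C; case: ifPn => iJ /=.
      by move=> _; exact: h1.
    by move=> iJ'; exact: h2.
  move=> h; split=> i /= iJ.
    by have := h i; rewrite /= !inE iJ /C iJ; exact.
  have := h i; rewrite /= !inE iJ orbT /C (disjointFl dJ iJ); exact.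
rewrite !indepX// (eq_bigl [predU J & J']) ?bigU//=; last first.
  by move=> i; rewrite !inE.
congr (_ * _)%E; apply: eq_bigr => i iJ; rewrite /C ?iJ//.
by rewrite (disjointFl dJ iJ).
Qed.

(** [indep_generated] is applied twice: it extends in [A] with [A'] fixed, then in [A'] with [A] a
    cylinder, which leaves the product rule for two cylinders. *)
Lemma indep_sigma (J J' : {set I}) A A' : [disjoint J & J']%B ->
  <<s cylinder J >> A -> <<s cylinder J' >> A' -> P (A `&` A') = (P A * P A')%E.
Proof.
move=> dJ sA sA'.
have mA' : measurable A'.
  exact: (smallest_sub (@sigma_algebra_measurable _ T) (@cylinder_measurable J')).
apply: indep_generated sA => //.
- exact: cylinder_measurable.
- exact: cylinder_setI_closed.
- exact: cylinder_setT.
move=> {}A cA; rewrite setIC muleC; apply: indep_generated sA' => //.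
- exact: cylinder_measurable.
- exact: cylinder_setI_closed.
- exact: cylinder_setT.
- exact: cylinder_measurable cA.
by move=> B cB; rewrite setIC muleC; exact: indep_cylinder cA cB.
Qed.

Lemma indep_depends (J J' : {set I}) f g (A B : set R) : [disjoint J & J']%B ->
  depends_on J f -> depends_on J' g -> measurable A -> measurable B ->
  P (f @^-1` A `&` g @^-1` B) = (P (f @^-1` A) * P (g @^-1` B))%E.
Proof.
move=> dJ mf mg mA mB; apply: (indep_sigma dJ).
  by have := mf measurableT A mA; rewrite setTI.
by have := mg measurableT B mB; rewrite setTI.
Qed.

End independence.

Section independent_pair.
Context d (T : measurableType d) (R : realType) (P : probability T R).
Local Open Scope ereal_scope.

(** The joint law of [(f, g)] agrees with the product of the marginals on rectangles, hence is the
    product measure, and Tonelli applies. With [h] nonnegative no integrability has to be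
    checked. *)
Lemma integral_indep_pair (f g : T -> R) (h : R * R -> \bar R) :
    measurable_fun setT f -> measurable_fun setT g ->
    (forall A B, measurable A -> measurable B ->
       P (f @^-1` A `&` g @^-1` B) = P (f @^-1` A) * P (g @^-1` B)) ->
    measurable_fun setT h -> (forall z, 0 <= h z) ->
  \int[P]_t h (f t, g t) = \int[P]_t \int[P]_s h (f t, g s).
Proof.
move=> mf mg fg mh h0.
have mfg : measurable_fun [set: T] (fun t => (f t, g t)).
  exact: measurable_fun_pair.
pose F : {RV P >-> R} := HB.pack f (isMeasurableFun.Build _ _ _ _ _ mf).
pose G : {RV P >-> R} := HB.pack g (isMeasurableFun.Build _ _ _ _ _ mg).
pose phi : {mfun T >-> (R * R)%type} := HB.pack (fun t => (f t, g t))
  (isMeasurableFun.Build _ _ _ _ _ mfg).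
transitivity (\int[distribution P phi]_z h z).
  by rewrite ge0_integral_distribution.
transitivity (\int[distribution P F \x distribution P G]_z h z).
  apply: eq_measure_integral => /= A mA _; apply/esym.
  by apply: product_measure_unique.
rewrite fubini_tonelli1// ge0_integral_distribution//; last 2 first.
- exact: measurable_fun_fubini_tonelli_F.
- by move=> y; apply: integral_ge0.
apply: eq_integral => t _ /=.
rewrite /fubini_F (@ge0_integral_distribution _ _ _ _ _ P G (fun y => h (f t, y)))//.
exact: (measurableT_comp mh (pair1_measurable _)).
Qed.

Lemma measurable_integral_pair (h : R * R -> \bar R) (g : T -> R) :
    measurable_fun setT g -> measurable_fun setT h -> (forall z, 0 <= h z) ->
  measurable_fun setT (fun y => \int[P]_t h (y, g t)).
Proof.
move=> mg mh h0.
have mh' : measurable_fun setT (fun yt : R * T => h (yt.1, g yt.2)).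
  apply: measurableT_comp => //; apply: measurable_fun_pair => //.
  exact: measurableT_comp.
exact: (measurable_fun_fubini_tonelli_F (m2 := P) _ mh').
Qed.

End independent_pair.

(** * Gaussian integrals *)

Section density.
Context d (T : measurableType d) (R : realType).
Context (mu nu : {measure set T -> \bar R}) (g : T -> R).
Context (mg : measurable_fun setT g) (g0 : forall x, 0 <= g x).
Context (nuE : forall A, measurable A -> nu A = (\int[mu]_(x in A) (g x)%:E)%E).
Import HBNNSimple.
Local Open Scope ereal_scope.

Lemma integral_density_nnsfun (f : {nnsfun T >-> R}) :
  \int[nu]_x (f x)%:E = \int[mu]_x (f x * g x)%:E.
Proof.
rewrite integralT_nnsfun sintegralE.
have mfg r : measurable_fun [set: T]
    (fun x => r%:E * (\1_(f @^-1` [set r]) x * g x)%:E).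
  by apply/measurable_EFinP/measurable_funM => //; apply: measurable_funM.
transitivity (\sum_(r \in range f)
    \int[mu]_x (r%:E * (\1_(f @^-1` [set r]) x * g x)%:E)); last first.
  rewrite -ge0_integral_fsum//.
  - apply: eq_integral => x _.
    rewrite [X in (X * g x)%:E]fimfunE mulr_fsuml -fsumEFin//.
    by apply: eq_fsbigr => r _; rewrite EFinM -mulrA.
  - move=> r x _; rewrite EFinM muleA mule_ge0 ?lee_fin//.
    exact: nnfun_muleindic_ge0.
apply: eq_fsbigr => r; rewrite inE => -[x _ <-].
rewrite ge0_integralZl//; last 3 first.
- apply/measurable_EFinP/measurable_funM => //.
- by move=> y _; rewrite lee_fin mulr_ge0.
- by rewrite lee_fin.
congr (_ * _); rewrite nuE// integral_mkcond; apply: eq_integral => y _.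
by rewrite patchE indicE; case: ifPn => _; rewrite ?mul1r ?mul0r.
Qed.

Lemma integral_density (f : T -> \bar R) : measurable_fun setT f ->
  (forall x, 0 <= f x) -> \int[nu]_x f x = \int[mu]_x (f x * (g x)%:E).
Proof.
move=> mf f0; pose f_ := nnsfun_approx measurableT mf.
have f_cvg x : (f_ n x)%:E @[n --> \oo] --> f x.
  by apply: cvg_nnsfun_approx => // y _; exact: f0.
transitivity (limn (fun n => \int[nu]_x (f_ n x)%:E)).
  rewrite -monotone_convergence//.
  - by apply: eq_integral => y _; apply/esym/cvg_lim => //; exact: f_cvg.
  - by move=> n; exact/measurable_EFinP/measurable_funP.
  - by move=> n y _; rewrite lee_fin.
  - by move=> y _ m n mn; rewrite lee_fin; exact/lefP/nd_nnsfun_approx.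
rewrite (_ : (fun _ => _) = (fun n => \int[mu]_x ((f_ n x)%:E * (g x)%:E))); last first.
  by apply/funext => n; rewrite integral_density_nnsfun.
rewrite -monotone_convergence//.
- apply: eq_integral => y _; apply/cvg_lim => //; apply: cvgeMr => //.
- by move=> n; apply/measurable_EFinP/measurable_funM => //; exact/measurable_funP.
- by move=> n y _; rewrite lee_fin mulr_ge0.
- by move=> y _ m n mn; rewrite lee_fin ler_wpM2r//; exact/lefP/nd_nnsfun_approx.
Qed.

End density.

Section gaussian.
Context (R : realType).
Notation mu := (@lebesgue_measure R).
Notation gam := (@normal_prob R 0 1).

(** By uniqueness of Lebesgue measure it suffices to measure half-open intervals. For [a < 0] the
    preimage of such an interval is closed at the other end, hence the two cases. *)
Lemma lebesgue_measure_affine (a b : R) (A : set R) : a != 0 -> measurable A ->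
  mu A = (`|a|%:E * mu ((fun x => (a * x + b)%R) @^-1` A))%E.
Proof.
move=> a0 mA.
have mf : measurable_fun [set: measurableTypeR R]
    (fun x : measurableTypeR R => a * x + b : measurableTypeR R).
  by apply: measurable_funD => //; apply: measurable_funM.
pose f : {mfun measurableTypeR R >-> measurableTypeR R} := 
  HB.pack (fun x : measurableTypeR R => a * x + b : measurableTypeR R)
  (isMeasurableFun.Build _ _ _ _ _ mf).
pose m2 : {measure set (measurableTypeR R) -> \bar R} :=
  mscale (NngNum (normr_ge0 a)) (pushforward mu f).
rewrite -[RHS]/(m2 mf A); apply: lebesgue_measure_unique => // _ [[u v]] _ <-/=.
rewrite /m2/= /mscale/= /pushforward/=.
have [a_gt0|a_lt0|/eqP] := ltgtP 0 a; last by rewrite eq_sym (negbTE a0).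
  rewrite (_ : _ @^-1` _ = `](u - b) / a, (v - b) / a]%classic); last first.
    apply/seteqP; split => x /=; rewrite !in_itv/= ltr_pdivrMr// ler_pdivlMr//
      lerBrDr ltrBlDr (mulrC a)//.
  rewrite !lebesgue_measure_itv/= !lte_fin ltr_pM2r ?invr_gt0// ltrD2r.
  case: ifP => _; rewrite ?mule0// -!EFinB -EFinM gtr0_norm//; congr EFin.
  by field; rewrite gt_eqF.
rewrite (_ : _ @^-1` _ = `[(v - b) / a, (u - b) / a[%classic); last first.
  apply/seteqP; split => x /=; rewrite !in_itv/= ltr_ndivlMr// ler_ndivrMr//
      lerBrDr ltrBlDr (mulrC a) andbC//.
rewrite !lebesgue_measure_itv/= !lte_fin ltr_nM2r ?invr_lt0// ltrD2r.
case: ifP => _; rewrite ?mule0// -!EFinB -EFinM ltr0_norm//; congr EFin.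
by field; rewrite lt_eqF.
Qed.

Lemma integral_affine (a b : R) (h : R -> \bar R) : a != 0 ->
  measurable_fun setT h -> (forall x, 0 <= h x)%E ->
  (\int[mu]_x h x = `|a|%:E * \int[mu]_x h (a * x + b)%R)%E.
Proof.
move=> a0 mh h0.
have mf : measurable_fun [set: measurableTypeR R]
    (fun x : measurableTypeR R => a * x + b : measurableTypeR R).
  by apply: measurable_funD => //; apply: measurable_funM.
pose f : {mfun measurableTypeR R >-> measurableTypeR R} := 
  HB.pack (fun x : measurableTypeR R => a * x + b : measurableTypeR R)
  (isMeasurableFun.Build _ _ _ _ _ mf).
rewrite -[X in (_ * X)%E](ge0_integral_pushforward mf mu (D := setT) (f := h))//.
rewrite -[`|a|]/((NngNum (normr_ge0 a))%:num).
rewrite -[RHS](ge0_integral_mscale (pushforward mu f) measurableT (NngNum (normr_ge0 a)) mh)//.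
apply: eq_measure_integral => A mA _.
exact: lebesgue_measure_affine.
Qed.

(** Isolates the universal constant [normal_peak 1], so that products of densities are compared by
    matching exponents only. *)
Lemma normal_pdfD (m s x : R) : s != 0 -> normal_pdf m s x =
  normal_peak 1 * (`|s|^-1 * expR (- ((x - m) ^+ 2 / (s ^+ 2 *+ 2)))).
Proof.
move=> s0; rewrite normal_pdfE// /normal_fun /normal_peak.
rewrite -mulrnAr sqrtrM ?sqr_ge0// sqrtr_sqr invfM expr1n mul1r mulNr.
by rewrite [in RHS]mulrCA mulrA.
Qed.

Lemma integral_normal_prob (h : R -> \bar R) : measurable_fun setT h ->
  (forall x, 0 <= h x)%E ->
  (\int[gam]_x h x = \int[mu]_x (h x * (normal_pdf 0 1 x)%:E))%E.
Proof.
move=> mh h0; apply: (@integral_density _ _ _ mu) => //.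
- exact: measurable_normal_pdf.
- exact: normal_pdf_ge0.
Qed.

Lemma integral_normal_affine (a b : R) (h : R -> \bar R) : a != 0 ->
  measurable_fun setT h -> (forall x, 0 <= h x)%E ->
  (\int[gam]_x h (a * x + b)%R = \int[mu]_x (h x * (normal_pdf b a x)%:E))%E.
Proof.
move=> a0 mh h0.
rewrite (integral_normal_prob (h := fun x => h (a * x + b)%R)); last 2 first.
- apply: measurableT_comp => //.
  by apply: measurable_funD => //; apply: measurable_funM.
- by move=> x; exact: h0.
rewrite [RHS](integral_affine b a0); last 2 first.
- by apply: emeasurable_funM => //; apply/measurable_EFinP; exact: measurable_normal_pdf.
- by move=> x; rewrite mule_ge0// lee_fin normal_pdf_ge0.
rewrite -ge0_integralZl//; last 2 first.
- apply: emeasurable_funM => /=.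
    apply: measurableT_comp => //.
    by apply: measurable_funD => //; apply: measurable_funM.
  apply/measurable_EFinP; apply: measurableT_comp; first exact: measurable_normal_pdf.
  by apply: measurable_funD => //; apply: measurable_funM.
- by move=> x _; rewrite mule_ge0// lee_fin normal_pdf_ge0.
apply: eq_integral => x _; rewrite muleCA -EFinM; congr (_ * _%:E)%E.
rewrite !normal_pdfD ?oner_neq0// [RHS]mulrCA; congr (_ * _).
rewrite mulrA divff ?normr_eq0// normr1 invr1 !mul1r; congr (expR (- _)).
by field.
Qed.

(** Symmetry of the standard normal law: it identifies [a] with [Num.sqrt (a ^+ 2)] when a
    convolution degenerates. *)
Lemma integral_normal_abs (a : R) (h : R -> \bar R) :
  measurable_fun setT h -> (forall x, 0 <= h x)%E ->
  (\int[gam]_x h (a * x)%R = \int[gam]_x h (`|a| * x)%R)%E.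
Proof.
move=> mh h0; have [->|a0] := eqVneq a 0; first by rewrite normr0.
under eq_integral do rewrite -[(a * _)%R]addr0.
under [RHS]eq_integral do rewrite -[(`|a| * _)%R]addr0.
rewrite !integral_normal_affine ?normr_eq0; [|by []..]; apply: eq_integral => x _.
by rewrite !normal_pdfD ?normr_eq0// normr_id real_normK ?num_real.
Qed.

(** Completing the square turns the integrand into a constant times the normal density of mean
    [c / v] and deviation [1 / sqrt v], with [v = 1 - 2 t]. *)
Lemma integral_normal_expR_quad (t c : R) : t < 2^-1 ->
  (\int[gam]_x (expR (t * x ^+ 2 + c * x))%:E =
   ((Num.sqrt (1 - 2 * t))^-1 * expR (c ^+ 2 / (2 * (1 - 2 * t))))%:E)%E.
Proof.
move=> t2; have v0 : 0 < 1 - 2 * t by lra.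
set v := 1 - 2 * t in v0 *.
have s0 : (Num.sqrt v)^-1 != 0 by rewrite invr_eq0 sqrtr_eq0 -ltNge.
have s2 : (Num.sqrt v)^-1 ^+ 2 = v^-1 by rewrite exprVn sqr_sqrtr// ltW.
rewrite integral_normal_prob; last 2 first.
- apply/measurable_EFinP; apply: measurableT_comp => //.
  by apply: measurable_funD => //; apply: measurable_funM.
- by move=> x; rewrite lee_fin expR_ge0.
transitivity (\int[mu]_x (((Num.sqrt v)^-1 * expR (c ^+ 2 / (2 * v)))%:E *
   (normal_pdf (c / v) (Num.sqrt v)^-1 x)%:E))%E.
  apply: eq_integral => x _; rewrite -!EFinM; congr EFin.
  rewrite !normal_pdfD ?oner_neq0// s2 normr1 invr1 mul1r.
  rewrite ger0_norm ?invr_ge0 ?sqrtr_ge0// invrK.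
  set q := Num.sqrt v; set e := expR (c ^+ 2 / _); set r := normal_peak 1.
  rewrite [LHS]mulrCA [RHS](_ : _ = r * ((q^-1 * q) * (e *
    expR (- ((x - c / v) ^+ 2 / (v^-1 *+ 2)))))); last by ring.
  rewrite mulVf ?mul1r; last by rewrite sqrtr_eq0 -ltNge.
  congr (_ * _).
  rewrite -!expRD; congr expR; rewrite /v; field.
  by rewrite gt_eqF.
rewrite ge0_integralZl//.
- by rewrite integral_normal_pdf mule1.
- apply/measurable_EFinP; exact: measurable_normal_pdf.
- move=> x _; rewrite lee_fin; exact: normal_pdf_ge0.
Qed.

(** The weight is the ratio of the centred normal density of variance [s] to the standard one. This
    is the one-row case of [quad_scale]. *)
Lemma integral_normal_scale (s : R) (h : R -> \bar R) : 0 < s ->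
  measurable_fun setT h -> (forall x, 0 <= h x)%E ->
  (\int[gam]_x h (s * x ^+ 2)%R = \int[gam]_x (h (x ^+ 2)%R *
     ((Num.sqrt s)^-1 * expR ((1 - s^-1) * x ^+ 2 / 2))%:E))%E.
Proof.
move=> s0 mh h0; have q0 : Num.sqrt s != 0 by rewrite sqrtr_eq0 -ltNge.
have mh2 : measurable_fun [set: R] (fun x => h (x ^+ 2)) by apply: measurableT_comp.
transitivity (\int[gam]_x h ((Num.sqrt s * x + 0) ^+ 2)%R)%E.
  by apply: eq_integral => x _; rewrite addr0 exprMn sqr_sqrtr// ltW.
rewrite (@integral_normal_affine _ _ (fun x => h (x ^+ 2)%R)); [|by []|by []|by []].
rewrite integral_normal_prob; last 2 first.
- apply: emeasurable_funM => //; apply/measurable_EFinP; apply: measurable_funM => //.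
  apply: measurableT_comp => //; apply: measurable_funM => //.
  by apply: measurable_funM.
- by move=> x; rewrite mule_ge0// lee_fin mulr_ge0 ?expR_ge0// invr_ge0 sqrtr_ge0.
apply: eq_integral => x _; rewrite -muleA -EFinM; congr (_ * _%:E)%E.
rewrite !normal_pdfD ?oner_neq0// normr1 invr1 mul1r sqr_sqrtr ?ltW//.
rewrite ger0_norm ?sqrtr_ge0// !subr0 expr1n.
set q := Num.sqrt s; set r := normal_peak 1; set e := expR (_ * _ / _).
rewrite [RHS](_ : _ = r * (q^-1 * (e * expR (- (x ^+ 2 / (1 *+ 2)))))); last by ring.
congr (_ * (_ * _)); rewrite /e -expRD; congr expR; field.
by rewrite gt_eqF.
Qed.

(** After Tonelli the joint density factors as the law of [z = a x + b y] times the conditional law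
    of [x] given [z], normal with mean [a z / v] and deviation [b / sqrt v]; the latter integrates
    to 1. The case [b = 0] is separate because [b y] then has no density. *)
Lemma normal_convolution (a b : R) (h : R -> \bar R) :
  measurable_fun setT h -> (forall x, 0 <= h x)%E ->
  (\int[gam]_x \int[gam]_y h (a * x + b * y)%R =
   \int[gam]_z h (Num.sqrt (a ^+ 2 + b ^+ 2) * z)%R)%E.
Proof.
move=> mh h0; have [->|b0] := eqVneq b 0.
  under eq_integral => x _.
    under eq_integral do rewrite mul0r addr0.
    rewrite integral_cst//= probability_setT mule1; over.
  by rewrite expr0n addr0 sqrtr_sqr integral_normal_abs.
set v := a ^+ 2 + b ^+ 2.
have v0 : 0 < v by rewrite ltr_wpDl ?sqr_ge0// exprn_even_gt0.
have q0 : Num.sqrt v != 0 by rewrite sqrtr_eq0 -ltNge.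
have q2 : Num.sqrt v ^+ 2 = v by rewrite sqr_sqrtr// ltW.
transitivity (\int[gam]_x \int[mu]_z (h z * (normal_pdf (a * x) b z)%:E))%E.
  apply: eq_integral => x _; under eq_integral do rewrite addrC.
  by rewrite integral_normal_affine.
pose F0 (xz : R * R) := (h xz.2 * (normal_pdf (a * xz.1) b xz.2)%:E)%E.
have mF0 : measurable_fun setT F0.
  apply: emeasurable_funM; first exact: measurableT_comp.
  apply/measurable_EFinP.
  rewrite [X in measurable_fun _ X](_ : _ = fun xz : R * R => normal_peak 1 *
    (`|b|^-1 * expR (- ((xz.2 - a * xz.1) ^+ 2 / (b ^+ 2 *+ 2))))); last first.
    by apply/funext => xz; rewrite normal_pdfD.
  do 2 apply: measurable_funM => //; apply: measurableT_comp => //.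
  apply: measurable_funN; apply: measurable_funM => //.
  apply: measurable_funX; apply: measurable_funB => //.
  exact: measurable_funM.
pose F (xz : R * R) := (F0 xz * (normal_pdf 0 1 xz.1)%:E)%E.
have mF : measurable_fun setT F.
  apply: emeasurable_funM => //; apply/measurable_EFinP.
  by apply: measurableT_comp => //; exact: measurable_normal_pdf.
have F0_ge0 z : (0 <= F0 z)%E by rewrite mule_ge0// lee_fin normal_pdf_ge0.
have F_ge0 z : (0 <= F z)%E by rewrite mule_ge0// lee_fin normal_pdf_ge0.
rewrite integral_normal_prob; last 2 first.
- exact: (measurable_fun_fubini_tonelli_F (m2 := mu) F0).
- by move=> x; apply: integral_ge0 => z _; rewrite mule_ge0// lee_fin normal_pdf_ge0.
transitivity (\int[mu]_x \int[mu]_z F (x, z))%E.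
  apply: eq_integral => x _; rewrite /F /= ge0_integralZr; [by []|by []|..].
  - exact: (measurableT_comp mF0 (pair1_measurable x)).
  - by [].
  - by rewrite lee_fin; exact: normal_pdf_ge0.
rewrite fubini_tonelli//.
under [RHS]eq_integral do rewrite -[(_ * _)%R]addr0.
rewrite integral_normal_affine; [|by []..]; apply: eq_integral => z _.
transitivity (\int[mu]_x ((h z * (normal_pdf 0 (Num.sqrt v) z)%:E) *
   (normal_pdf (a * z / v) (b / Num.sqrt v) x)%:E))%E; last first.
  rewrite ge0_integralZl; [|by []|..].
  - by rewrite integral_normal_pdf mule1.
  - by apply/measurable_EFinP; exact: measurable_normal_pdf.
  - by move=> x _; rewrite lee_fin; exact: normal_pdf_ge0.
  - by rewrite mule_ge0// lee_fin normal_pdf_ge0.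
apply: eq_integral => x _; rewrite /F /F0/= -!muleA -!EFinM; congr (_ * _%:E)%E.
have bq0 : b / Num.sqrt v != 0 by rewrite mulf_neq0// invr_eq0.
rewrite !normal_pdfD ?oner_neq0// normr1 invr1 mul1r !subr0.
rewrite q2 expr_div_n q2 normrM normfV invfM invrK (ger0_norm (sqrtr_ge0 _)).
set p := normal_peak 1; set q := Num.sqrt v.
rewrite [LHS](_ : _ = p * p * `|b|^-1 * (expR (- ((z - a * x) ^+ 2 / (b ^+ 2 *+ 2))) * expR (- (x ^+ 2 / (1 ^+ 2 *+ 2))))); last by ring.
rewrite [RHS](_ : _ = p * p * `|b|^-1 * (q^-1 * q) * (expR (- (z ^+ 2 / (v *+ 2))) * expR (- ((x - a * z / v) ^+ 2 / (b ^+ 2 / v *+ 2))))); last by ring.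
rewrite mulVf// mulr1 -!expRD; congr (_ * expR _); rewrite /v; field.
by rewrite b0 -/v gt_eqF.
Qed.

End gaussian.

(** * Linear and quadratic forms of a Gaussian matrix *)

Section gaussian_matrix.
Context d (T : measurableType d) (R : realType) (P : probability T R).
Context (n p : nat) (x : 'I_n -> 'I_p -> {RV P >-> R}).
Notation gam := (@normal_prob R 0 1).
Notation X := (fun ij : 'I_n * 'I_p => x ij.1 ij.2).

Definition sqnorm (u : 'I_p -> R) : R := \sum_j u j ^+ 2.
Definition lin (u : 'I_p -> R) (i : 'I_n) (t : T) : R := \sum_j x i j t * u j.
Definition quad (u : 'I_p -> R) (t : T) : R := \sum_i lin u i t ^+ 2.

Lemma depends_on_lin (J : {set 'I_n * 'I_p}) (A : {set 'I_p}) u i :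
  (forall j, j \notin A -> u j = 0) -> (forall j, j \in A -> (i, j) \in J) ->
  depends_on X J (lin u i).
Proof.
move=> uA AJ; rewrite (_ : lin u i = fun t => \sum_(j in A) x i j t * u j).
  apply: depends_on_sum => j jA; apply: depends_onM; last exact: depends_on_cst.
  by apply: (@depends_on_id _ _ _ _ _ X _ (i, j)); exact: AJ.
apply/funext => t; rewrite /lin [RHS]big_mkcond; apply: eq_bigr => j _.
by case: ifPn => // /uA ->; rewrite mulr0.
Qed.

Lemma depends_on_quad (A : {set 'I_p}) u : (forall j, j \notin A -> u j = 0) ->
  depends_on X [set ij | ij.2 \in A] (quad u).
Proof.
move=> uA; rewrite (_ : quad u = fun t => \sum_(i in 'I_n) lin u i t ^+ 2)//.
apply: depends_on_sum => i _; apply: (@depends_on_comp _ _ _ _ _ X _ _ (fun z : R => z ^+ 2)) => //.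
by apply: depends_on_lin uA _ => j jA; rewrite inE.
Qed.

Lemma depends_on_row (u : 'I_p -> R) i : depends_on X [set ij | ij.1 == i] (lin u i).
Proof.
by apply: (@depends_on_lin _ [set: 'I_p]%SET) => j; rewrite !inE//=.
Qed.

Lemma measurable_lin u i : measurable_fun setT (lin u i).
Proof. exact: (depends_on_measurable (@depends_on_row u i)). Qed.

Lemma measurable_quad u : measurable_fun setT (quad u).
Proof.
by apply: (depends_on_measurable (@depends_on_quad [set: 'I_p]%SET u _)) => j; rewrite inE.
Qed.

Context (Hnormal : forall i j, standard_normal (x i j)).
Context (Hindep : mutually_independent X).

Lemma indep_integral (J J' : {set 'I_n * 'I_p}) f g (h : R * R -> \bar R) :
  [disjoint J & J']%B -> depends_on X J f -> depends_on X J' g ->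
  measurable_fun setT h -> (forall z, 0 <= h z)%E ->
  (\int[P]_t h (f t, g t) = \int[P]_t \int[P]_s h (f t, g s))%E.
Proof.
move=> JJ' df dg; apply: integral_indep_pair.
- exact: depends_on_measurable df.
- exact: depends_on_measurable dg.
- by move=> A B mA mB; exact: indep_depends JJ' df dg mA mB.
Qed.

Lemma integral_standard_normal i j (h : R -> \bar R) : measurable_fun setT h ->
  (forall y, 0 <= h y)%E -> (\int[P]_t h (x i j t) = \int[gam]_y h y)%E.
Proof.
move=> mh h0.
transitivity (\int[distribution P (x i j)]_y h y)%E.
  by rewrite ge0_integral_distribution.
(* [normal_prob] lives on [measurableTypeR R], whose display is not that of
   [R]: transport along the identity. *)
have mid : measurable_fun [set: measurableTypeR R] (id : measurableTypeR R -> R).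
  by move=> _ B mB; rewrite setTI.
rewrite -[RHS](ge0_integral_pushforward mid gam (D := setT) (f := h)); [|by []..].
by apply: eq_measure_integral => A mA _; exact: Hnormal.
Qed.

(** Columns are added one at a time: each new term is independent of the sum of the others, and
    [normal_convolution] adds the variances. The test function is generalised because the induction
    hypothesis is used on a translate of [h]. *)
Lemma lin_law u i (h : R -> \bar R) : measurable_fun setT h ->
  (forall y, 0 <= h y)%E ->
  (\int[P]_t h (lin u i t) = \int[gam]_z h (Num.sqrt (sqnorm u) * z)%R)%E.
Proof.
rewrite /lin /sqnorm; elim: (index_enum _) (index_enum_uniq 'I_p) h => [|j s IH] /=.
  move=> _ h mh h0; rewrite big_nil sqrtr0.
  under eq_integral do rewrite big_nil.
  under [RHS]eq_integral do rewrite mul0r.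
  by rewrite !integral_cst//= !probability_setT.
move=> /andP[js us] h mh h0; rewrite big_cons.
under eq_integral do rewrite big_cons.
pose f t := x i j t * u j.
pose g t := \sum_(k <- s) x i k t * u k.
have df : depends_on X [set (i, j)] f.
  apply: depends_onM; last exact: depends_on_cst.
  by apply: (@depends_on_id _ _ _ _ _ X _ (i, j)); rewrite inE.
have dg : depends_on X [set ij | ij.2 \in s] g.
  rewrite (_ : g = fun t => \sum_(k in [set k | k \in s]%SET) x i k t * u k); last first.
    apply/funext => t; rewrite /g big_uniq//=; apply: eq_bigl => k; rewrite inE//.
  apply: depends_on_sum => k; rewrite inE => ks.
  apply: depends_onM; last exact: depends_on_cst.
  by apply: (@depends_on_id _ _ _ _ _ X _ (i, k)); rewrite inE.
have mh' : measurable_fun setT (fun z : R * R => h (z.1 + z.2)).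
  by apply: measurableT_comp => //; exact: measurable_funD.
rewrite (@indep_integral _ _ f g (fun z => h (z.1 + z.2)%R) _ df dg)//=; last first.
  by rewrite disjoints1 inE.
transitivity (\int[P]_t \int[gam]_z h (u j * x i j t +
   Num.sqrt (\sum_(k <- s) u k ^+ 2) * z)%R)%E.
  apply: eq_integral => t _.
  rewrite (IH us (fun y => h (f t + y)%R))//.
    by under eq_integral do rewrite /f mulrC.
  by apply: measurableT_comp => //; exact: measurable_funD.
pose q := Num.sqrt (\sum_(k <- s) u k ^+ 2).
have mh2 : measurable_fun setT (fun z : R * R => h (u j * z.1 + q * z.2)).
  by apply: measurableT_comp => //; apply: measurable_funD; exact: measurable_funM.
rewrite (integral_standard_normal i j (h := fun y => \int[gam]_z h (u j * y + q * z)%R)%E); last 2 first.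
- exact: (measurable_fun_fubini_tonelli_F (m2 := gam) _ mh2).
- by move=> y; exact: integral_ge0.
rewrite normal_convolution// sqr_sqrtr//.
by apply: sumr_ge0 => k _; exact: sqr_ge0.
Qed.

Lemma lin_expR_pair (u v : 'I_p -> R) i (a b : R) : sqnorm u = 1 -> sqnorm v = 1 ->
  (\int[P]_t (expR (a * lin u i t + b * lin v i t))%:E =
   (expR ((a ^+ 2 + 2 * a * b * (\sum_j u j * v j) + b ^+ 2) / 2))%:E)%E.
Proof.
move=> u1 v1; pose w j := a * u j + b * v j.
transitivity (\int[P]_t (expR (lin w i t))%:E)%E.
  apply: eq_integral => t _; congr (expR _)%:E; rewrite /lin !mulr_sumr -big_split/=.
  by apply: eq_bigr => j _; rewrite /w; ring.
rewrite (@lin_law w i (fun y => (expR y)%:E)); last 2 first.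
- exact/measurable_EFinP.
- by move=> y; rewrite lee_fin expR_ge0.
transitivity (\int[gam]_z (expR (0 * z ^+ 2 + Num.sqrt (sqnorm w) * z))%:E)%E.
  by apply: eq_integral => z _; rewrite mul0r add0r.
rewrite integral_normal_expR_quad// mulr0 subr0 sqrtr1 invr1 mul1r mulr1.
rewrite sqr_sqrtr; last by apply: sumr_ge0 => k _; exact: sqr_ge0.
have -> // : sqnorm w = a ^+ 2 + 2 * a * b * (\sum_j u j * v j) + b ^+ 2.
transitivity (a ^+ 2 * sqnorm u + 2 * a * b * (\sum_j u j * v j) + b ^+ 2 * sqnorm v).
  rewrite /sqnorm !mulr_sumr -!big_split/=.
  by apply: eq_bigr => j _; rewrite /w; ring.
by rewrite u1 v1 !mulr1.
Qed.

Lemma lin_expR_sqr (u : 'I_p -> R) i (t : R) : sqnorm u = 1 -> t < 2^-1 ->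
  (\int[P]_w (expR (t * lin u i w ^+ 2))%:E = ((Num.sqrt (1 - 2 * t))^-1)%:E)%E.
Proof.
move=> u1 t2; rewrite (@lin_law u i (fun y => (expR (t * y ^+ 2))%:E)); last 2 first.
- apply/measurable_EFinP; apply: measurableT_comp => //.
  exact: measurable_funM.
- by move=> y; rewrite lee_fin expR_ge0.
transitivity (\int[gam]_z (expR (t * z ^+ 2 + 0 * z))%:E)%E.
  by apply: eq_integral => z _; rewrite u1 sqrtr1 mul1r mul0r addr0.
by rewrite integral_normal_expR_quad// expr0n mul0r expR0 mulr1.
Qed.

(** The square is linearised by an auxiliary standard normal [g]: exp (t y^2) is the mean of exp
    (sqrt (2 t) g y). Once the integrals are exchanged, only exponential moments of linear forms are
    left, followed by a Gaussian integral in [g]. *)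
Lemma lin_expR_sqr_lin (u v : 'I_p -> R) i (t k r : R) : sqnorm u = 1 -> sqnorm v = 1 ->
  \sum_j u j * v j = r -> 0 <= t -> t < 2^-1 ->
  (\int[P]_w (expR (t * lin v i w ^+ 2 + k * lin u i w))%:E =
   ((Num.sqrt (1 - 2 * t))^-1 *
     expR (k ^+ 2 * (2^-1 + t * r ^+ 2 / (1 - 2 * t))))%:E)%E.
Proof.
move=> u1 v1 uv t0 t2; pose c := Num.sqrt (2 * t).
have c2 : c ^+ 2 = 2 * t by rewrite sqr_sqrtr// mulr_ge0.
transitivity (\int[P]_w \int[gam]_g (expR (k * lin u i w + (g * c) * lin v i w))%:E)%E.
  apply: eq_integral => w _.
  transitivity (\int[gam]_g ((expR (k * lin u i w))%:E * (expR (0 * g ^+ 2 + (c * lin v i w) * g))%:E))%E; last first.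
    apply: eq_integral => g _; rewrite -EFinM -expRD; congr (expR _)%:E; ring.
  rewrite integral_EFinZl; last 3 first.
  - apply: measurableT_comp => //.
    by apply: measurable_funD; apply: measurable_funM => //.
  - by move=> g; exact: expR_ge0.
  - exact: expR_ge0.
  rewrite integral_normal_expR_quad; [|by []]; rewrite mulr0 subr0 sqrtr1 invr1 mul1r -EFinM -expRD.
  by congr (expR _)%:E; rewrite exprMn c2; field.
rewrite (fubini_tonelli (m1 := P) (m2 := gam) (fun z => (expR (k * lin u i z.1 + (z.2 * c) * lin v i z.1))%:E)); last 2 first.
- apply/measurable_EFinP; apply: measurableT_comp => //.
  apply: measurable_funD.
    by apply: measurable_funM => //; apply: measurableT_comp => //; exact: measurable_lin.
  apply: measurable_funM; first exact: measurable_funM.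
  by apply: measurableT_comp => //; exact: measurable_lin.
- by move=> z; rewrite lee_fin expR_ge0.
transitivity (\int[gam]_g ((expR (k ^+ 2 / 2))%:E * (expR (t * g ^+ 2 + (k * c * r) * g))%:E))%E.
  apply: eq_integral => g _; rewrite [LHS](lin_expR_pair i k (g * c) u1 v1) uv -EFinM -expRD.
  by congr (expR _)%:E; rewrite exprMn c2; field.
rewrite integral_EFinZl; last 3 first.
- apply: measurableT_comp => //.
  by apply: measurable_funD; apply: measurable_funM => //.
- by move=> g; exact: expR_ge0.
- exact: expR_ge0.
rewrite integral_normal_expR_quad; [|by []]; rewrite -EFinM mulrCA -expRD.
congr (_ * expR _)%:E; rewrite !exprMn c2; field.
by rewrite gt_eqF; last lra.
Qed.

Lemma lin_expR_sqr_pair (u v : 'I_p -> R) i (t r : R) : sqnorm u = 1 -> sqnorm v = 1 ->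
  \sum_j u j * v j = r -> 0 <= r <= 1 -> 0 <= t -> t < 4^-1 ->
  (\int[P]_w (expR (t * (lin u i w ^+ 2 + lin v i w ^+ 2)))%:E =
   ((Num.sqrt ((1 - 2 * t * (1 + r)) * (1 - 2 * t * (1 - r))))^-1)%:E)%E.
Proof.
move=> u1 v1 uv r01 t0 t4; pose c := Num.sqrt (2 * t).
have c2 : c ^+ 2 = 2 * t by rewrite sqr_sqrtr// mulr_ge0.
transitivity (\int[P]_w \int[gam]_g (expR (t * lin v i w ^+ 2 + (g * c) * lin u i w))%:E)%E.
  apply: eq_integral => w _.
  transitivity (\int[gam]_g ((expR (t * lin v i w ^+ 2))%:E * (expR (0 * g ^+ 2 + (c * lin u i w) * g))%:E))%E; last first.
    apply: eq_integral => g _; rewrite -EFinM -expRD; congr (expR _)%:E; ring.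
  rewrite integral_EFinZl; last 3 first.
  - apply: measurableT_comp => //.
    by apply: measurable_funD; apply: measurable_funM => //.
  - by move=> g; exact: expR_ge0.
  - exact: expR_ge0.
  rewrite integral_normal_expR_quad; [|by []]; rewrite mulr0 subr0 sqrtr1 invr1 mul1r -EFinM -expRD.
  by congr (expR _)%:E; rewrite exprMn c2; field.
rewrite (fubini_tonelli (m1 := P) (m2 := gam) (fun z => (expR (t * lin v i z.1 ^+ 2 + (z.2 * c) * lin u i z.1))%:E)); last 2 first.
- apply/measurable_EFinP; apply: measurableT_comp => //.
  apply: measurable_funD.
    apply: measurable_funM => //; apply: measurable_funX.
    by apply: measurableT_comp => //; exact: measurable_lin.
  apply: measurable_funM; first exact: measurable_funM.
  by apply: measurableT_comp => //; exact: measurable_lin.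
- by move=> z; rewrite lee_fin expR_ge0.
have t2 : t < 2^-1 by lra.
have v0 : 0 < 1 - 2 * t by lra.
have r2 : r ^+ 2 <= 1 by rewrite expr_le1//; lra.
pose s := 2 * t * (2^-1 + t * r ^+ 2 / (1 - 2 * t)).
(* The determinant of [1 - 2 t G], where [G] is the Gram matrix of [u] and [v], with eigenvalues
   [1 + r] and [1 - r]. The left side is what two successive Gaussian integrations produce. *)
have sE : (1 - 2 * t) * (1 - 2 * s) = (1 - 2 * t * (1 + r)) * (1 - 2 * t * (1 - r)).
  by rewrite /s; field; rewrite gt_eqF.
have s2 : s < 2^-1.
  suff : 0 < 1 - 2 * s by lra.
  rewrite -(pmulr_rgt0 _ v0) sE mulr_gt0//.
    by move: r01 => /andP[r0 r1]; nra.
  by move: r01 => /andP[r0 r1]; nra.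
transitivity (\int[gam]_g (((Num.sqrt (1 - 2 * t))^-1)%:E * (expR (s * g ^+ 2 + 0 * g))%:E))%E.
  apply: eq_integral => g _; rewrite [LHS](lin_expR_sqr_lin i (g * c) u1 v1 uv t0 t2).
  rewrite -EFinM; congr (_ * expR _)%:E; rewrite /s exprMn c2; ring.
rewrite integral_EFinZl; last 3 first.
- apply: measurableT_comp => //.
  by apply: measurable_funD; apply: measurable_funM => //.
- by move=> g; exact: expR_ge0.
- by rewrite invr_ge0 sqrtr_ge0.
rewrite integral_normal_expR_quad; [|by []]; rewrite expr0n/= mul0r expR0 mulr1 -EFinM.
by rewrite -sE (sqrtrM _ (ltW v0)) invfM.
Qed.

Lemma integral_prod_rows (F : 'I_n -> T -> R) (c : R) :
  (forall i, depends_on X [set ij | ij.1 == i] (F i)) ->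
  (forall i t, 0 <= F i t) ->
  (forall i, \int[P]_t (F i t)%:E = c%:E)%E ->
  (\int[P]_t (\prod_i F i t)%:E = (c ^+ n)%:E)%E.
Proof.
move=> dF F0 Fc.
suff H (s : seq 'I_n) : uniq s -> (\int[P]_t (\prod_(i <- s) F i t)%:E = (c ^+ size s)%:E)%E.
  by rewrite -[in RHS](card_ord n) cardT enumT; apply: H; rewrite index_enum_uniq.
elim: s => [_|i s IH /= /andP[si us]].
  by under eq_integral do rewrite big_nil; rewrite integral_cst//= probability_setT mule1.
pose G t := \prod_(k <- s) F k t.
have dG : depends_on X [set ij | ij.1 \in s] G.
  rewrite /G; elim: s {IH si us G} => [|k s IH].
    have -> : (fun t => \prod_(k <- [::]) F k t) = fun=> 1.
      by apply/funext => t; rewrite big_nil.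
    exact: depends_on_cst.
  have -> : (fun t => \prod_(k <- k :: s) F k t) =
      fun t => F k t * \prod_(k <- s) F k t.
    by apply/funext => t; rewrite big_cons.
  apply: depends_onM.
    apply: depends_on_sub (dF k); apply/fintype.subsetP => ij.
    by rewrite !inE => ->.
  apply: depends_on_sub IH; apply/fintype.subsetP => ij.
  by rewrite !inE => ->; rewrite orbT.
have dis : [disjoint [set ij : 'I_n * 'I_p | ij.1 == i]%SET & [set ij | ij.1 \in s]%SET]%B.
  apply/pred0P => ij /=; rewrite !inE; apply/negP => /andP[/eqP ->].
  exact/negP.
under eq_integral do rewrite big_cons.
have G0 t : 0 <= G t by apply: prodr_ge0.
(* The test function has to be nonnegative on the whole plane; the product of positive parts agrees
   with the product at the values actually taken. *)
pose h (z : R * R) := (Num.max 0 z.1 * Num.max 0 z.2)%:E.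
have mh : measurable_fun setT h.
  by apply/measurable_EFinP; apply: measurable_funM; apply: measurable_maxr.
have h0 z : (0 <= h z)%E by rewrite lee_fin mulr_ge0// le_max lexx.
transitivity (\int[P]_t h (F i t, G t))%E.
  by apply: eq_integral => t _; rewrite /h/= !max_r.
rewrite (indep_integral dis (dF i) dG mh h0).
transitivity (\int[P]_t ((c ^+ size s)%:E * (F i t)%:E))%E.
  apply: eq_integral => t _; rewrite /h/=.
  transitivity (\int[P]_s ((F i t)%:E * (G s)%:E))%E.
    by apply: eq_integral => w _; rewrite !max_r ?EFinM.
  rewrite integral_EFinZl; [|exact: depends_on_measurable dG|by []..].
  by rewrite IH// muleC.
have cs0 : 0 <= c ^+ size s.
  have : (0 <= \int[P]_t (G t)%:E)%E by apply: integral_ge0 => t _; rewrite lee_fin.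
  by rewrite IH.
rewrite integral_EFinZl; [|exact: depends_on_measurable (dF i)|by []..].
by rewrite Fc -EFinM -exprSr.
Qed.

Lemma quad_expR (u : 'I_p -> R) (t : R) : sqnorm u = 1 -> t < 2^-1 ->
  (\int[P]_w (expR (t * quad u w))%:E = ((Num.sqrt (1 - 2 * t))^-1 ^+ n)%:E)%E.
Proof.
move=> u1 t2; transitivity (\int[P]_w (\prod_i expR (t * lin u i w ^+ 2))%:E)%E.
  by apply: eq_integral => w _; rewrite /quad mulr_sumr expR_sum.
apply: (integral_prod_rows (F := fun i w => expR (t * lin u i w ^+ 2))).
- move=> i; apply: (@depends_on_comp _ _ _ _ _ X _ (lin u i) (fun z => expR (t * z ^+ 2))).
    by apply: measurableT_comp => //; exact: measurable_funM.
  exact: depends_on_row.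
- by move=> i w; exact: expR_ge0.
- by move=> i; exact: lin_expR_sqr.
Qed.

Lemma quad_expR_pair (u v : 'I_p -> R) (t r : R) : sqnorm u = 1 -> sqnorm v = 1 ->
  \sum_j u j * v j = r -> 0 <= r <= 1 -> 0 <= t -> t < 4^-1 ->
  (\int[P]_w (expR (t * (quad u w + quad v w)))%:E =
   ((Num.sqrt ((1 - 2 * t * (1 + r)) * (1 - 2 * t * (1 - r))))^-1 ^+ n)%:E)%E.
Proof.
move=> u1 v1 uv r01 t0 t4.
transitivity (\int[P]_w (\prod_i expR (t * (lin u i w ^+ 2 + lin v i w ^+ 2)))%:E)%E.
  by apply: eq_integral => w _; rewrite /quad -big_split mulr_sumr expR_sum.
apply: (integral_prod_rows (F := fun i w => expR (t * (lin u i w ^+ 2 + lin v i w ^+ 2)))).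
- move=> i.
  apply: (@depends_on_comp _ _ _ _ _ X _ (fun w => t * (lin u i w ^+ 2 + lin v i w ^+ 2)) expR) => //.
  apply: depends_onM; first exact: depends_on_cst.
  by apply: depends_onD; apply: (@depends_on_comp _ _ _ _ _ X _ (lin _ i) (fun z : R => z ^+ 2)) => //; exact: depends_on_row.
- by move=> i w; exact: expR_ge0.
- by move=> i; exact: lin_expR_sqr_pair.
Qed.

(* The law of [quad u] has density proportional to [r^(n/2-1) exp (-r/2)]; this
   is the resulting change of scale. *)
Lemma quad_scale (u : 'I_p -> R) (s : R) (h : R -> \bar R) : sqnorm u = 1 -> 0 < s ->
  measurable_fun setT h -> (forall y, 0 <= h y)%E ->
  (\int[P]_w h (s * quad u w)%R = \int[P]_w (h (quad u w) *
     ((Num.sqrt s)^-1 ^+ n * expR ((1 - s^-1) * quad u w / 2))%:E))%E.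
Proof.
move=> u1 s0.
have wt_ge0 k (a : R) : 0 <= (Num.sqrt s)^-1 ^+ k * expR a.
  by rewrite mulr_ge0 ?expR_ge0// exprn_ge0// invr_ge0 sqrtr_ge0.
suff H (l : seq 'I_n) : uniq l -> forall h : R -> \bar R,
    measurable_fun setT h -> (forall y, 0 <= h y)%E ->
  (\int[P]_w h (s * \sum_(i <- l) lin u i w ^+ 2)%R =
   \int[P]_w (h (\sum_(i <- l) lin u i w ^+ 2)%R *
     ((Num.sqrt s)^-1 ^+ size l * expR ((1 - s^-1) * (\sum_(i <- l) lin u i w ^+ 2)%R / 2))%:E))%E.
  move=> mh h0; rewrite H; [|exact: index_enum_uniq|by []..].
  by rewrite -[in RHS](card_ord n) cardT enumT.
elim: l {h} => [_|i l IH /= /andP[il ul]] h mh h0.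
  apply: eq_integral => w _.
  by rewrite !big_nil/= expr0 mul1r !mulr0 mul0r expR0 mule1.
pose Q w := \sum_(k <- l) lin u k w ^+ 2.
have dQ : depends_on X [set ij | ij.1 \in l] Q.
  rewrite /Q; elim: l {IH il ul Q} => [|k l IH].
    have -> : (fun t => \sum_(k <- [::]) lin u k t ^+ 2) = fun=> 0.
      by apply/funext => t; rewrite big_nil.
    exact: depends_on_cst.
  have -> : (fun t => \sum_(k <- k :: l) lin u k t ^+ 2) =
      fun t => lin u k t ^+ 2 + \sum_(k <- l) lin u k t ^+ 2.
    by apply/funext => t; rewrite big_cons.
  apply: depends_onD.
    apply: depends_on_sub; last first.
      apply: (@depends_on_comp _ _ _ _ _ X _ (lin _ k) (fun z : R => z ^+ 2)) => //; exact: depends_on_row.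
    by apply/fintype.subsetP => ij; rewrite !inE => ->.
  apply: depends_on_sub IH; apply/fintype.subsetP => ij.
  by rewrite !inE => ->; rewrite orbT.
have dis : [disjoint [set ij | ij.1 \in l]%SET & [set ij : 'I_n * 'I_p | ij.1 == i]%SET]%B.
  apply/pred0P => ij /=; rewrite !inE; apply/negP => /andP[ijl /eqP iji].
  by rewrite iji (negbTE il) in ijl.
have dl := @depends_on_row u i.
have Q0 w : 0 <= Q w by apply: sumr_ge0 => k _; exact: sqr_ge0.
under eq_integral do rewrite big_cons.
pose h1 (z : R * R) := h (s * (z.2 ^+ 2 + z.1)).
have mh1 : measurable_fun setT h1.
  apply: measurableT_comp => //; apply: measurable_funM => //.
  by apply: measurable_funD => //; exact: measurable_funX.
transitivity (\int[P]_w h1 (Q w, lin u i w))%E.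
  by apply: eq_integral => w _.
rewrite (indep_integral dis dQ dl mh1) ?/h1//=.
(* [k1] is what becomes of [h] once row [i] is rescaled and integrated out. The induction hypothesis
   is applied to it as a new test function. *)
pose k1 y := (\int[P]_w (h (lin u i w ^+ 2 + y)%R *
     ((Num.sqrt s)^-1 * expR ((1 - s^-1) * lin u i w ^+ 2 / 2))%:E))%E.
pose g1 (z : R * R) := (h (z.2 ^+ 2 + z.1)%R *
     ((Num.sqrt s)^-1 * expR ((1 - s^-1) * z.2 ^+ 2 / 2))%:E)%E.
have mg1 : measurable_fun setT g1.
  apply: emeasurable_funM.
    by apply: measurableT_comp => //; apply: measurable_funD => //; exact: measurable_funX.
  apply/measurable_EFinP; apply: measurable_funM => //; apply: measurableT_comp => //.
  apply: measurable_funM => //; apply: measurable_funM => //; exact: measurable_funX.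
have g10 z : (0 <= g1 z)%E.
  by rewrite mule_ge0// lee_fin -[X in X * _]expr1 wt_ge0.
have mk1 : measurable_fun setT k1.
  exact: (measurable_integral_pair P (measurable_lin u i) mg1 g10).
have k10 y : (0 <= k1 y)%E.
  by apply: integral_ge0 => w _; exact: (g10 (y, lin u i w)).
transitivity (\int[P]_w k1 (s * Q w)%R)%E.
  apply: eq_integral => w _; rewrite /k1.
  rewrite (@lin_law u i (fun y => h (s * (y ^+ 2 + Q w))%R)); last 2 first.
  - apply: measurableT_comp => //; apply: measurable_funM => //.
    by apply: measurable_funD.
  - by [].
  rewrite (@lin_law u i (fun y => (h (y ^+ 2 + s * Q w)%R * ((Num.sqrt s)^-1 * expR ((1 - s^-1) * y ^+ 2 / 2))%:E)%E)); last 2 first.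
  - exact: (measurableT_comp mg1 (pair1_measurable (s * Q w))).
  - by move=> y; exact: (g10 (s * Q w, y)).
  rewrite u1 sqrtr1.
  under eq_integral do rewrite mul1r mulrDr.
  under [RHS]eq_integral do rewrite mul1r.
  rewrite (integral_normal_scale (h := fun y => h (y + s * Q w)%R)); [by []|by []| |by []].
  by apply: measurableT_comp => //; exact: measurable_funD.
rewrite /Q (IH ul k1 mk1 k10) -/Q.
pose W (y : R) := ((Num.sqrt s)^-1 ^+ size l * expR ((1 - s^-1) * y / 2))%:E.
have mW : measurable_fun setT W.
  apply/measurable_EFinP; apply: measurable_funM => //; apply: measurableT_comp => //.
  by apply: measurable_funM => //; exact: measurable_funM.
pose g2 (z : R * R) := (g1 z * W z.1)%E.
have mg2 : measurable_fun setT g2.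
  by apply: emeasurable_funM => //; exact: measurableT_comp.
transitivity (\int[P]_w g2 (Q w, lin u i w))%E; last first.
  apply: eq_integral => w _; rewrite /g2 /g1 /W big_cons -/(Q w) -muleA -EFinM.
  congr (_ * _%:E)%E; rewrite mulrACA -expRD; congr (_ * expR _); rewrite ?exprS//=.
  by rewrite mulrDr mulrDl.
rewrite (indep_integral dis dQ dl mg2); last first.
  by move=> z; rewrite mule_ge0// lee_fin wt_ge0.
apply: eq_integral => w _; rewrite /g2/= ge0_integralZr; [by []|by []| |by []|].
- exact: (measurableT_comp (measurableT_comp mg1 (pair1_measurable (Q w))) (measurable_lin u i)).
- by rewrite lee_fin wt_ge0.
Qed.

End gaussian_matrix.

(** * Chi-square tails *)

Section logarithm_bounds.
Context (R : realType).
Implicit Types (x y b : R).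

Lemma le_at0_of_derive_ge0 (f f' : R -> R) b : 0 <= b ->
  (forall x, 0 <= x <= b -> is_derive x 1 f (f' x)) ->
  (forall x, 0 <= x <= b -> 0 <= f' x) -> f 0 <= f b.
Proof.
move=> b0 df f'0.
have der x : x \in `[0, b] -> derivable f x 1.
  by rewrite in_itv/= => /df[].
have sub x : x \in `]0, b[ -> 0 <= x <= b.
  by rewrite in_itv/= => /andP[h1 h2]; rewrite !ltW.
apply: (ger0_derive1_le_cc (a := 0) (b := b)).
- by move=> x /sub xb; apply: der; rewrite in_itv.
- move=> x /sub xb; have dfx := df _ xb; rewrite derive1E derive_val; exact: f'0.
- exact: derivable_within_continuous.
- by rewrite in_itv/= lexx.
- by rewrite in_itv/= b0 lexx.
- exact: b0.
Qed.

(** The quadratic coefficient has to be exact: in the upper tail [n * t ^+ 2] is the main term, of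
    order L^2, and only the cubic term is an error. *)
Lemma ln1B_ge x : 0 <= x <= 2^-1 -> - ln (1 - x) <= x + x ^+ 2 / 2 + x ^+ 3.
Proof.
move=> /andP[x0 x2].
pose f y := y + y ^+ 2 / 2 + y ^+ 3 + ln (1 - y).
suff : f 0 <= f x.
  rewrite /f !expr0n/= mul0r !addr0 subr0 ln1 addr0; lra.
apply: (@le_at0_of_derive_ge0 f (fun y => 1 + y + 3 * y ^+ 2 - (1 - y)^-1)) => //.
- move=> y /andP[y0 yx]; have y1 : 0 < 1 - y by lra.
  have dln := is_derive1_ln y1.
  have h : is_derive y 1 (fun z => ln (1 - z)) ((1 - y)^-1 * -1).
    apply: (@is_derive1_comp _ (@ln R) (fun z => 1 - z)).
    apply: is_derive_eq; ring.
  by apply: is_derive_eq; rewrite /GRing.scale/=; field; rewrite gt_eqF.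
- move=> y /andP[y0 yx]; have y1 : 0 < 1 - y by lra.
  rewrite -(pmulr_lge0 _ y1) mulrBl mulVf ?gt_eqF//.
  have -> : (1 + y + 3 * y ^+ 2) * (1 - y) - 1 = y ^+ 2 * (2 - 3 * y) by ring.
  by rewrite mulr_ge0 ?sqr_ge0//; lra.
Qed.

Lemma ln1D_ge y : 0 <= y -> y - y ^+ 2 / 2 <= ln (1 + y).
Proof.
move=> y0; pose f z : R := ln (1 + z) - (z - z ^+ 2 / 2).
suff : f 0 <= f y.
  rewrite /f !expr0n/= mul0r !subr0 addr0 ln1; lra.
apply: (@le_at0_of_derive_ge0 f (fun z => (1 + z)^-1 - (1 - z))) => //.
- move=> z /andP[z0 zy]; have z1 : 0 < 1 + z by lra.
  have dln := is_derive1_ln z1.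
  have h : is_derive z 1 (fun z => ln (1 + z)) ((1 + z)^-1 * 1).
    apply: (@is_derive1_comp _ (@ln R) (fun z => 1 + z)).
    apply: is_derive_eq; ring.
  by apply: is_derive_eq; rewrite /GRing.scale/=; field; rewrite gt_eqF.
- move=> z /andP[z0 zy]; have z1 : 0 < 1 + z by lra.
  rewrite -(pmulr_lge0 _ z1) mulrBl mulVf ?gt_eqF//.
  have -> : 1 - (1 - z) * (1 + z) = z ^+ 2 by ring.
  exact: sqr_ge0.
Qed.

Lemma sqrtr_expR x : 0 < x -> Num.sqrt x = expR (ln x / 2).
Proof.
move=> x0; rewrite -[in LHS](lnK (x := x)) ?posrE//.
rewrite (_ : ln x = ln x / 2 + ln x / 2); last by field.
rewrite expRD -expr2 sqrtr_sqr ger0_norm ?expR_ge0//.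
by rewrite (_ : ln x / 2 + ln x / 2 = ln x) //; field.
Qed.

Lemma sqrtrV_exp x n : 0 < x -> (Num.sqrt x)^-1 ^+ n = expR (- (n%:R / 2 * ln x)).
Proof.
move=> x0; rewrite sqrtr_expR// -expRN -expRM_natl; by congr expR; field.
Qed.

End logarithm_bounds.

Section integral_probability.
Context d (T : measurableType d) (R : realType) (P : probability T R).
Local Open Scope ereal_scope.

Lemma integral_indic_prob (A : set T) : measurable A ->
  \int[P]_w (\1_A w)%:E = P A.
Proof. by move=> mA; rewrite integral_indic// setIT. Qed.

Lemma le_integral_fun (f g : T -> R) : measurable_fun setT f ->
  measurable_fun setT g -> (forall w, 0 <= f w)%R -> (forall w, f w <= g w)%R ->
  \int[P]_w (f w)%:E <= \int[P]_w (g w)%:E.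
Proof.
move=> mf mg f0 fg; apply: ge0_le_integral => //.
- by move=> w _; rewrite lee_fin.
- exact/measurable_EFinP.
- exact/measurable_EFinP.
- by move=> w _; rewrite lee_fin.
Qed.

Lemma prob_le_integral (A : set T) (f : T -> R) : measurable A ->
  measurable_fun setT f -> (forall w, 0 <= f w)%R ->
  (forall w, A w -> 1 <= f w)%R -> P A <= \int[P]_w (f w)%:E.
Proof.
move=> mA mf f0 Af; rewrite -integral_indic_prob//; apply: le_integral_fun => //.
move=> w; rewrite indicE; case: (boolP (w \in A)) => [|_]; last exact: f0.
by rewrite inE => /Af.
Qed.

Lemma integral_EFin_sum (K : finType) (A : {pred K}) (f : K -> T -> R) :
  (forall k, measurable_fun setT (f k)) -> (forall k w, 0 <= f k w)%R ->
  \int[P]_w (\sum_(k in A) f k w)%R%:E = \sum_(k in A) \int[P]_w (f k w)%:E.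
Proof.
move=> mf f0; under eq_integral do rewrite -sumEFin.
rewrite -[in RHS]big_filter -ge0_integral_sum; [|by []|..].
- by apply: eq_integral => w _; rewrite big_filter.
- by move=> k; exact/measurable_EFinP.
- by move=> k w _; rewrite lee_fin.
Qed.

Lemma prob_le_sum (K : finType) (B : set T) (A : K -> set T) :
  measurable B -> (forall k, measurable (A k)) ->
  (forall w, B w -> exists k, A k w) -> P B <= \sum_k P (A k).
Proof.
move=> mB mA BA; apply: (@le_trans _ _ (\int[P]_w (\sum_k \1_(A k) w)%R%:E)).
  apply: prob_le_integral => //.
  - by apply: measurable_sum => k; exact: measurable_indic.
  - by move=> w; apply: sumr_ge0.
  - move=> w /BA[k Akw]; rewrite (bigD1 k)//= indicE mem_set// lerDl.
    by apply: sumr_ge0.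
rewrite integral_EFin_sum//; last by move=> k; exact: measurable_indic.
by apply: lee_sum => k _; rewrite integral_indic_prob.
Qed.

End integral_probability.

Section chi_square_bounds.
Context d (T : measurableType d) (R : realType) (P : probability T R).
Context (n p : nat) (x : 'I_n -> 'I_p -> {RV P >-> R}).
Context (Hnormal : forall i j, standard_normal (x i j)).
Context (Hindep : mutually_independent (fun ij : 'I_n * 'I_p => x ij.1 ij.2)).
Implicit Types u v : 'I_p -> R.

Lemma quad_expR_le u (t : R) : sqnorm u = 1 -> 0 <= t <= 4^-1 ->
  (\int[P]_w (expR (t * quad x u w))%:E <=
   (expR (n%:R * t + n%:R * t ^+ 2 + 4 * n%:R * t ^+ 3))%:E)%E.
Proof.
move=> u1 /andP[t0 t4]; rewrite quad_expR//; last by lra.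
rewrite lee_fin sqrtrV_exp; last by lra.
rewrite ler_expR; have := @ln1B_ge _ (2 * t).
have -> : 0 <= 2 * t <= 2^-1 by lra.
move=> /(_ isT) h; have n0 : 0 <= n%:R / 2 :> R by rewrite divr_ge0.
rewrite -mulrN; apply: (le_trans (ler_wpM2l n0 h)).
by rewrite le_eqVlt; apply/orP; left; apply/eqP; field.
Qed.

Lemma quad_expRN_le u (t : R) : sqnorm u = 1 -> 0 <= t ->
  (\int[P]_w (expR (- t * quad x u w))%:E <=
   (expR (- n%:R * t + n%:R * t ^+ 2))%:E)%E.
Proof.
move=> u1 t0; rewrite quad_expR//; last by lra.
rewrite lee_fin sqrtrV_exp; last by lra.
rewrite ler_expR (_ : 1 - 2 * - t = 1 + 2 * t); last by ring.
have h : 2 * t - (2 * t) ^+ 2 / 2 <= ln (1 + 2 * t) by apply: ln1D_ge; lra.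
have n0 : 0 <= n%:R / 2 :> R by rewrite divr_ge0.
have := ler_wpM2l n0 h; rewrite (_ : n%:R / 2 * (2 * t - (2 * t) ^+ 2 / 2) = n%:R * t - n%:R * t ^+ 2); last by field.
lra.
Qed.

Lemma measurable_expR_quad u (t : R) :
  measurable_fun setT (fun w => expR (t * quad x u w)).
Proof.
by apply: measurableT_comp => //; apply: measurable_funM => //; exact: measurable_quad.
Qed.

Lemma quad_expR_norm_le u (t : R) : sqnorm u = 1 -> 0 <= t <= 4^-1 ->
  (\int[P]_w (expR (t * `|quad x u w - n%:R|))%:E <=
   (2 * expR (n%:R * t ^+ 2 + 4 * n%:R * t ^+ 3))%:E)%E.
Proof.
move=> u1 t04; have /andP[t0 t4] := t04.
pose f w := expR (- (t * n%:R)) * expR (t * quad x u w) +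
            expR (t * n%:R) * expR (- t * quad x u w).
have mf1 (c s : R) : measurable_fun setT (fun w => c * expR (s * quad x u w)).
  by apply: measurable_funM => //; exact: measurable_expR_quad.
apply: (@le_trans _ _ (\int[P]_w (f w)%:E)%E).
  apply: le_integral_fun.
  - apply: measurableT_comp => //; apply: measurable_funM => //.
    apply: measurableT_comp => //; apply: measurable_funB => //; exact: measurable_quad.
  - by apply: measurable_funD; exact: mf1.
  - by move=> w; exact: expR_ge0.
  - move=> w; rewrite /f -!expRD.
    have [h|h] := ger0P (quad x u w - n%:R).
      rewrite ler_wpDr ?expR_ge0// ler_expR; lra.
    rewrite ler_wpDl ?expR_ge0// ler_expR; lra.
under eq_integral do rewrite /f EFinD.
rewrite ge0_integralD; [|by []|..]; last 4 first.
- by move=> w _; rewrite lee_fin mulr_ge0 ?expR_ge0.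
- exact/measurable_EFinP.
- by move=> w _; rewrite lee_fin mulr_ge0 ?expR_ge0.
- exact/measurable_EFinP.
under eq_integral do rewrite EFinM.
under [X in (_ + X)%E]eq_integral do rewrite EFinM.
rewrite integral_EFinZl; [|exact: measurable_expR_quad|by move=> w; exact: expR_ge0|exact: expR_ge0].
rewrite integral_EFinZl; [|exact: measurable_expR_quad|by move=> w; exact: expR_ge0|exact: expR_ge0].
rewrite mulrDl mul1r EFinD; apply: leeD.
  apply: (le_trans (lee_wpmul2l _ (quad_expR_le u1 t04))).
    by rewrite lee_fin expR_ge0.
  rewrite -EFinM -expRD lee_fin ler_expR; lra.
apply: (le_trans (lee_wpmul2l _ (quad_expRN_le u1 t0))).
  by rewrite lee_fin expR_ge0.
rewrite -EFinM -expRD lee_fin ler_expR.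
have : 0 <= n%:R * t ^+ 3 by rewrite mulr_ge0// exprn_ge0.
lra.
Qed.

(** Chernoff bound with the same tilt for both events. The factor [1 + r ^+ 2] appears because the
    two quadratic forms have variance 2 n and covariance 2 n r^2. *)
Lemma quad_pair_tail u v (t r a : R) : sqnorm u = 1 -> sqnorm v = 1 ->
  \sum_j u j * v j = r -> 0 <= r <= 1 -> 0 <= t <= 8^-1 ->
  (P ([set w | (a <= quad x u w)%R] `&` [set w | (a <= quad x v w)%R]) <=
   (expR (2 * t * (n%:R - a) + 2 * n%:R * t ^+ 2 * (1 + r ^+ 2) + 32 * n%:R * t ^+ 3))%:E)%E.
Proof.
move=> u1 v1 uv r01 /andP[t0 t8].
have mq w' : measurable [set w | a <= quad x w' w].
  rewrite -[X in measurable X]setTI.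
  by rewrite -preimage_itvcy; apply: (@measurable_quad _ _ _ _ _ _ x w') => //; exact: measurable_itv.
apply: (@le_trans _ _ (\int[P]_w ((expR (- (2 * t * a)))%:E * (expR (t * (quad x u w + quad x v w)))%:E))%E).
  under eq_integral do rewrite -EFinM.
  apply: prob_le_integral.
  - exact: measurableI.
  - apply: measurable_funM => //; apply: measurableT_comp => //; apply: measurable_funM => //.
    by apply: measurable_funD; exact: measurable_quad.
  - by move=> w; rewrite mulr_ge0 ?expR_ge0.
  - move=> w /= [h1 h2]; rewrite -expRD -[leLHS]expR0 ler_expR.
    have := ler_wpM2l t0 (lerD h1 h2); lra.
rewrite integral_EFinZl; last 3 first.
- apply: measurableT_comp => //; apply: measurable_funM => //.
  by apply: measurable_funD; exact: measurable_quad.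
- by move=> w; exact: expR_ge0.
- exact: expR_ge0.
have /andP[r0 r1] := r01.
have tr : 0 <= t * r by rewrite mulr_ge0.
have tr1 : t * r <= t by rewrite ler_piMr.
rewrite (quad_expR_pair Hnormal Hindep u1 v1 uv r01 t0); last by lra.
rewrite -EFinM lee_fin sqrtrV_exp; last by apply: mulr_gt0; lra.
rewrite -expRD ler_expR lnM ?posrE; [|lra..].
have h1 : - ln (1 - 2 * t * (1 + r)) <= 2 * t * (1 + r) + (2 * t * (1 + r)) ^+ 2 / 2 + (2 * t * (1 + r)) ^+ 3.
  by apply: ln1B_ge; lra.
have h2 : - ln (1 - 2 * t * (1 - r)) <= 2 * t * (1 - r) + (2 * t * (1 - r)) ^+ 2 / 2 + (2 * t * (1 - r)) ^+ 3.
  by apply: ln1B_ge; lra.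
have n0 : 0 <= n%:R / 2 :> R by rewrite divr_ge0.
have h := ler_wpM2l n0 (lerD h1 h2).
have r2 : r ^+ 2 <= 1 by rewrite expr_le1.
(* The two cubes add up to [8 t^3 (2 + 6 r^2)]. Replacing [r ^+ 2] by 1 in this term yields the
   constant 32; [h3] is the sign of the difference. *)
have h3 : 0 <= n%:R * t ^+ 3 * (1 - r ^+ 2).
  by rewrite !mulr_ge0// ?exprn_ge0//; lra.
have e : n%:R / 2 * (2 * t * (1 + r) + (2 * t * (1 + r)) ^+ 2 / 2 + (2 * t * (1 + r)) ^+ 3
  + (2 * t * (1 - r) + (2 * t * (1 - r)) ^+ 2 / 2 + (2 * t * (1 - r)) ^+ 3)) =
  2 * t * n%:R + 2 * n%:R * t ^+ 2 * (1 + r ^+ 2) + 32 * n%:R * t ^+ 3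
   - 24 * (n%:R * t ^+ 3 * (1 - r ^+ 2)) by field.
rewrite e in h; lra.
Qed.

End chi_square_bounds.

Section chi_square_lower_tail.
Context d (T : measurableType d) (R : realType) (P : probability T R).
Context (n p : nat) (x : 'I_n -> 'I_p -> {RV P >-> R}).
Context (Hnormal : forall i j, standard_normal (x i j)).
Context (Hindep : mutually_independent (fun ij : 'I_n * 'I_p => x ij.1 ij.2)).
Context (u : 'I_p -> R) (u1 : sqnorm u = 1) (n_ge : (4096 <= n)%N).
Notation Q := (quad x u).

Lemma sqrtn_ge64 : 64 <= Num.sqrt n%:R :> R.
Proof.
rewrite -(ger0_norm (_ : 0 <= 64 :> R))// -sqrtr_sqr ler_sqrt ?ler0n//.
by rewrite -natrX ler_nat; exact: leq_trans n_ge.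
Qed.

Lemma measurable_quad_set (B : set R) : measurable B -> measurable (Q @^-1` B).
Proof.
by move=> mB; rewrite -[X in measurable X]setTI; apply: (@measurable_quad _ _ _ _ _ _ x u).
Qed.

(** Markov's inequality for [exp (t |Q - n|)] with [t = 2 / sqrt n] gives [2 exp (- 4 + 16 t)], and
    [4096 <= n] ensures [t <= 1 / 32], which brings this below 1/2. *)
Lemma quad_concentration :
  ((2^-1)%:E <= P [set w | (`|Q w - n%:R| < 4 * Num.sqrt n%:R)%R])%E.
Proof.
set q := Num.sqrt n%:R.
have q64 : 64 <= q := sqrtn_ge64.
have q2 : q ^+ 2 = n%:R by rewrite sqr_sqrtr// ler0n.
pose B : set T := [set w | (4 * q <= `|Q w - n%:R|)%R].
have mB : measurable B.
  apply: (measurable_quad_set (B := [set y | (4 * q <= `|y - n%:R|)%R])).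
  rewrite (_ : [set y | _] = ~` `]n%:R - 4 * q, n%:R + 4 * q[%classic).
    by apply: measurableC; exact: measurable_itv.
  apply/seteqP; split => y /=; rewrite in_itv/= -ltr_distlC leNgt distrC.
    by move/negP.
  by move=> /negP.
have -> : [set w | (`|Q w - n%:R| < 4 * q)%R] = ~` B.
  by apply/seteqP; split => w /=; rewrite /B/= ltNge => /negP.
rewrite probability_setC//.
suff PB : (P B <= (2^-1)%:E)%E.
  have [b PBb] : exists b, P B = b%:E.
    by exists (fine (P B)); rewrite fineK// fin_num_measure.
  by move: PB; rewrite PBb -EFinB !lee_fin; lra.
pose t := 2 / q.
have tq : t * q = 2 by rewrite /t divfK// gt_eqF//; lra.
have t0 : 0 <= t by rewrite divr_ge0//; lra.
have t32 : t <= 32^-1 by rewrite /t ler_pdivrMr; lra.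
apply: (@le_trans _ _ (\int[P]_w ((expR (- 8))%:E * (expR (t * `|Q w - n%:R|))%:E))%E).
  under eq_integral do rewrite -EFinM.
  apply: prob_le_integral.
  - exact: mB.
  - apply: measurable_funM => //; apply: measurableT_comp => //.
    apply: measurable_funM => //; apply: measurableT_comp => //.
    by apply: measurable_funB => //; exact: measurable_quad.
  - by move=> w; rewrite mulr_ge0 ?expR_ge0.
  - move=> w /= Bw; rewrite -expRD -[leLHS]expR0 ler_expR.
    have := ler_wpM2l t0 Bw; lra.
rewrite integral_EFinZl; last 3 first.
- apply: measurableT_comp => //; apply: measurable_funM => //; apply: measurableT_comp => //.
  by apply: measurable_funB => //; exact: measurable_quad.
- by move=> w; exact: expR_ge0.
- exact: expR_ge0.
have t14 : 0 <= t <= 4^-1 by lra.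
apply: (le_trans (lee_wpmul2l _ (quad_expR_norm_le Hnormal Hindep u1 t14))).
  by rewrite lee_fin expR_ge0.
rewrite -EFinM mulrCA -expRD lee_fin.
have -> : - 8 + (n%:R * t ^+ 2 + 4 * n%:R * t ^+ 3) = - 4 + 16 * t :> R.
  have e2 : n%:R * t ^+ 2 = 4 by rewrite -q2 mulrC -exprMn tq; lra.
  have -> : 4 * n%:R * t ^+ 3 = 4 * (n%:R * t ^+ 2) * t by ring.
  by rewrite e2; lra.
have e0 : 0 < expR (- 4 + 16 * t) := expR_gt0 _.
have h : 4 <= (expR (- 4 + 16 * t))^-1.
  by rewrite -expRN; apply: le_trans (expR_ge1Dx _); lra.
have := ler_wpM2r (ltW e0) h; rewrite mulVf ?gt_eqF//; lra.
Qed.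

(** Pigeonhole: the interval of [quad_concentration] is cut into [K] windows. A narrow window is
    wanted because the density factor of [quad_scale] varies over it by the exponential of a
    multiple of [z / K]. *)
Lemma quad_window (K : nat) : (0 < K)%N ->
  exists2 a, n%:R / 2 <= a <= n%:R + 4 * Num.sqrt n%:R &
    n%:R - 4 * Num.sqrt n%:R <= a /\
    (((2 * K%:R)^-1)%:E <=
      P [set w | (a <= Q w < a + 8 * Num.sqrt n%:R / K%:R)%R])%E.
Proof.
move=> K0; set q := Num.sqrt n%:R.
have q64 : 64 <= q := sqrtn_ge64.
have q2 : q ^+ 2 = n%:R by rewrite sqr_sqrtr// ler0n.
have K0' : 0 < K%:R :> R by rewrite ltr0n.
set h := 8 * q / K%:R.
have h0 : 0 < h by rewrite divr_gt0//; lra.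
have Kh : K%:R * h = 8 * q by rewrite /h mulrC divfK// gt_eqF.
pose a (k : 'I_K) := n%:R - 4 * q + k%:R * h.
pose A (k : 'I_K) : set T := [set w | (a k <= Q w < a k + h)%R].
have mA k : measurable (A k).
  apply: (measurable_quad_set (B := `[a k, a k + h[%classic)); exact: measurable_itv.
have [k Pk] : exists k, (((2 * K%:R)^-1)%:E <= P (A k))%E.
  apply: contrapT => /forallNP noA.
  have PAfin k : P (A k) = (fine (P (A k)))%:E by rewrite fineK// fin_num_measure.
  have small k : fine (P (A k)) < (2 * K%:R)^-1.
    have /negP := noA k; rewrite -ltNge {1}PAfin lte_fin; exact.
  pose B : set T := [set w | (`|Q w - n%:R| < 4 * q)%R].
  have mB : measurable B.
    rewrite (_ : B = Q @^-1` `]n%:R - 4 * q, n%:R + 4 * q[%classic).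
      by apply: measurable_quad_set; exact: measurable_itv.
    by apply/seteqP; split => w /=; rewrite /B/= in_itv/= -ltr_distlC distrC.
  have PB : ((2^-1)%:E <= P B)%E := quad_concentration.
  have : (P B <= \sum_k P (A k))%E.
    apply: prob_le_sum => // w Bw.
    have := Bw; rewrite /B/= distrC ltr_distlC => /andP[B1 B2].
    pose y := (Q w - (n%:R - 4 * q)) / h.
    have y0 : 0 <= y by rewrite divr_ge0 ?ltW//; lra.
    have yK : y < K%:R.
      by rewrite ltr_pdivrMr// Kh; lra.
    have /andP[t1 t2] := truncn_itv y0.
    have tK : (Num.trunc y < K)%N by rewrite -(ltr_nat R); exact: le_lt_trans yK.
    exists (Ordinal tK); rewrite /A/a/=; apply/andP; split.
      by move: t1; rewrite ler_pdivlMr//; lra.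
    by move: t2; rewrite ltr_pdivrMr// -natr1 mulrDl; lra.
  move=> /(le_trans PB); rewrite (eq_bigr _ (fun k _ => PAfin k)) sumEFin lee_fin.
  apply/negP; rewrite -ltNge.
  apply: (@lt_le_trans _ _ (\sum_(k < K) (2 * K%:R)^-1)).
    by apply: ltr_sum => //; apply/hasP; exists (Ordinal K0); rewrite ?mem_index_enum.
  rewrite sumr_const card_ord -[X in X <= _]mulr_natr le_eqVlt; apply/orP; left.
  by apply/eqP; field; rewrite gt_eqF.
exists (a k); last first.
  by split => //; rewrite /a lerDl mulr_ge0// ltW.
have kh : 0 <= k%:R * h <= 8 * q.
  rewrite mulr_ge0 ?(ltW h0)//= -Kh ler_wpM2r// ?(ltW h0)//.
  by rewrite ler_nat ltnW.
rewrite /a -q2; nra.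
Qed.

(* [quad_scale] moves a window of probability at least [1 / (2 K)] near [n] up to
   the threshold; only the density factor is lost. *)
Lemma quad_lower_tail (z : R) (K : nat) : 4 <= z -> (0 < K)%N ->
  ((expR (- (z ^+ 2 / 4) - 8 * (z + 4) / K%:R) / (2 * K%:R))%:E <=
   P [set w | (n%:R + Num.sqrt n%:R * z <= Q w)%R])%E.
Proof.
move=> z4 K0; set q := Num.sqrt n%:R.
have q64 : 64 <= q := sqrtn_ge64.
have q2 : q ^+ 2 = n%:R by rewrite sqr_sqrtr// ler0n.
have K0' : 0 < K%:R :> R by rewrite ltr0n.
have [a /andP[a1 a2] [a3 PA]] := quad_window K0.
move: a2 a3 PA; rewrite -/q => a2 a3 PA.
set h := 8 * q / K%:R in PA.
have h0 : 0 < h by rewrite divr_gt0//; lra.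
have n0 : 0 < n%:R :> R by rewrite -q2 exprn_gt0//; lra.
have a0 : 0 < a by lra.
pose t := n%:R + q * z.
have qz : 4 * q <= q * z by rewrite mulrC ler_wpM2l//; lra.
have ta : a <= t by rewrite /t; lra.
have t0 : 0 < t by lra.
(* Rescaling by [a / t] sends the threshold [t] to the left end [a] of the window. *)
pose s := a / t.
have s0 : 0 < s by rewrite divr_gt0.
pose A : set R := `[a, a + h[%classic.
have mA : measurable A by exact: measurable_itv.
have mA1 : measurable_fun [set: R] (fun y => (\1_A y)%:E : \bar R).
  by apply/measurable_EFinP; exact: measurable_indic.
have scaled := quad_scale Hnormal Hindep (h := fun y => (\1_A y)%:E) u1 s0 mA1 (fun y => _).
have {}scaled := scaled (fun y => (lee_tofin (ler0n R (y \in A)))).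
(* [c] is the density factor at the right end of the window, where it is smallest since
   [1 - s^-1 <= 0]. *)
pose c := expR (- (n%:R / 2 * ln s) + (1 - s^-1) * (a + h) / 2).
apply: (@le_trans _ _ (\int[P]_w (\1_A (s * Q w)%R)%:E)%E); last first.
  rewrite -integral_indic_prob; last first.
    apply: (measurable_quad_set (B := [set y | (t <= y)%R])).
    by rewrite -set_itvcy; exact: measurable_itv.
  apply: le_integral_fun => //.
  - apply: (measurableT_comp (measurable_indic mA)).
    by apply: measurable_funM => //; exact: measurable_quad.
  - apply: measurable_indic; apply: (measurable_quad_set (B := [set y | (t <= y)%R])).
    by rewrite -set_itvcy; exact: measurable_itv.
  - move=> w; rewrite !indicE.
    case: (boolP (s * Q w \in A)) => //; rewrite inE /A/= in_itv/= => /andP[h1 _].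
    rewrite mem_set//=; move: h1; rewrite /s mulrAC ler_pdivlMr//.
    by rewrite ler_pM2l.
rewrite scaled.
apply: (@le_trans _ _ (\int[P]_w (c%:E * (\1_A (Q w))%:E))%E); last first.
  apply: ge0_le_integral => //.
  - by move=> w _; rewrite -EFinM lee_fin mulr_ge0 ?expR_ge0.
  - apply/measurable_EFinP; apply: measurable_funM => //.
    by apply: (measurableT_comp (measurable_indic mA)); exact: measurable_quad.
  - apply/measurable_EFinP; apply: measurable_funM.
      by apply: (measurableT_comp (measurable_indic mA)); exact: measurable_quad.
    apply: measurable_funM => //; apply: measurableT_comp => //.
    by do 2 apply: measurable_funM => //; exact: measurable_quad.
  - move=> w _; rewrite -!EFinM lee_fin indicE.
    case: (boolP (Q w \in A)) => [|_]; last by rewrite mulr0 mul0r.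
    rewrite inE /A/= in_itv/= mulr1 mul1r => /andP[_ Qw].
    rewrite sqrtrV_exp// -expRD ler_expR lerD2l.
    have s1 : 1 - s^-1 <= 0 by rewrite /s invf_div subr_le0 ler_pdivlMr// mul1r.
    rewrite ler_pM2r//; apply: ler_wnM2l => //; exact: ltW.
rewrite integral_EFinZl; last 3 first.
- by apply: (measurableT_comp (measurable_indic mA)); exact: measurable_quad.
- by move=> w; rewrite indicE.
- exact: expR_ge0.
have -> : (\int[P]_w (\1_A (Q w))%:E = P [set w | (a <= Q w < a + h)%R])%E.
  rewrite -integral_indic_prob//.
  by apply: (measurable_quad_set (B := A)).
apply: (@le_trans _ _ (c%:E * ((2 * K%:R)^-1)%:E)%E); last first.
  by apply: lee_wpmul2l => //; rewrite lee_fin expR_ge0.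
rewrite -EFinM lee_fin ler_pM2r ?invr_gt0 ?mulr_gt0// ler_expR.
have tE : t = n%:R * (1 + z / q).
  rewrite /t -q2; field; rewrite gt_eqF//; lra.
have zq0 : 0 <= z / q by rewrite divr_ge0; lra.
have lns : ln s = ln a - ln n%:R - ln (1 + z / q).
  rewrite /s ln_div ?posrE// tE lnM ?posrE//; first by ring.
  by rewrite ltr_wpDr.
(* The tangent bound on [ln a] is enough: the resulting [(a - n) / 2] cancels against the
   exponential factor, so the unknown position of the window drops out of the main term. *)
have lna : ln a <= ln n%:R + (a - n%:R) / n%:R.
  have -> : a = n%:R * (1 + (a - n%:R) / n%:R) by field; rewrite gt_eqF.
  have an : 0 < 1 + (a - n%:R) / n%:R.
    rewrite (_ : 1 + _ = a / n%:R); first by rewrite divr_gt0.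
    by field; rewrite gt_eqF.
  rewrite lnM ?posrE// lerD2l.
  rewrite (_ : n%:R * (1 + (a - n%:R) / n%:R) = a); last by field; rewrite gt_eqF.
  by apply: le_ln1Dx; lra.
have lnz := ln1D_ge zq0.
have n2 : 0 <= n%:R / 2 :> R by rewrite divr_ge0.
have m1 := ler_wpM2l n2 lna.
have m2 := ler_wpM2l n2 lnz.
have e1 : n%:R / 2 * (ln n%:R + (a - n%:R) / n%:R) = n%:R / 2 * ln n%:R + (a - n%:R) / 2.
  by field; rewrite gt_eqF.
have e2 : n%:R / 2 * (z / q - (z / q) ^+ 2 / 2) = q * z / 2 - z ^+ 2 / 4.
  by rewrite -q2; field; rewrite gt_eqF//; lra.
rewrite e1 in m1; rewrite e2 in m2; rewrite lns.
have e3 : (1 - s^-1) * (a + h) / 2 = (a - t) / 2 - (t - a) * h / (2 * a).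
  by rewrite /s; field; rewrite !gt_eqF.
have m3 : (t - a) * h / (2 * a) <= 8 * (z + 4) / K%:R.
  rewrite ler_pdivrMr ?mulr_gt0//.
  apply: (@le_trans _ _ ((q * (z + 4)) * h)).
    by rewrite ler_pM2r// /t; lra.
  rewrite (_ : q * (z + 4) * h = 8 * (z + 4) / K%:R * n%:R); last first.
    by rewrite /h -q2; field; rewrite gt_eqF.
  apply: ler_wpM2l; last by lra.
  by rewrite divr_ge0 ?mulr_ge0//; lra.
by rewrite e3; move: m1 m2 m3; rewrite /t; lra.
Qed.

End chi_square_lower_tail.

(** * Second moment over block vectors *)

Section second_moment.
Context d (T : measurableType d) (R : realType) (P : probability T R).
Context (I : finType) (E : I -> set T) (mE : forall i, measurable (E i)).

(** Chebyshev's inequality for the number [N] of events that occur, multiplied out to avoid dividing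
    by the mean. Pairs outside [rel] cancel against the square of the mean. *)
Lemma second_moment (rel : I -> I -> bool) :
  (forall i j, ~~ rel i j -> P (E i `&` E j) = (P (E i) * P (E j))%E) ->
  fine (P (\bigcap_i ~` E i)) * (\sum_i fine (P (E i))) ^+ 2 <=
    \sum_(ij : I * I | rel ij.1 ij.2) fine (P (E ij.1 `&` E ij.2)).
Proof.
move=> indepE; set mu := \sum_i _.
pose N w : R := \sum_i \1_(E i) w.
have Pfin A : measurable A -> P A = (fine (P A))%:E.
  by move=> mA; rewrite fineK// fin_num_measure.
pose Z := \bigcap_i ~` E i.
have mZ : measurable Z.
  by apply: fin_bigcap_measurable => // i _; exact: measurableC.
have mi i : measurable_fun [set: T] (\1_(E i) : T -> R) by exact: measurable_indic.
have mN : measurable_fun setT N by exact: measurable_sum.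
have N0 w : 0 <= N w by apply: sumr_ge0.
have mu0 : 0 <= mu by apply: sumr_ge0 => i _; exact: fine_ge0.
have EN : (\int[P]_w (N w)%:E = mu%:E)%E.
  rewrite integral_EFin_sum; [|exact: mi|by move=> i w; rewrite indicE].
  rewrite -sumEFin; apply: eq_bigr => i _.
  by rewrite integral_indic_prob; [exact: Pfin|exact: mE].
pose S := \sum_i \sum_j fine (P (E i `&` E j)).
have EN2 : (\int[P]_w (N w ^+ 2)%:E = S%:E)%E.
  transitivity (\int[P]_w (\sum_i \sum_j \1_(E i `&` E j) w)%R%:E)%E.
    apply: eq_integral => w _; rewrite expr2 /N mulr_suml; congr EFin.
    apply: eq_bigr => i _; rewrite mulr_sumr; apply: eq_bigr => j _.
    by rewrite indicI.
  rewrite integral_EFin_sum; last 2 first.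
  - by move=> i; apply: measurable_sum => j; apply: measurable_indic; exact: measurableI.
  - by move=> i w; apply: sumr_ge0.
  rewrite -sumEFin; apply: eq_bigr => i _.
  rewrite integral_EFin_sum; last 2 first.
  - by move=> j; apply: measurable_indic; exact: measurableI.
  - by move=> j w; rewrite indicE.
  rewrite -sumEFin; apply: eq_bigr => j _.
  have mEE := measurableI _ _ (mE i) (mE j).
  by rewrite integral_indic_prob; [exact: Pfin|exact: mEE].
(* This is [(N - mu)^2 >= mu^2 1_Z] with the cross term moved to the left, so that both sides are
   nonnegative and no integrability is involved. *)
have : (\int[P]_w (mu ^+ 2 * \1_Z w + 2 * mu * N w)%:E <= \int[P]_w (N w ^+ 2 + mu ^+ 2)%:E)%E.
  apply: le_integral_fun.
  - apply: measurable_funD; apply: measurable_funM => //; exact: measurable_indic.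
  - by apply: measurable_funD => //; exact: measurable_funX.
  - by move=> w; rewrite addr_ge0// mulr_ge0 ?sqr_ge0// ?mulr_ge0// indicE.
  - move=> w; rewrite indicE; case: (boolP (w \in Z)) => [|_].
      rewrite inE => Zw; have -> : N w = 0.
        apply: big1 => i _; rewrite indicE memNset//.
        by have := Zw i Logic.I.
      by rewrite mulr1 mulr0 addr0 expr0n add0r.
    have := sqr_ge0 (N w - mu); rewrite mulr0 add0r; lra.
under eq_integral do rewrite EFinD EFinM [X in (_ + X)%E]EFinM.
rewrite ge0_integralD; [|by []|..]; last 4 first.
- by move=> w _; rewrite -EFinM lee_fin mulr_ge0 ?sqr_ge0// indicE.
- apply/measurable_EFinP; apply: measurable_funM => //; exact: measurable_indic.
- by move=> w _; rewrite -EFinM lee_fin !mulr_ge0.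
- by apply/measurable_EFinP; apply: measurable_funM.
rewrite integral_EFinZl; last 3 first.
- exact: measurable_indic.
- by move=> w; rewrite indicE.
- exact: sqr_ge0.
rewrite integral_EFinZl; last 3 first.
- exact: mN.
- exact: N0.
- by rewrite mulr_ge0.
under [X in (_ <= X)%E]eq_integral do rewrite EFinD.
rewrite ge0_integralD; [|by []|..]; last 4 first.
- by move=> w _; rewrite lee_fin sqr_ge0.
- by apply/measurable_EFinP; exact: measurable_funX.
- by move=> w _; rewrite lee_fin sqr_ge0.
- by apply/measurable_EFinP.
rewrite integral_indic_prob; [|exact: mZ].
have -> : (\int[P]_w (mu ^+ 2)%:E = (mu ^+ 2)%:E)%E.
  by rewrite integral_cst//= probability_setT mule1.
rewrite EN EN2.
rewrite (Pfin _ mZ) -!EFinM -!EFinD lee_fin => main.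
have SE : S - mu ^+ 2 <= \sum_(ij : I * I | rel ij.1 ij.2) fine (P (E ij.1 `&` E ij.2)).
  have -> : mu ^+ 2 = \sum_ij fine (P (E ij.1)) * fine (P (E ij.2)).
    rewrite -(pair_bigA _ (fun i j => fine (P (E i)) * fine (P (E j))))/=.
    rewrite expr2 /mu mulr_suml; apply: eq_bigr => i _.
    by rewrite mulr_sumr.
  rewrite /S pair_bigA/= (bigID (fun ij => rel ij.1 ij.2))/= lerBlDr lerD2l.
  rewrite [leRHS](bigID (fun ij => rel ij.1 ij.2))/= ler_wpDl//.
    by apply: sumr_ge0 => ij _; rewrite mulr_ge0// fine_ge0.
  apply: ler_sum => ij nij; rewrite indepE// fineM ?fin_num_measure//.
by move: main SE; rewrite -/Z; lra.
Qed.

End second_moment.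

Section block_vectors.
Context (R : realType) (p m q : nat) (iota : 'I_m -> 'I_q -> 'I_p).
Context (iota_inj : forall l c l' c', iota l c = iota l' c' -> l = l' /\ c = c').
Context (m_gt0 : (0 < m)%N).
Implicit Types f g : {ffun 'I_m -> 'I_q}.

(* [iota l] lists the columns of the [l]-th of [m] blocks of size [q]; [f] picks
   one column in each block. *)
Definition block_vec f (j : 'I_p) : R :=
  \sum_l (iota l (f l) == j)%:R / Num.sqrt m%:R.

Definition overlap f g : nat := #|[set l | f l == g l]%SET|.

Lemma block_vec_dot f g :
  \sum_j block_vec f j * block_vec g j = (overlap f g)%:R / m%:R.
Proof.
transitivity (\sum_(l < m) (f l == g l)%:R / m%:R : R); last first.
  rewrite -mulr_suml; congr (_ / _).
  rewrite /overlap -sum1_card natr_sum [RHS]big_mkcond/=; apply: eq_bigr => l _.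
  by rewrite inE; case: (f l == g l).
rewrite /block_vec; under eq_bigr do rewrite mulr_suml.
rewrite exchange_big/=; apply: eq_bigr => l _.
under eq_bigr do rewrite mulr_sumr.
rewrite exchange_big/= (bigD1 l)//= [X in _ + X]big1 ?addr0; last first.
  move=> l' l'l; apply: big1 => j _.
  case: (iota l (f l) =P j) => [<-|_]; last by rewrite !mul0r.
  case: (iota l' (g l') =P _) => [/iota_inj[/eqP]|_]; last by rewrite mul0r mulr0.
  by rewrite (negbTE l'l).
rewrite (bigD1 (iota l (f l)))//= big1 ?addr0; last first.
  by move=> j; rewrite eq_sym => /negbTE ->; rewrite !mul0r.
rewrite eqxx mul1r; case: (f l =P g l) => [->|fg].
  by rewrite eqxx !mul1r -invfM -expr2 sqr_sqrtr ?ler0n.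
case: (iota l (g l) =P _) => [/iota_inj[_ gf]|_]; first by case: fg.
by rewrite !mul0r mulr0.
Qed.

Lemma overlap_id f : overlap f f = m.
Proof. by rewrite /overlap (_ : [set l | _]%SET = finset.setT) ?cardsT ?card_ord//; apply/setP => l; rewrite !inE eqxx. Qed.

Lemma overlap_lt f g : f != g -> (overlap f g < m)%N.
Proof.
move=> fg; rewrite -[X in (_ < X)%N](card_ord m) -cardsT; apply: proper_card.
rewrite properT; apply: contraNN fg => /eqP h; apply/eqP/ffunP => l.
by have : l \in [set: 'I_m]%SET := finset.in_setT l; rewrite -h inE => /eqP.
Qed.

Lemma sqnorm_block_vec f : sqnorm (block_vec f) = 1.
Proof.
rewrite /sqnorm; under eq_bigr do rewrite expr2.
by rewrite block_vec_dot overlap_id divff// pnatr_eq0 -lt0n.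
Qed.

Definition block_support f : {set 'I_p} := [set iota l (f l) | l : 'I_m]%SET.

Lemma block_vec_support f j : j \notin block_support f -> block_vec f j = 0.
Proof.
move=> jf; apply: big1 => l _; case: (iota l (f l) =P j) => [ij|_]; last by rewrite mul0r.
by move: jf; rewrite -ij imset_f.
Qed.

Lemma block_support_disjoint f g : overlap f g = 0%N ->
  [disjoint block_support f & block_support g]%B.
Proof.
move=> /eqP; rewrite cards_eq0 => /eqP fg; apply/pred0P => j /=; apply/negP.
move=> /andP[/imsetP[l _ ->] /imsetP[l' _ /iota_inj[ll' h]]].
have : l \in [set l | f l == g l]%SET by rewrite inE h ll'.
by rewrite fg finset.in_set0.
Qed.

(** The summand is a product over the blocks, so the sum over [g] factors; a block contributes [q]
    for the agreeing column and 1 for each other one. *)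
Lemma sum_overlap f : \sum_g (q%:R : R) ^+ overlap f g <= (2 * q%:R) ^+ m.
Proof.
have -> : \sum_g (q%:R : R) ^+ overlap f g =
    \prod_(l < m) \sum_(c < q) (if f l == c then q%:R else 1).
  rewrite bigA_distr_bigA/=; apply: eq_bigr => g _.
  rewrite -big_mkcond/= /overlap -prodr_const.
  by apply: eq_bigl => l; rewrite inE.
rewrite -[m in leRHS](card_ord m) -[leRHS]prodr_const; apply: ler_prod => l _.
rewrite (bigD1 (f l))//= eqxx (eq_bigr (fun=> 1)); last first.
  by move=> c; rewrite eq_sym => /negbTE ->.
rewrite sumr_const; set k := #|_|.
have kq : (k <= q)%N by rewrite -[X in (_ <= X)%N](card_ord q); exact: max_card.
rewrite addr_ge0//= mulr2n mulrDl mul1r lerD2l -[1 *+ k]/(k%:R) ler_nat//.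
Qed.

End block_vectors.

(** Compares the Chernoff exponent of a pair with [k] common blocks to that of an independent pair
    plus the entropy [k lam] lost by agreeing. At [z ^+ 2 = 4 m lam] the gap is
    [lam k (m - k)^2 / (m^2 + k^2)], at least [lam / (4 m)] since [k] is neither 0 nor [m]. *)
Lemma overlap_exponent (R : realFieldType) (m k lam z : R) :
  1 <= k -> k <= m - 1 -> 0 <= lam -> z ^+ 2 <= 4 * m * lam ->
  - (z ^+ 2 / (2 * (1 + (k / m) ^+ 2))) <=
  - (z ^+ 2 / 2) + k * lam - lam / (4 * m).
Proof.
move=> k1 km lam0 zl; have m0 : 0 < m by lra.
have D0 : 0 < m ^+ 2 + k ^+ 2 by rewrite addr_gt0 ?exprn_gt0//; lra.
have -> : z ^+ 2 / (2 * (1 + (k / m) ^+ 2)) = z ^+ 2 / 2 - z ^+ 2 * (k ^+ 2 / (2 * (m ^+ 2 + k ^+ 2))).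
  by field; rewrite !gt_eqF.
suff : z ^+ 2 * (k ^+ 2 / (2 * (m ^+ 2 + k ^+ 2))) <= k * lam - lam / (4 * m) by lra.
apply: (@le_trans _ _ (4 * m * lam * (k ^+ 2 / (2 * (m ^+ 2 + k ^+ 2))))).
  by apply: ler_wpM2r => //; rewrite divr_ge0 ?sqr_ge0// mulr_ge0// ltW.
rewrite -subr_ge0.
have -> : k * lam - lam / (4 * m) - 4 * m * lam * (k ^+ 2 / (2 * (m ^+ 2 + k ^+ 2))) =
   lam * ((4 * m * k * (m - k) ^+ 2 - (m ^+ 2 + k ^+ 2)) / (4 * m * (m ^+ 2 + k ^+ 2))).
  by field; rewrite !gt_eqF.
apply: mulr_ge0 => //; apply: divr_ge0; last by rewrite !mulr_ge0// ltW.
(* [k (m - k)] is least at the ends of the range, where it equals [m - 1], and [m >= 2]. *)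
have h1 : m / 2 <= k * (m - k) by nra.
have h2 : m / 2 <= k * (m - k) * (m - k).
  by apply: (le_trans h1); rewrite ler_peMr//; [nra|lra].
have h3 : 0 <= m * (k * (m - k) * (m - k) - m / 2) by rewrite mulr_ge0//; lra.
have h4 : k ^+ 2 <= m ^+ 2 by rewrite ler_pXn2r ?nnegrE//; lra.
rewrite (_ : 4 * m * k * (m - k) ^+ 2 = 4 * (m * (k * (m - k) * (m - k) - m / 2)) + 2 * m ^+ 2); last by field.
lra.
Qed.

(** [y / s] is the tilt [t] that minimises the main exponent [- 2 t s z + 2 s^2 t^2 (1 + r^2)] of
    [quad_pair_tail]; the bound 1/8 is the range allowed there. *)
Lemma tilt_bounds (R : realFieldType) (m k z s : R) : 1 <= k -> k <= m - 1 ->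
  0 < s -> 4 <= z -> z <= s / 4 ->
  let r := k / m in let y := z / (2 * (1 + r ^+ 2)) in
  [/\ 0 <= r <= 1, 0 < 1 + r ^+ 2, 0 <= y / s <= 8^-1 &
    32 * y ^+ 3 / s <= 4 * z ^+ 3 / s].
Proof.
move=> k1 km s0 z4 zs r y.
have m0 : 0 < m by lra.
have r2 : 0 <= r ^+ 2 by exact: sqr_ge0.
have D0 : 0 < 1 + r ^+ 2 by lra.
have z0 : 0 <= z by exact: le_trans z4.
have yz : y <= z / 2.
  rewrite /y invfM mulrA ler_piMr ?divr_ge0// invf_le1//; move: r2; clear; lra.
have y0 : 0 <= y by apply: divr_ge0 => //; apply: mulr_ge0 => //; exact: ltW.
split => //.
- by rewrite divr_ge0 ?(ltW m0)//= ?ler_pdivrMr//; move: k1 km; clear; lra.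
- by rewrite divr_ge0 ?(ltW s0)//= ler_pdivrMr//; move: yz zs; clear; lra.
- rewrite ler_pM2r ?invr_gt0//.
  have : y ^+ 3 <= (z / 2) ^+ 3 by rewrite ler_pXn2r ?nnegrE// divr_ge0.
  by rewrite expr_div_n; clear; lra.
Qed.

Section block_probability.
Context d (T : measurableType d) (R : realType) (P : probability T R).
Context (n p : nat) (x : 'I_n -> 'I_p -> {RV P >-> R}).
Context (m q : nat).
Notation X := (fun ij : 'I_n * 'I_p => x ij.1 ij.2).

(** A real-valued count instead of an event, because independence of disjoint sets of columns is
    expressed for functions through [depends_on]. A family fails when its count vanishes. *)
Definition block_count (iota : 'I_m -> 'I_q -> 'I_p) (t : R) (w : T) : R :=
  \sum_(f in {: {ffun 'I_m -> 'I_q}})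
     \1_(`[t, +oo[%classic : set R) (quad x (block_vec R iota f) w).

Lemma block_count_ge0 iota t w : 0 <= block_count iota t w.
Proof. by apply: sumr_ge0 => f _; rewrite indicE. Qed.

Lemma block_count_eq0 iota t w : block_count iota t w = 0 <->
  forall f, quad x (block_vec R iota f) w < t.
Proof.
split=> [/eqP|small].
  rewrite psumr_eq0 => [/allP h f|f _]; last by rewrite indicE.
  have := h f (mem_index_enum f); rewrite /= indicE pnatr_eq0 eqb0 => /negP h1.
  by rewrite ltNge; apply/negP => h2; apply: h1; rewrite inE/= in_itv/= h2.
apply: big1 => f _; rewrite indicE memNset//= in_itv/= andbT; apply/negP.
by rewrite -ltNge small.
Qed.

Lemma depends_on_block_count (C : {set 'I_p}) iota t :
  (forall l c, iota l c \in C) ->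
  depends_on X [set ij | ij.2 \in C] (block_count iota t).
Proof.
move=> iC; apply: depends_on_sum => f _.
apply: (@depends_on_comp _ _ _ _ _ X _ (quad x (block_vec R iota f))).
  by apply: measurable_indic; exact: measurable_itv.
apply: depends_on_quad => j jC; apply: block_vec_support.
by apply: contraNN jC => /imsetP[l _ ->].
Qed.

Context (Hnormal : forall i j, standard_normal (x i j)).
Context (Hindep : mutually_independent X).

(** The first summand is the inverse of a lower bound on the mean count and pays for the diagonal
    pairs. The second one pays for partial overlaps, with [2 ^+ m] coming from [sum_overlap]. *)
Lemma block_failure (iota : 'I_m -> 'I_q -> 'I_p) (z : R) (K : nat) :
  (forall l c l' c', iota l c = iota l' c' -> l = l' /\ c = c') ->
  (2 <= m)%N -> (0 < q)%N -> (0 < K)%N -> (4096 <= n)%N ->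
  4 <= z -> z <= Num.sqrt n%:R / 4 -> z ^+ 2 <= 4 * m%:R * ln q%:R ->
  (P (block_count iota (n%:R + Num.sqrt n%:R * z) @^-1` [set 0%R]) <=
   (2 * K%:R * expR (z ^+ 2 / 4 + 8 * (z + 4) / K%:R - m%:R * ln q%:R) +
    2 ^+ m * ((2 * K%:R) ^+ 2 * expR (4 * z ^+ 3 / Num.sqrt n%:R
       + 16 * (z + 4) / K%:R - ln q%:R / (4 * m%:R))))%:E)%E.
Proof.
move=> iota_inj m2 q0 K0 n_ge z4 zn zq; set s := Num.sqrt n%:R in zn *.
have s64 : 64 <= s := sqrtn_ge64 R n_ge.
have s2 : s ^+ 2 = n%:R by rewrite sqr_sqrtr// ler0n.
have s0 : 0 < s by lra.
have m0 : (0 < m)%N by apply: leq_trans m2.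
have m0' : 0 < m%:R :> R by rewrite ltr0n.
have K0' : 0 < K%:R :> R by rewrite ltr0n.
have q0' : 0 < q%:R :> R by rewrite ltr0n.
set lam := ln q%:R in zq *.
have lam0 : 0 <= lam by apply: ln_ge0; rewrite ler1n.
have qE : q%:R = expR lam by rewrite lnK// posrE.
set t := n%:R + s * z.
pose Q f := quad x (block_vec R iota f).
pose E f : set T := [set w | (t <= Q f w)%R].
have mE f : measurable (E f).
  by rewrite /E -[X in measurable X]setTI -preimage_itvcy; apply: (@measurable_quad _ _ _ _ _ _ x (block_vec R iota f)) => //; exact: measurable_itv.
have unit f := sqnorm_block_vec R iota_inj m0 f.
pose l := expR (- (z ^+ 2 / 4) - 8 * (z + 4) / K%:R) / (2 * K%:R).
have l0 : 0 < l by rewrite divr_gt0 ?expR_gt0// mulr_gt0.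
(* A pair with [k] common blocks will be bounded by [l ^+ 2 * e * q ^ k]. The factors of [e] that
   involve [K] cancel the losses in [l ^+ 2], so that both sides are compared through [mu]. *)
pose e := (2 * K%:R) ^+ 2 * expR (4 * z ^+ 3 / s + 16 * (z + 4) / K%:R - lam / (4 * m%:R)).
have e0 : 0 < e by rewrite mulr_gt0 ?expR_gt0// exprn_gt0// mulr_gt0.
have Pfin A : measurable A -> P A = (fine (P A))%:E.
  by move=> mA; rewrite fineK// fin_num_measure.
have Pl f : l <= fine (P (E f)).
  rewrite -lee_fin -Pfin//; exact: quad_lower_tail.
have le2 : l ^+ 2 * e = expR (- (z ^+ 2 / 2) + 4 * z ^+ 3 / s - lam / (4 * m%:R)).
  rewrite /l /e expr_div_n mulrA divfK ?gt_eqF ?exprn_gt0 ?mulr_gt0//.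
  rewrite -expRM_natl -expRD; congr expR; field; rewrite ?gt_eqF//.
have pair f g : overlap f g != 0%N -> f != g ->
    fine (P (E f `&` E g)) <= l ^+ 2 * e * q%:R ^+ overlap f g.
  move=> fg0 fg; set k := overlap f g.
  have k1 : 1 <= k%:R :> R by rewrite ler1n lt0n.
  have km : k%:R <= m%:R - 1 :> R.
    by rewrite lerBrDr natr1 ler_nat; exact: overlap_lt.
  pose r : R := k%:R / m%:R.
  pose y := z / (2 * (1 + r ^+ 2)); pose th := y / s.
  have [r01 D0 th8 h2] := tilt_bounds k1 km s0 z4 zn.
  have := quad_pair_tail Hnormal Hindep t (unit f) (unit g) (block_vec_dot R iota_inj f g) r01 th8.
  rewrite -/(E f) -/(E g) (Pfin _ (measurableI _ _ (mE f) (mE g))) lee_fin.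
  move=> /le_trans; apply.
  rewrite le2 qE -expRM_natl -expRD ler_expR.
  have -> : 2 * th * (n%:R - t) + 2 * n%:R * th ^+ 2 * (1 + r ^+ 2) + 32 * n%:R * th ^+ 3 =
     - (z ^+ 2 / (2 * (1 + r ^+ 2))) + 32 * y ^+ 3 / s.
    by rewrite /th /y /t -s2; field; rewrite !gt_eqF.
  have h1 := overlap_exponent k1 km lam0 zq.
  by move: h1 h2; rewrite -/r -/y; move: (32 * y ^+ 3 / s) => a; lra.
pose mu := \sum_f fine (P (E f)).
pose M : R := q%:R ^+ m.
have M0 : 0 < M by rewrite exprn_gt0.
have muM : M * l <= mu.
  rewrite /M -natrX -[q in (q ^ m)%N]card_ord -[m in (_ ^ m)%N]card_ord -card_ffun.
  by rewrite mulr_natl -sumr_const; apply: ler_sum => f _.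
have Ml0 : 0 < M * l by apply: mulr_gt0.
have mu0 : 0 < mu by exact: lt_le_trans muM.
have indepE f g : ~~ (overlap f g != 0%N) -> P (E f `&` E g) = (P (E f) * P (E g))%E.
  rewrite negbK => /eqP /(block_support_disjoint iota_inj) dis.
  have dep h : depends_on X [set ij | ij.2 \in block_support iota h] (Q h).
    by apply: depends_on_quad; exact: block_vec_support.
  rewrite /E -!preimage_itvcy.
  apply: (indep_depends Hindep _ (dep f) (dep g)); [|exact: measurable_itv..].
  apply/pred0P => ij /=; rewrite !inE.
  by move/pred0P: dis => /(_ ij.2)/=.
have := second_moment mE indepE.
rewrite -/mu (_ : \bigcap_f ~` E f = block_count iota t @^-1` [set 0]); last first.
  apply/seteqP; split => w /=.
    move=> h; apply/block_count_eq0 => f; rewrite ltNge; apply/negP.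
    exact: (h f Logic.I).
  move=> /block_count_eq0 h f _ /=; rewrite /E/= leNgt h//.
set p0 := fine _ => sm.
have mp0 : measurable (block_count iota t @^-1` [set 0]).
  have dc : depends_on X [set ij | ij.2 \in [set: 'I_p]%SET] (block_count iota t).
    by apply: depends_on_block_count => ? ?; rewrite inE.
  have /= := depends_on_measurable dc measurableT (measurable_set1 0).
  by rewrite setTI.
rewrite (Pfin _ mp0) lee_fin -/p0.
have {}sm : p0 * mu ^+ 2 <= mu + l ^+ 2 * e * (2 ^+ m * M ^+ 2).
  apply: (le_trans sm).
  apply: (@le_trans _ _ (\sum_(ij : _ * _) ((if ij.1 == ij.2 then fine (P (E ij.1)) else 0) + l ^+ 2 * e * q%:R ^+ overlap ij.1 ij.2))).
    rewrite big_mkcond/=; apply: ler_sum => -[f g] _ /=.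
    have nonneg : 0 <= l ^+ 2 * e * q%:R ^+ overlap f g.
      by rewrite !mulr_ge0 ?exprn_ge0// ltW.
    case: ifPn => [fg0|_]; last by rewrite addr_ge0//; case: ifP => // _; exact: fine_ge0.
    have [fg|fg] := eqVneq f g; first by move: nonneg; rewrite -fg setIid lerDl.
    by rewrite add0r; exact: pair.
  rewrite big_split/= -(pair_bigA _ (fun f g => if f == g then fine (P (E f)) else 0))/=.
  rewrite -(pair_bigA _ (fun f g => l ^+ 2 * e * q%:R ^+ overlap f g))/=.
  apply: lerD.
    rewrite le_eqVlt; apply/orP; left; apply/eqP; apply: eq_bigr => f _.
    by rewrite -big_mkcond/= (big_pred1 f)// => g; rewrite eq_sym.
  apply: (@le_trans _ _ (\sum_(f : {ffun 'I_m -> 'I_q}) l ^+ 2 * e * (2 * q%:R) ^+ m)).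
    apply: ler_sum => f _; rewrite -mulr_sumr ler_pM2l; first exact: sum_overlap.
    by rewrite mulr_gt0// exprn_gt0.
  rewrite sumr_const card_ffun !card_ord -[leLHS]mulr_natr natrX -/M [(2 * q%:R) ^+ m]exprMn -/M.
  rewrite le_eqVlt; apply/orP; left; apply/eqP.
  by move: (2 ^+ m : R) => c; ring.
have -> : 2 * K%:R * expR (z ^+ 2 / 4 + 8 * (z + 4) / K%:R - m%:R * lam) = (M * l)^-1.
  rewrite /M /l qE -expRM_natl invfM invf_div -!expRN mulrCA -expRD.
  by congr (_ * expR _); ring.
rewrite -/e.
have h1 : (M * l) ^+ 2 <= mu ^+ 2 by rewrite ler_pXn2r ?nnegrE ?(ltW Ml0) ?(ltW mu0).
have mu2 : 0 < mu ^+ 2 by rewrite exprn_gt0.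
rewrite -(ler_pM2r mu2); apply: (le_trans sm); rewrite mulrDl; apply: lerD.
  have h2 : 1 <= (M * l)^-1 * mu by rewrite (ler_pdivlMl _ _ Ml0) mulr1.
  by rewrite [mu ^+ 2]expr2 mulrA ler_peMl// ltW.
rewrite (_ : l ^+ 2 * e * _ = 2 ^+ m * e * (M * l) ^+ 2); last first.
  by move: (2 ^+ m : R) => c; ring.
by rewrite ler_pM2l// mulr_gt0// exprn_gt0.
Qed.

Lemma blocks_failure (B : nat) (iota : 'I_B -> 'I_m -> 'I_q -> 'I_p) (t c : R) :
  (forall b l a b' l' a', iota b l a = iota b' l' a' -> b = b') ->
  0 <= c ->
  (forall b, P (block_count (iota b) t @^-1` [set 0%R]) <= c%:E)%E ->
  (P [set w | forall b, block_count (iota b) t w = 0%R] <= (c ^+ B)%:E)%E.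
Proof.
move=> iota_inj c0 Pc.
pose C (s : seq 'I_B) : {set 'I_p} := [set j | [exists b, (b \in s) && [exists l, exists a, iota b l a == j]]]%SET.
have iC s b l a : b \in s -> iota b l a \in C s.
  move=> bs; rewrite inE; apply/existsP; exists b; rewrite bs/=.
  by apply/existsP; exists l; apply/existsP; exists a.
(* Counts are nonnegative, so the failure of all the families in [s] is the vanishing of one sum, a
   single variable that depends on the columns [C s]. *)
pose S (s : seq 'I_B) w := \sum_(b <- s) block_count (iota b) t w.
have dS s : depends_on X [set ij | ij.2 \in C s] (S s).
  suff H s' : {subset s' <= s} -> depends_on X [set ij | ij.2 \in C s] (S s') by exact: H.
  elim: s' => [_|b s' IH sub].
    have -> : S [::] = fun=> 0 by apply/funext => w; rewrite /S big_nil.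
    exact: depends_on_cst.
  have -> : S (b :: s') = fun w => block_count (iota b) t w + S s' w.
    by apply/funext => w; rewrite /S big_cons.
  apply: depends_onD; last by apply: IH => y ys; apply: sub; rewrite inE ys orbT.
  by apply: depends_on_block_count => l a; apply: iC; apply: sub; rewrite inE eqxx.
have S0 s w : 0 <= S s w by apply: sumr_ge0 => b _; exact: block_count_ge0.
suff H (s : seq 'I_B) : uniq s -> (P (S s @^-1` [set 0%R]) <= (c ^+ size s)%:E)%E.
  have := H (index_enum 'I_B) (index_enum_uniq _).
  have -> : size (index_enum 'I_B) = B by rewrite -[RHS](card_ord B) cardT enumT.
  congr (P _ <= _)%E; apply/seteqP; split => w /=.
    move=> /eqP; rewrite /S psumr_eq0 => [/allP h b|b _]; last exact: block_count_ge0.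
    exact/eqP/(h b (mem_index_enum b)).
  by move=> h; apply: big1 => b _.
elim: s => [_|b s IH /= /andP[bs us]].
  by rewrite expr0 probability_le1//; have /= := depends_on_measurable (dS [::]) measurableT (measurable_set1 0); rewrite setTI.
have -> : S (b :: s) @^-1` [set 0%R] = (block_count (iota b) t @^-1` [set 0%R]) `&` (S s @^-1` [set 0%R]).
  apply/seteqP; split => w /=; rewrite /S big_cons -/(S s w).
    move=> /eqP; rewrite paddr_eq0 ?block_count_ge0// => /andP[/eqP h1 /eqP h2] //.
  by move=> [-> ->]; rewrite addr0.
rewrite (indep_depends Hindep _ (@depends_on_block_count (C [:: b]) (iota b) t _) (dS s)).
- rewrite exprS EFinM; apply: lee_pmul => //; exact: IH.
- apply/pred0P => ij /=; rewrite !inE; apply/negP => /andP[/existsP[b1 /andP[]]].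
  rewrite inE => /eqP -> /existsP[l /existsP[a /eqP h]] /existsP[b2 /andP[b2s]].
  move=> /existsP[l' /existsP[a' /eqP h']].
  by move: bs; rewrite (iota_inj b l a b2 l' a') ?b2s// h h'.
- by move=> l a; apply: iC; rewrite inE.
- exact: measurable_set1.
- exact: measurable_set1.
Qed.

End block_probability.

(** * Eigenvalues of principal minors *)

Section rayleigh.
Context (R : realType) (k : nat) (A : 'M[R]_k).
Implicit Types v w : 'rV[R]_k.

(** Row vectors, to match [eigenvalue], which refers to left eigenvectors. *)
Definition mxform v w : R := (v *m A *m w^T) 0 0.
Definition rdot v w : R := (v *m w^T) 0 0.

Lemma rdotE v w : rdot v w = \sum_i v 0 i * w 0 i.
Proof. by rewrite /rdot mxE; apply: eq_bigr => i _; rewrite mxE. Qed.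

Lemma rdotC v w : rdot v w = rdot w v.
Proof. by rewrite !rdotE; apply: eq_bigr => i _; rewrite mulrC. Qed.

Lemma rdot_ge0 v : 0 <= rdot v v.
Proof. by rewrite rdotE; apply: sumr_ge0 => i _; rewrite -expr2 sqr_ge0. Qed.

Lemma rdot_eq0 v : (rdot v v == 0) = (v == 0).
Proof.
apply/idP/eqP => [|->]; last by rewrite /rdot mul0mx mxE.
rewrite rdotE psumr_eq0 => [/allP h|i _]; last by rewrite -expr2 sqr_ge0.
apply/rowP => i; rewrite mxE; apply/eqP.
by have := h i (mem_index_enum i); rewrite /= mulf_eq0 orbb.
Qed.

Lemma mxformE v : mxform v v = \sum_i \sum_j v 0 i * A i j * v 0 j.
Proof.
rewrite /mxform mxE exchange_big/=; apply: eq_bigr => j _.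
by rewrite !mxE mulr_suml.
Qed.

Lemma continuous_mxform : continuous (fun v => mxform v v).
Proof.
rewrite (_ : (fun v => _) = fun v => \sum_i \sum_j v 0 i * A i j * v 0 j); last first.
  by apply/funext => v; exact: mxformE.
apply: continuous_big => [|i _]; first exact: add_continuous.
apply: continuous_big => [|j _]; first exact: add_continuous.
move=> v; have c l : (fun w : 'rV[R]_k => w 0 l) w @[w --> v] --> v 0 l.
  exact: coord_continuous.
exact: (cvgM (cvgM (c i) (cvg_cst (A i j))) (c j)).
Qed.

Lemma continuous_rdot : continuous (fun v => rdot v v).
Proof.
rewrite (_ : (fun v => _) = fun v => \sum_i v 0 i * v 0 i); last first.
  by apply/funext => v; exact: rdotE.
apply: continuous_big => [|i _]; first exact: add_continuous.
move=> v; have c l : (fun w : 'rV[R]_k => w 0 l) w @[w --> v] --> v 0 l.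
  exact: coord_continuous.
exact: (cvgM (c i) (c i)).
Qed.

Lemma compact_sphere : compact [set v | rdot v v = 1].
Proof.
apply: bounded_closed_compact.
  exists 1; split; first by rewrite num_real.
  move=> M M1 v /= v1; rewrite /Num.norm/= mx_normrE.
  apply/bigmax_leP; split; first by rewrite (le_trans ler01) ?ltW.
  move=> [i j] _ /=; rewrite (le_trans _ (ltW M1))//.
  rewrite -(@ler_pXn2r _ 2) ?nnegrE// expr1n real_normK ?num_real// -v1 rdotE (bigD1 j)//=.
  by rewrite ord1 -expr2 lerDl; apply: sumr_ge0 => l _; rewrite -expr2 sqr_ge0.
rewrite (_ : [set v | _] = (fun v => rdot v v) @^-1` [set 1]); last by [].
by apply: closed_comp; [move=> v _; exact: continuous_rdot|exact: closed_eq].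
Qed.

Context (symA : A^T = A) (k_gt0 : (0 < k)%N).

Lemma mxformC v w : mxform v w = mxform w v.
Proof.
rewrite /mxform -[in LHS](trmxK (v *m A *m w^T)) mxE !trmx_mul trmxK symA.
by rewrite mulmxA.
Qed.

(** A maximiser [v] on the sphere is an eigenvector: along [w = v A - mu v] the form minus [mu]
    times the square norm increases by [2 t |w|^2] to first order, so [w] must vanish. *)
Lemma rayleigh_max : exists2 mu, eigenvalue A mu &
  forall v, mxform v v <= mu * rdot v v.
Proof.
have [v /[!inE] /= v1 vmax] : exists2 c, c \in [set v | rdot v v = 1] &
    forall t, t \in [set v | rdot v v = 1] -> mxform t t <= mxform c c.
  apply: EVT_max_rV.
  - exists (delta_mx 0 (Ordinal k_gt0)) => /=.
    rewrite rdotE (bigD1 (Ordinal k_gt0))//= big1 ?addr0 ?mxE ?eqxx ?mulr1//.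
    by move=> i i0; rewrite mxE (negbTE i0) andbF mul0r.
  - exact: compact_sphere.
  - by apply: continuous_subspaceT; exact: continuous_mxform.
set mu := mxform v v in vmax.
have form_le w : mxform w w <= mu * rdot w w.
  have [->|w0] := eqVneq w 0; first by rewrite /mxform /rdot !mul0mx mxE mulr0.
  have N0 : 0 < rdot w w by rewrite lt_def rdot_eq0 w0 rdot_ge0.
  pose c := (Num.sqrt (rdot w w))^-1.
  have c2 : c ^+ 2 = (rdot w w)^-1 by rewrite exprVn sqr_sqrtr// rdot_ge0.
  have dotc : rdot (c *: w) (c *: w) = c ^+ 2 * rdot w w.
    by rewrite !rdotE mulr_sumr; apply: eq_bigr => i _; rewrite !mxE; ring.
  have formc : mxform (c *: w) (c *: w) = c ^+ 2 * mxform w w.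
    rewrite !mxformE mulr_sumr; apply: eq_bigr => i _; rewrite mulr_sumr.
    by apply: eq_bigr => j _; rewrite !mxE; ring.
  have := vmax (c *: w); rewrite inE/= dotc c2 mulVf ?gt_eqF// => /(_ erefl).
  by rewrite formc c2 ler_pdivrMl// mulrC.
exists mu => //.
have [w wE] : exists w, w = v *m A - mu *: v by eexists.
have eD (a b : 'M[R]_1) : (a + b) 0 0 = a 0 0 + b 0 0 by rewrite mxE.
have eZ c (a : 'M[R]_1) : (c *: a) 0 0 = c * a 0 0 by rewrite mxE.
have tr t : (v + t *: w)^T = v^T + t *: w^T.
  by apply/matrixP => i j; rewrite !mxE.
have expand t : mxform (v + t *: w) (v + t *: w) - mu * rdot (v + t *: w) (v + t *: w) =
    2 * t * rdot w w + t ^+ 2 * (mxform w w - mu * rdot w w).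
  have e1 : mxform (v + t *: w) (v + t *: w) = mu + 2 * t * mxform v w + t ^+ 2 * mxform w w.
    rewrite /mu (_ : 2 * t * mxform v w = t * mxform v w + t * mxform w v); last first.
      by rewrite (mxformC w v); ring.
    rewrite /mxform tr !mulmxDl !mulmxDr -?scalemxAl -?scalemxAr !(eD, eZ). ring.
  have e2 : rdot (v + t *: w) (v + t *: w) = rdot v v + 2 * t * rdot v w + t ^+ 2 * rdot w w.
    rewrite (_ : 2 * t * rdot v w = t * rdot v w + t * rdot w v); last first.
      by rewrite (rdotC w v); ring.
    rewrite /rdot tr !mulmxDl !mulmxDr -?scalemxAl -?scalemxAr !(eD, eZ); ring.
  have e3 : rdot w w = mxform v w - mu * rdot v w.
    rewrite {1}/rdot {1}wE mulmxBl -scalemxAl.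
    by rewrite mxE [X in _ + X]mxE [X in _ - X]mxE.
  by rewrite e1 e2 v1; move: (rdot w w) e3 => a ->; ring.
apply/eigenvalueP; exists v; last first.
  by apply: contra_eq_neq v1 => ->; rewrite /rdot mul0mx mxE eq_sym oner_neq0.
apply/eqP; rewrite -subr_eq0 -wE -rdot_eq0.
apply/negPn/negP => w0.
have a0 : 0 < rdot w w by rewrite lt_def w0 rdot_ge0.
set a := rdot w w in a0 *; pose C := mxform w w - mu * a.
have C1 : 0 < `|C| + 1 by rewrite ltr_pwDr.
(* With this [t] the second-order term [t C] stays above [- a], so the increment [t (2 a + t C)] is
   at least [t a]. *)
pose t := a / (`|C| + 1).
have t0 : 0 < t by rewrite divr_gt0.
have := form_le (v + t *: w); rewrite -subr_le0 expand -/a -/C.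
have tC : - a <= t * C.
  rewrite /t mulrAC ler_pdivlMr//.
  have h : - (`|C| + 1) <= C by have := ler_norm (- C); rewrite normrN; lra.
  by have := ler_wpM2l (ltW a0) h; lra.
rewrite leNgt => /negP; apply.
rewrite (_ : _ + _ = t * (2 * a + t * C)); last by ring.
by rewrite mulr_gt0//; lra.
Qed.

(** Phrased through upper bounds [b], so that the later suprema over supports and vectors become
    universal statements. *)
Lemma largest_eigenvalue_le (b : R) : largest_eigenvalue A <= b <->
  forall v, mxform v v <= b * rdot v v.
Proof.
have [mu mueig mumax] := rayleigh_max.
have ub : ubound [set a | eigenvalue A a] mu.
  move=> a /= /eigenvalueP[v vA v0].
  have N0 : 0 < rdot v v by rewrite lt_def rdot_eq0 v0 rdot_ge0.
  have := mumax v; rewrite /mxform vA -scalemxAl mxE -/(rdot v v).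
  by rewrite ler_pM2r.
have has : has_sup [set a | eigenvalue A a].
  by split; [exists mu|exists mu].
have -> : largest_eigenvalue A = mu.
  apply/eqP; rewrite eq_le; apply/andP; split.
    by apply: ge_sup => //; exists mu.
  exact: sup_upper_bound.
split=> [mub v|h].
  by apply: (le_trans (mumax v)); rewrite ler_wpM2r// rdot_ge0.
have /eigenvalueP[v vA v0] := mueig.
have N0 : 0 < rdot v v by rewrite lt_def rdot_eq0 v0 rdot_ge0.
by have := h v; rewrite /mxform vA -scalemxAl mxE -/(rdot v v) ler_pM2r.
Qed.

End rayleigh.

Section maximal_minor.
Context (R : realType) (n p m : nat) (X : 'M[R]_(n, p)).
Context (m_gt0 : (0 < m)%N) (mp : (m <= p)%N).
Implicit Types (S : {set 'I_p}) (u : 'I_p -> R).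

Definition gram_form u : R := \sum_i (\sum_j X i j * u j) ^+ 2.

Lemma principal_submatrix_form S (v : 'rV[R]_#|S|) :
  mxform (principal_submatrix (X^T *m X) S) v v =
  \sum_i (\sum_k X i (enum_val k) * v 0 k) ^+ 2.
Proof.
rewrite mxformE; under [RHS]eq_bigr do rewrite expr2 mulr_suml.
rewrite [RHS]exchange_big/=; apply: eq_bigr => k _.
under [RHS]eq_bigr do rewrite mulr_sumr.
rewrite [RHS]exchange_big/=; apply: eq_bigr => l _.
rewrite !mxE mulr_sumr mulr_suml; apply: eq_bigr => i _.
by rewrite !mxE; ring.
Qed.

(** Vectors on [S] are extended by zero to all columns, which removes the dependent dimension [#|S|]
    from what follows. *)
Lemma largest_eigenvalue_principal_le S (b : R) : #|S| = m ->
  largest_eigenvalue (principal_submatrix (X^T *m X) S) <= b <->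
  (forall u, (forall j, j \notin S -> u j = 0) -> gram_form u <= b * sqnorm u).
Proof.
move=> Sm.
have sym : (principal_submatrix (X^T *m X) S)^T = principal_submatrix (X^T *m X) S.
  apply/matrixP => k l; rewrite !mxE; apply: eq_bigr => i _.
  by rewrite !mxE mulrC.
have sumS (F : 'I_p -> R) : (forall j, j \notin S -> F j = 0) ->
    \sum_j F j = \sum_(k < #|S|) F (enum_val k).
  move=> F0; rewrite -(big_enum_val F) [RHS]big_mkcond/=.
  by apply: eq_bigr => j _; case: ifPn => // /F0.
have S0 : (0 < #|S|)%N by rewrite Sm.
apply: (iff_trans (largest_eigenvalue_le sym S0 b)); split => h.
  move=> u uS; pose v : 'rV[R]_#|S| := \row_k u (enum_val k).
  have := h v; rewrite principal_submatrix_form rdotE /gram_form /sqnorm.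
  rewrite (sumS (fun j => u j ^+ 2)); last by move=> j /uS ->; rewrite expr0n.
  have -> : \sum_i (\sum_j X i j * u j) ^+ 2 =
      \sum_i (\sum_k X i (enum_val k) * v 0 k) ^+ 2.
    apply: eq_bigr => i _; congr (_ ^+ 2).
    rewrite (sumS (fun j => X i j * u j)) => [|j /uS ->]; last by rewrite mulr0.
    by apply: eq_bigr => k _; rewrite mxE.
  rewrite (_ : \sum_i v 0 i * v 0 i = \sum_(k < #|S|) u (enum_val k) ^+ 2)//.
  by apply: eq_bigr => k _; rewrite mxE expr2.
move=> v; pose u j := \sum_(k < #|S|) (enum_val k == j)%:R * v 0 k.
have uE k : u (enum_val k) = v 0 k.
  rewrite /u (bigD1 k)//= eqxx mul1r big1 ?addr0// => l lk.
  by rewrite (inj_eq enum_val_inj) (negbTE lk) mul0r.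
have uS j : j \notin S -> u j = 0.
  move=> jS; apply: big1 => k _; case: eqP => [kj|_]; last by rewrite mul0r.
  by move: jS; rewrite -kj enum_valP.
have := h u uS; rewrite principal_submatrix_form rdotE /gram_form /sqnorm.
rewrite (sumS (fun j => u j ^+ 2)) => [|j /uS ->]; last by rewrite expr0n.
have -> : \sum_i (\sum_j X i j * u j) ^+ 2 =
    \sum_i (\sum_k X i (enum_val k) * v 0 k) ^+ 2.
  apply: eq_bigr => i _; congr (_ ^+ 2).
  rewrite (sumS (fun j => X i j * u j)) => [|j /uS ->]; last by rewrite mulr0.
  by apply: eq_bigr => k _; rewrite uE.
rewrite (_ : \sum_(k < #|S|) u (enum_val k) ^+ 2 = \sum_i v 0 i * v 0 i)//.
by apply: eq_bigr => k _; rewrite uE expr2.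
Qed.

Lemma max_subset_eigenvalue_le (b : R) :
  max_subset_eigenvalue m X <= b <->
  (forall S u, #|S| = m -> (forall j, j \notin S -> u j = 0) ->
     gram_form u <= b * sqnorm u).
Proof.
pose lam S := largest_eigenvalue (principal_submatrix (X^T *m X) S).
have ub : ubound [set lam S | S in [set S : {set 'I_p} | #|S| = m]] (\sum_S `|lam S|).
  move=> _ [S _ <-]; rewrite (bigD1 S)//= ler_wpDr ?ler_norm//.
  exact: sumr_ge0.
(* Without a subset of size [m] the supremum would be the default value 0; [m <= p] provides one. *)
have ne : [set lam S | S in [set S : {set 'I_p} | #|S| = m]] !=set0.
  pose S : {set 'I_p} := [set widen_ord mp l | l : 'I_m]%SET.
  exists (lam S), S => //=; rewrite card_imset ?card_ord//.
  by move=> l l' /(congr1 val)/= ll'; exact: val_inj.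
have has : has_sup [set lam S | S in [set S : {set 'I_p} | #|S| = m]].
  by split => //; exists (\sum_S `|lam S|).
split=> [Tb S u Sm uS|h].
  apply: (largest_eigenvalue_principal_le b Sm).1 => //.
  by apply: le_trans Tb; apply: sup_upper_bound => //; exists S.
apply: ge_sup => // _ [S /= Sm <-].
by apply/(largest_eigenvalue_principal_le b Sm) => u uS; exact: h uS.
Qed.

End maximal_minor.

(** * Discretisation of the unit ball *)

Section grid.
Context (R : realType) (n p m : nat) (y : 'I_n -> 'I_p -> R) (N : R).
Implicit Types (u v : 'I_p -> R) (S : {set 'I_p}).

(** The shift [N] is a parameter: it is [n] in the deviation estimates and an arbitrary threshold in
    the proof of measurability. *)
Definition dform u : R := \sum_i (\sum_j y i j * u j) ^+ 2 - N * sqnorm u.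

Definition grid_point (K : nat) (g : 'I_(K.*2.+1)) : R := (g%:R - K%:R) / K%:R.

(** Supports are listed by a function [f], so that grid vectors are indexed by a product of function
    types. Counting ordered supports gives [p ^ m], which is the factor exp (L^2) absorbed by the
    centring. *)
Definition grid_vec (K : nat) (f : {ffun 'I_m -> 'I_p})
    (g : {ffun 'I_m -> 'I_(K.*2.+1)}) (j : 'I_p) : R :=
  \sum_l (f l == j)%:R * grid_point (g l).

Lemma sqnorm_ge0 u : 0 <= sqnorm u.
Proof. by apply: sumr_ge0 => j _; exact: sqr_ge0. Qed.

(** Rounding is towards 0, so that a rounded vector is no longer than the original one and stays in
    the unit ball. *)
Lemma grid_point_approx (K : nat) (a : R) : (0 < K)%N -> `|a| <= 1 ->
  exists g : 'I_(K.*2.+1), `|grid_point g| <= `|a| /\ `|a - grid_point g| <= K%:R^-1.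
Proof.
move=> K0 a1; have K0' : 0 < K%:R :> R by rewrite ltr0n.
have aK0 : 0 <= `|a| * K%:R by rewrite mulr_ge0.
have /andP[t1 t2] := truncn_itv aK0; set k := Num.trunc _ in t1 t2.
have kK : (k <= K)%N.
  by rewrite -(ler_nat R); apply: (le_trans t1); rewrite ler_piMl// ltW.
have t1' : k%:R / K%:R <= `|a| by rewrite ler_pdivrMr.
have t2' : `|a| - k%:R / K%:R <= K%:R^-1.
  rewrite lerBlDr -(ler_pM2r K0') mulrDl mulVf ?gt_eqF// divfK ?gt_eqF//.
  by move: t2; rewrite -natr1; lra.
have kK0 : 0 <= k%:R / K%:R :> R by rewrite divr_ge0.
have [a0|a0] := leP 0 a.
  have gK : (K + k < K.*2.+1)%N by rewrite ltnS -addnn leq_add2l.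
  exists (Ordinal gK); rewrite /grid_point/= natrD addrAC subrr add0r.
  rewrite (ger0_norm kK0); split => //; move: t1' t2'; rewrite (ger0_norm a0) => t1' t2'.
  by rewrite ger0_norm// subr_ge0.
have gK : (K - k < K.*2.+1)%N by rewrite ltnS -addnn (leq_trans (leq_subr _ _))// leq_addr.
exists (Ordinal gK); rewrite /grid_point/= natrB// addrAC subrr add0r mulNr normrN.
rewrite (ger0_norm kK0); split => //; move: t1' t2'; rewrite (ltr0_norm a0) => t1' t2'.
by rewrite opprK -normrN opprD ger0_norm//; lra.
Qed.

Lemma grid_vec_approx (K : nat) S u : (0 < K)%N -> #|S| = m ->
    (forall j, j \notin S -> u j = 0) -> (forall j, `|u j| <= 1) ->
  exists f : {ffun 'I_m -> 'I_p}, exists g : {ffun 'I_m -> 'I_(K.*2.+1)}, [/\ injectiveb f,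
    forall j, `|grid_vec f g j| <= `|u j| &
    forall j, `|u j - grid_vec f g j| <= (j \in S)%:R / K%:R].
Proof.
move=> K0 Sm uS u1.
pose f : {ffun 'I_m -> 'I_p} := [ffun l => enum_val (cast_ord (esym Sm) l)].
have injf : injective f.
  by move=> l l'; rewrite !ffunE => /enum_val_inj /cast_ord_inj.
have /boolp.choice[G GP] := fun j => grid_point_approx K0 (u1 j).
pose g : {ffun 'I_m -> 'I_(K.*2.+1)} := [ffun l => G (f l)].
have gvS j : j \in S -> grid_vec f g j = grid_point (G j).
  move=> jS; pose l := cast_ord Sm (enum_rank_in jS j).
  have fl : f l = j by rewrite ffunE /l cast_ordK enum_rankK_in.
  rewrite /grid_vec (bigD1 l)//= fl eqxx mul1r big1.
    by rewrite addr0 /g ffunE fl.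
  move=> l' l'l; case: eqP => [fl'|_]; last by rewrite mul0r.
  by move: l'l; rewrite (injf l' l) ?eqxx// fl' fl.
have gvC j : j \notin S -> grid_vec f g j = 0.
  move=> jS; apply: big1 => l _; case: eqP => [flj|_]; last by rewrite mul0r.
  by move: jS; rewrite -flj ffunE enum_valP.
exists f, g; split => [|j|j]; first exact/injectiveP.
  have [jS|jS] := boolP (j \in S); first by rewrite gvS//; have [] := GP j.
  by rewrite gvC// normr0.
have [jS|jS] := boolP (j \in S); first by rewrite gvS// mul1r; have [] := GP j.
by rewrite gvC// uS// subr0 normr0 mul0r.
Qed.

(** Only the finiteness of [C] matters: it makes the best constant in [net_bound] well defined. *)
Lemma dform_bounded : exists2 C, 0 <= C & forall u, `|dform u| <= C * sqnorm u.
Proof.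
pose c i := \sum_j `|y i j|.
exists (\sum_i c i ^+ 2 + `|N|).
  by rewrite addr_ge0//; apply: sumr_ge0 => i _; exact: sqr_ge0.
move=> u; rewrite /dform mulrDl.
apply: (le_trans (ler_normB _ _)); apply: lerD; last first.
  by rewrite normrM (ger0_norm (sqnorm_ge0 u)).
rewrite ger0_norm; last by apply: sumr_ge0 => i _; exact: sqr_ge0.
rewrite mulr_suml; apply: ler_sum => i _.
have uj j : `|u j| <= Num.sqrt (sqnorm u).
  rewrite -(ler_pXn2r (n := 2))// ?nnegrE ?sqrtr_ge0//.
  rewrite sqr_sqrtr ?sqnorm_ge0// real_normK ?num_real// /sqnorm (bigD1 j)//= lerDl.
  by apply: sumr_ge0 => k _; exact: sqr_ge0.
have h : `|\sum_j y i j * u j| <= c i * Num.sqrt (sqnorm u).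
  rewrite /c mulr_suml; apply: (le_trans (ler_norm_sum _ _ _)).
  by apply: ler_sum => j _; rewrite normrM ler_wpM2l.
rewrite -real_normK ?num_real//.
have -> : c i ^+ 2 * sqnorm u = (c i * Num.sqrt (sqnorm u)) ^+ 2.
  by rewrite exprMn sqr_sqrtr ?sqnorm_ge0.
by rewrite ler_pXn2r ?nnegrE// (le_trans _ h).
Qed.

(* With [a = u - v] and [b = u + v], [dform u - dform v] is the polar form of
   [dform] at [(a, b)], hence also at [(a / s, s b)]. *)
Lemma dform_diff (C s : R) S u v : s != 0 ->
    (forall w, (forall j, j \notin S -> w j = 0) -> `|dform w| <= C * sqnorm w) ->
    (forall j, j \notin S -> u j = 0) -> (forall j, j \notin S -> v j = 0) ->
  `|dform u - dform v| <= C / 2 * (sqnorm (fun j => u j - v j) / s ^+ 2 +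
      s ^+ 2 * sqnorm (fun j => u j + v j)).
Proof.
move=> s0 dC uS vS.
pose w1 j := ((u j - v j) / s + s * (u j + v j)) / 2.
pose w2 j := ((u j - v j) / s - s * (u j + v j)) / 2.
have w1S j : j \notin S -> w1 j = 0 by move=> jS; rewrite /w1 uS// vS//; field.
have w2S j : j \notin S -> w2 j = 0 by move=> jS; rewrite /w2 uS// vS//; field.
have dE : dform u - dform v = dform w1 - dform w2.
  have lin12 i : (\sum_j y i j * u j) ^+ 2 - (\sum_j y i j * v j) ^+ 2 =
      (\sum_j y i j * w1 j) ^+ 2 - (\sum_j y i j * w2 j) ^+ 2.
    set a := \sum_j y i j * u j; set b := \sum_j y i j * v j.
    have -> : \sum_j y i j * w1 j = ((a - b) / s + s * (a + b)) / 2.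
      rewrite /a /b -sumrB -big_split/= mulr_sumr mulr_suml -big_split/= mulr_suml.
      by apply: eq_bigr => j _; rewrite /w1; field.
    have -> : \sum_j y i j * w2 j = ((a - b) / s - s * (a + b)) / 2.
      rewrite /a /b -sumrB -big_split/= mulr_sumr mulr_suml -sumrB mulr_suml.
      by apply: eq_bigr => j _; rewrite /w2; field.
    by field.
  have sq12 : sqnorm u - sqnorm v = sqnorm w1 - sqnorm w2.
    by rewrite /sqnorm -!sumrB; apply: eq_bigr => j _; rewrite /w1 /w2; field.
  rewrite /dform; transitivity
    (\sum_i ((\sum_j y i j * u j) ^+ 2 - (\sum_j y i j * v j) ^+ 2) - N * (sqnorm u - sqnorm v)).
    by rewrite sumrB; ring.
  rewrite sq12; under eq_bigr do rewrite lin12.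
  by rewrite sumrB; ring.
rewrite dE; apply: (le_trans (ler_normB _ _)).
apply: (le_trans (lerD (dC _ w1S) (dC _ w2S))).
rewrite -mulrDr -mulrA; have -> : sqnorm w1 + sqnorm w2 =
  2^-1 * (sqnorm (fun j => u j - v j) / s ^+ 2 + s ^+ 2 * sqnorm (fun j => u j + v j)).
  rewrite /sqnorm mulr_suml mulr_sumr -!big_split/= mulr_sumr.
  by apply: eq_bigr => j _; rewrite /w1 /w2; field.
by [].
Qed.

Lemma grid_approx (C : R) (K : nat) S u : 0 <= C -> (0 < K)%N -> (0 < m)%N -> #|S| = m ->
    (forall w, (forall j, j \notin S -> w j = 0) -> `|dform w| <= C * sqnorm w) ->
    (forall j, j \notin S -> u j = 0) -> sqnorm u <= 1 ->
  exists f : {ffun 'I_m -> 'I_p}, exists g : {ffun 'I_m -> 'I_(K.*2.+1)}, [/\ injectiveb f,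
    sqnorm (grid_vec f g) <= 1 &
    `|dform u - dform (grid_vec f g)| <= 2 * (m%:R / K%:R) * C].
Proof.
move=> C0 K0 m0 Sm dC uS u1.
have K0' : 0 < K%:R :> R by rewrite ltr0n.
have m0' : 1 <= m%:R :> R by rewrite ler1n.
have uj j : `|u j| <= 1.
  rewrite -(@ler_pXn2r _ 2) ?nnegrE// expr1n real_normK ?num_real// (le_trans _ u1)//.
  rewrite /sqnorm (bigD1 j)//= lerDl.
  by apply: sumr_ge0 => k _; exact: sqr_ge0.
have [f [g [injf gu ug]]] := grid_vec_approx K0 Sm uS uj.
set v := grid_vec f g in gu ug *.
have vu : sqnorm v <= sqnorm u.
  apply: ler_sum => j _; rewrite -[leLHS]real_normK ?num_real// -[leRHS]real_normK ?num_real//.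
  by rewrite ler_pXn2r ?nnegrE.
exists f, g; split => //; first exact: le_trans u1.
have vS j : j \notin S -> v j = 0.
  by move=> jS; apply/eqP; rewrite -normr_eq0 eq_le normr_ge0 (le_trans (gu j))// uS ?normr0.
pose e := m%:R / K%:R : R.
have e0 : 0 < e by rewrite divr_gt0//; lra.
(* Balances the two terms of [dform_diff]: with [|u - v|^2 <= e^2] and [|u + v|^2 <= 4], each is at
   most [2 e]. *)
pose s := Num.sqrt (e / 2).
have s2 : s ^+ 2 = e / 2 by rewrite sqr_sqrtr// divr_ge0// ltW.
have s0 : s != 0 by rewrite sqrtr_eq0 -ltNge divr_gt0.
apply: (le_trans (dform_diff s0 dC uS vS)); rewrite s2 -/e.
have h1 : sqnorm (fun j => u j - v j) <= e ^+ 2.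
  apply: (@le_trans _ _ (\sum_j ((j \in S)%:R / K%:R) ^+ 2)).
    apply: ler_sum => j _; rewrite -[leLHS]real_normK ?num_real//.
    by rewrite ler_pXn2r ?nnegrE ?divr_ge0.
  rewrite (_ : \sum_j _ = m%:R / K%:R ^+ 2).
    rewrite /e expr_div_n ler_pM2r ?invr_gt0 ?exprn_gt0// expr2 ler_peMl//; lra.
  rewrite -Sm -sum1_card natr_sum [in RHS]big_mkcond/= mulr_suml; apply: eq_bigr => j _.
  by case: (j \in S); rewrite ?mul0r ?expr0n// expr_div_n expr1n.
have h2 : sqnorm (fun j => u j + v j) <= 4.
  apply: (@le_trans _ _ (\sum_j 2 * (u j ^+ 2 + v j ^+ 2))).
    by apply: ler_sum => j _; have := sqr_ge0 (u j - v j); lra.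
  by rewrite -mulr_sumr big_split/= -/(sqnorm u) -/(sqnorm v); lra.
have h3 : sqnorm (fun j => u j - v j) / (e / 2) <= 2 * e.
  by rewrite ler_pdivrMr ?divr_gt0//; move: h1; lra.
have h4 : e / 2 * sqnorm (fun j => u j + v j) <= 2 * e.
  by have := ler_wpM2l (ltW e0) h2; lra.
have C2 : 0 <= C / 2 by lra.
by have := ler_wpM2l C2 (lerD h3 h4); lra.
Qed.

Lemma sqnorm_scale (c : R) u : sqnorm (fun j => c * u j) = c ^+ 2 * sqnorm u.
Proof. by rewrite /sqnorm mulr_sumr; apply: eq_bigr => j _; rewrite exprMn. Qed.

Lemma dform_scale (c : R) u : dform (fun j => c * u j) = c ^+ 2 * dform u.
Proof.
rewrite /dform sqnorm_scale mulrBr; congr (_ - _); last by rewrite mulrCA.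
rewrite mulr_sumr; apply: eq_bigr => i _; rewrite -exprMn mulr_sumr; congr (_ ^+ 2).
by apply: eq_bigr => j _; rewrite mulrCA.
Qed.

(* The best constant [C] in [|dform u| <= C * sqnorm u] satisfies
   [C <= b + 2 (m / K) C], which is solved for [C]. *)
Lemma net_bound (b : R) (K : nat) S : (0 < m)%N -> (2 * m < K)%N -> #|S| = m ->
    (forall (f : {ffun 'I_m -> 'I_p}) (g : {ffun 'I_m -> 'I_(K.*2.+1)}), injectiveb f ->
       sqnorm (grid_vec f g) <= 1 -> `|dform (grid_vec f g)| <= b) ->
  forall u, (forall j, j \notin S -> u j = 0) ->
    `|dform u| <= b / (1 - 2 * (m%:R / K%:R)) * sqnorm u.
Proof.
move=> m0 mK Sm gb.
have K0 : (0 < K)%N by exact: leq_ltn_trans mK.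
have K0' : 0 < K%:R :> R by rewrite ltr0n.
pose e := 2 * (m%:R / K%:R) : R.
have e1 : e < 1.
  by rewrite /e mulrA ltr_pdivrMr// mul1r -natrM ltr_nat.
pose V := [set C : R | 0 <= C /\ forall u, (forall j, j \notin S -> u j = 0) ->
  `|dform u| <= C * sqnorm u].
have V0 : V !=set0.
  by have [C C0 hC] := dform_bounded; exists C; split => // u _; exact: hC.
have hV : has_inf V by split => //; exists 0 => C [].
pose Ci := inf V.
have Ci0 : 0 <= Ci by apply: lb_le_inf => // C [].
(* The infimum is itself admissible, so the improvement below can be applied to it. *)
have ViC : V Ci.
  split => // u uS; have [u0|u0] := eqVneq (sqnorm u) 0.
    by have [C [_ hC]] := V0; have := hC u uS; rewrite u0 !mulr0.
  have su : 0 < sqnorm u by rewrite lt_def u0 sqnorm_ge0.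
  rewrite -ler_pdivrMr//; apply: lb_le_inf => // C [_ hC].
  by rewrite ler_pdivrMr//; exact: hC.
have step : V (b + e * Ci).
  have unit_le u : (forall j, j \notin S -> u j = 0) -> sqnorm u <= 1 ->
      `|dform u| <= b + e * Ci.
    move=> uS u1; have [f [g [injf g1 ug]]] := grid_approx Ci0 K0 m0 Sm ViC.2 uS u1.
    have := gb f g injf g1; rewrite -/e in ug.
    have := ler_normD (dform u - dform (grid_vec f g)) (dform (grid_vec f g)).
    by rewrite subrK; lra.
  split.
    apply: le_trans (unit_le (fun=> 0) _ _) => //.
    by rewrite /sqnorm big1 ?ler01// => j _; rewrite expr0n.
  move=> u uS; have [u0|u0] := eqVneq (sqnorm u) 0.
    by have := ViC.2 u uS; rewrite u0 !mulr0.
  have su : 0 < sqnorm u by rewrite lt_def u0 sqnorm_ge0.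
  pose c := (Num.sqrt (sqnorm u))^-1.
  have c2 : c ^+ 2 = (sqnorm u)^-1 by rewrite exprVn sqr_sqrtr// ltW.
  pose w j := c * u j.
  have wS j : j \notin S -> w j = 0 by move=> jS; rewrite /w uS// mulr0.
  have := unit_le w wS; rewrite sqnorm_scale dform_scale c2 mulVf ?gt_eqF// => /(_ (lexx _)).
  by rewrite normrM gtr0_norm ?invr_gt0// ler_pdivrMl// mulrC.
have : Ci <= b + e * Ci by apply: ge_inf => //; exact: hV.2.
move=> h u uS; apply: (le_trans (ViC.2 u uS)); apply: ler_wpM2r; first exact: sqnorm_ge0.
by rewrite -/e ler_pdivlMr; lra.
Qed.

End grid.

(** * Tails of the statistic *)

Section statistic.
Context d (T : measurableType d) (R : realType) (P : probability T R).
Context (n p m : nat) (x : 'I_n -> 'I_p -> {RV P >-> R}).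
Context (m_gt0 : (0 < m)%N) (mp : (m <= p)%N).
Implicit Types (S : {set 'I_p}) (u : 'I_p -> R).
Notation X := (fun ij : 'I_n * 'I_p => x ij.1 ij.2).

Definition top_eigenvalue (w : T) : R :=
  max_subset_eigenvalue m (\matrix_(i < n, j < p) x i j w).

Lemma gram_form_quad u w : gram_form (\matrix_(i < n, j < p) x i j w) u = quad x u w.
Proof.
apply: eq_bigr => i _; congr (_ ^+ 2); apply: eq_bigr => j _.
by rewrite mxE.
Qed.

Lemma top_eigenvalue_le w (b : R) : top_eigenvalue w <= b <->
  (forall S u, #|S| = m -> (forall j, j \notin S -> u j = 0) ->
     quad x u w <= b * sqnorm u).
Proof.
apply: (iff_trans (max_subset_eigenvalue_le _ m_gt0 mp b)).
by split=> h S u Sm uS; have := h S u Sm uS; rewrite gram_form_quad.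
Qed.

Lemma quad_le_top_eigenvalue w S u : #|S| = m -> (forall j, j \notin S -> u j = 0) ->
  quad x u w <= top_eigenvalue w * sqnorm u.
Proof. by move: S u; apply/top_eigenvalue_le. Qed.

Lemma grid_vec_support (K : nat) (f : {ffun 'I_m -> 'I_p}) (g : {ffun 'I_m -> 'I_(K.*2.+1)}) j :
  j \notin [set f l | l : 'I_m]%SET -> grid_vec R f g j = 0.
Proof.
move=> jf; apply: big1 => l _; case: eqP => [flj|_]; last by rewrite mul0r.
by move: jf; rewrite -flj imset_f.
Qed.

Lemma card_grid_support (f : {ffun 'I_m -> 'I_p}) : injectiveb f ->
  #|[set f l | l : 'I_m]%SET| = m.
Proof. by move=> /injectiveP injf; rewrite card_imset ?card_ord. Qed.

Lemma dform_quad w (N : R) u : dform (fun i j => x i j w) N u = quad x u w - N * sqnorm u.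
Proof. by []. Qed.

(** Countably many vectors occur on the right, whence measurability. If [dform] with shift [b] is
    positive somewhere, it is still positive at a grid vector close to the normalised point. *)
Lemma top_eigenvalue_le_grid w (b : R) : top_eigenvalue w <= b <->
  (forall (K : nat) (f : {ffun 'I_m -> 'I_p}) (g : {ffun 'I_m -> 'I_(K.*2.+1)}), injectiveb f ->
     quad x (grid_vec R f g) w <= b * sqnorm (grid_vec R f g)).
Proof.
split=> [Tb K f g injf|h].
  by apply: ((top_eigenvalue_le w b).1 Tb) (card_grid_support injf) _; exact: grid_vec_support.
apply/top_eigenvalue_le => S u Sm uS; rewrite -subr_le0 -(dform_quad w b u).
rewrite leNgt; apply/negP => D0.
pose y i j : R := x i j w.
have [C C0 hC] := dform_bounded y b.
have hC' : forall v, (forall j, j \notin S -> v j = 0) -> `|dform y b v| <= C * sqnorm v.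
  by move=> v _; exact: hC.
have su : 0 < sqnorm u.
  rewrite lt_def sqnorm_ge0 andbT; apply/eqP => u0.
  by have := lt_le_trans D0 (le_trans (ler_norm _) (hC u)); rewrite u0 mulr0 ltxx.
pose c := (Num.sqrt (sqnorm u))^-1.
have c2 : c ^+ 2 = (sqnorm u)^-1 by rewrite exprVn sqr_sqrtr// ltW.
pose v j := c * u j.
have vS j : j \notin S -> v j = 0 by move=> jS; rewrite /v uS// mulr0.
have v1 : sqnorm v <= 1 by rewrite sqnorm_scale c2 mulVf// gt_eqF.
have Dv : 0 < dform y b v by rewrite dform_scale mulr_gt0// c2 invr_gt0.
(* Any [K] above [r] makes the error of [grid_approx] smaller than the positive value
   [dform y b v]. *)
pose r := 2 * m%:R * C / dform y b v.
have r0 : 0 <= r by rewrite divr_ge0 ?(ltW Dv)// !mulr_ge0.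
have [K K_gt0 rK] : exists2 K, (0 < K)%N & r < K%:R.
  by exists (Num.trunc r).+1 => //; have /andP[] := truncn_itv r0.
have [f [g [injf _ close]]] := grid_approx C0 K_gt0 m_gt0 Sm hC' vS v1.
have K0 : 0 < K%:R :> R by rewrite ltr0n.
have small : 2 * (m%:R / K%:R) * C < dform y b v.
  have -> : 2 * (m%:R / K%:R) * C = 2 * m%:R * C / K%:R by field; rewrite gt_eqF.
  by rewrite ltr_pdivrMr// [_ * K%:R]mulrC -ltr_pdivrMr.
have : 0 < dform y b (grid_vec R f g).
  have h1 := le_lt_trans (le_trans (ler_norm _) close) small. by rewrite ltrBlDr ltrDl in h1.
by rewrite (dform_quad w) subr_gt0 ltNge h.
Qed.

Lemma measurable_top_eigenvalue : measurable_fun setT top_eigenvalue.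
Proof.
apply: (measurability _ (RGenOInfty.measurableE R)) => _ [_ [a ->] <-].
rewrite setTI.
pose A (K : nat) (fg : {ffun 'I_m -> 'I_p} * {ffun 'I_m -> 'I_(K.*2.+1)}) : set T :=
  if injectiveb fg.1 then
    [set w | (quad x (grid_vec R fg.1 fg.2) w <= a * sqnorm (grid_vec R fg.1 fg.2))%R]
  else setT.
rewrite (_ : _ @^-1` _ = ~` \bigcap_K \bigcap_fg A K fg); last first.
  apply/seteqP; split => w /=; rewrite in_itv/= andbT.
    move=> aT h; move: aT; rewrite ltNge => /negP; apply; apply/top_eigenvalue_le_grid.
    by move=> K f g injf; have := h K Logic.I (f, g) Logic.I; rewrite /A/= injf.
  move=> h; rewrite ltNge; apply/negP => /top_eigenvalue_le_grid Ta; apply: h.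
  by move=> K _ fg _; rewrite /A; case: ifPn => // injf; exact: Ta.
apply: measurableC; apply: bigcapT_measurable => K.
apply: fin_bigcap_measurable => // fg _; rewrite /A; case: ifPn => // _.
rewrite -preimage_itvNyc -[X in measurable X]setTI.
by apply: (@measurable_quad _ _ _ _ _ _ x) => //; exact: measurable_itv.
Qed.

(** [net_bound] is used with the random bound [b = ln (1 + s) / t'], a soft maximum: every grid
    value is below [b] because its exponential is one term of [s]. The resulting inequality is
    pointwise and can be integrated term by term. *)
Lemma expR_top_eigenvalue_le (t : R) (K : nat) w : 0 < t -> (8 * m <= K)%N ->
  expR (t * (top_eigenvalue w - n%:R)) <= 1 +
    \sum_(fg : {ffun 'I_m -> 'I_p} * {ffun 'I_m -> 'I_(K.*2.+1)}
        | sqnorm (grid_vec R fg.1 fg.2) <= 1)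
      expR (t / (1 - 2 * (m%:R / K%:R)) *
        `|dform (fun i j => x i j w) n%:R (grid_vec R fg.1 fg.2)|).
Proof.
move=> t0 mK; set s := \sum_(_ | _) _.
have m0' : 0 < m%:R :> R by rewrite ltr0n.
have K0 : 0 < K%:R :> R.
  by rewrite ltr0n (leq_trans _ mK)// muln_gt0.
pose e := 2 * (m%:R / K%:R) : R.
have e1 : e <= 4^-1.
  rewrite /e mulrA ler_pdivrMr//.
  have : (8 * m)%:R <= K%:R :> R by rewrite ler_nat.
  by rewrite natrM; lra.
rewrite -/e in s *; pose t' := t / (1 - e).
have t'0 : 0 < t' by rewrite divr_gt0//; lra.
have s0 : 0 <= s by apply: sumr_ge0 => fg _; exact: expR_ge0.
pose b := ln (1 + s) / t'.
have gb (f : {ffun 'I_m -> 'I_p}) (g : {ffun 'I_m -> 'I_(K.*2.+1)}) : injectiveb f ->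
    sqnorm (grid_vec R f g) <= 1 ->
    `|dform (fun i j => x i j w) n%:R (grid_vec R f g)| <= b.
  move=> _ g1; rewrite /b ler_pdivlMr// mulrC.
  rewrite -ler_expR lnK ?posrE ?ltr_wpDr// /s (bigD1 (f, g))//= addrCA ler_wpDr//.
  by rewrite addr_ge0//; apply: sumr_ge0 => fg _; exact: expR_ge0.
have mK2 : (2 * m < K)%N.
  by apply: leq_trans mK; rewrite ltn_pmul2r.
have Tb : top_eigenvalue w <= n%:R + b / (1 - e).
  apply/top_eigenvalue_le => S u Sm uS.
  have := net_bound m_gt0 mK2 Sm gb uS; rewrite (dform_quad w) -/e.
  by move=> h; have := le_trans (ler_norm _) h; rewrite lerBlDl mulrDl.
apply: (@le_trans _ _ (expR (t * (b / (1 - e))))).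
  by rewrite ler_expR ler_pM2l//; lra.
rewrite (_ : t * (b / (1 - e)) = ln (1 + s)); last first.
  by rewrite mulrCA -/t' /b divfK// gt_eqF.
by rewrite lnK// posrE ltr_wpDr.
Qed.

Context (Hnormal : forall i j, standard_normal (x i j)).
Context (Hindep : mutually_independent X).

Lemma measurable_dform u (N : R) :
  measurable_fun setT (fun w => dform (fun i j => x i j w) N u).
Proof.
rewrite (_ : (fun _ => _) = fun w => quad x u w - N * sqnorm u)//.
by apply: measurable_funB => //; exact: measurable_quad.
Qed.

(** Grid vectors lie in the ball, not on the sphere. Normalising can only increase the absolute
    value of the form; the null vector is treated apart. *)
Lemma expR_dform_le u (t : R) : sqnorm u <= 1 -> 0 <= t <= 4^-1 ->
  (\int[P]_w (expR (t * `|dform (fun i j => x i j w) n%:R u|))%:E <=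
   (2 * expR (n%:R * t ^+ 2 + 4 * n%:R * t ^+ 3))%:E)%E.
Proof.
move=> u1 t14; have /andP[t0 _] := t14.
have mexp v : measurable_fun setT
    (fun w => expR (t * `|dform (fun i j => x i j w) n%:R v|)).
  apply: measurableT_comp => //; apply: measurable_funM => //.
  by apply: measurableT_comp => //; exact: measurable_dform.
have [u0|u0] := eqVneq (sqnorm u) 0.
  rewrite (eq_integral (fun=> 1%:E)); last first.
    move=> w _; have [C _ hC] := dform_bounded (fun i j => x i j w) n%:R.
    have := hC u; rewrite u0 mulr0 normr_le0 => /eqP ->.
    by rewrite normr0 mulr0 expR0.
  rewrite integral_cst//= probability_setT mule1 lee_fin.
  have : 1 <= expR (n%:R * t ^+ 2 + 4 * n%:R * t ^+ 3).
    by rewrite -[leLHS]expR0 ler_expR addr_ge0// !mulr_ge0// exprn_ge0.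
  lra.
have su : 0 < sqnorm u by rewrite lt_def u0 sqnorm_ge0.
pose c := Num.sqrt (sqnorm u).
have c0 : c != 0 by rewrite sqrtr_eq0 -ltNge.
have c2 : c ^+ 2 = sqnorm u by rewrite sqr_sqrtr// ltW.
pose v j := c^-1 * u j.
have v1 : sqnorm v = 1 by rewrite sqnorm_scale exprVn c2 mulVf// gt_eqF.
apply: le_trans (quad_expR_norm_le Hnormal Hindep v1 t14).
apply: le_integral_fun.
- exact: mexp.
- apply: measurableT_comp => //; apply: measurable_funM => //.
  by apply: measurableT_comp => //; apply: measurable_funB => //; exact: measurable_quad.
- by move=> w; exact: expR_ge0.
- move=> w; rewrite ler_expR ler_wpM2l//.
  have -> : dform (fun i j => x i j w) n%:R u = c ^+ 2 * dform (fun i j => x i j w) n%:R v.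
    by rewrite -dform_scale; congr (dform _ _ _); apply/funext => j; rewrite mulVKf.
  by rewrite normrM ger0_norm ?sqr_ge0// c2 (dform_quad w) v1 mulr1 ler_piMl.
Qed.

Lemma integral_expR_top_le (t t' : R) (K : nat) : 0 < t -> (8 * m <= K)%N ->
  t' = t / (1 - 2 * (m%:R / K%:R)) -> 0 <= t' <= 4^-1 ->
  (\int[P]_w (expR (t * (top_eigenvalue w - n%:R)))%:E <=
   (3 * (p%:R ^+ m * (K.*2.+1)%:R ^+ m) * expR (n%:R * t' ^+ 2 + 4 * n%:R * t' ^+ 3))%:E)%E.
Proof.
move=> t0 mK t'E t'4.
pose F (fg : {ffun 'I_m -> 'I_p} * {ffun 'I_m -> 'I_(K.*2.+1)}) w :=
  expR (t' * `|dform (fun i j => x i j w) n%:R (grid_vec R fg.1 fg.2)|).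
pose A := [pred fg : {ffun 'I_m -> 'I_p} * {ffun 'I_m -> 'I_(K.*2.+1)} |
  sqnorm (grid_vec R fg.1 fg.2) <= 1].
have mF fg : measurable_fun setT (F fg).
  apply: measurableT_comp => //; apply: measurable_funM => //.
  by apply: measurableT_comp => //; exact: measurable_dform.
have F0 fg w : 0 <= F fg w by exact: expR_ge0.
have mS : measurable_fun setT (fun w => \sum_(fg in A) F fg w).
  rewrite (_ : (fun _ => _) = fun w => \sum_fg (if fg \in A then F fg w else 0)).
    by apply: measurable_sum => fg; case: (fg \in A).
  by apply/funext => w; rewrite big_mkcond.
apply: (@le_trans _ _ (\int[P]_w (1 + \sum_(fg in A) F fg w)%R%:E)%E).
  apply: le_integral_fun.
  - apply: measurableT_comp => //; apply: measurable_funM => //.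
    by apply: measurable_funB => //; exact: measurable_top_eigenvalue.
  - exact: measurable_funD.
  - by move=> w; exact: expR_ge0.
  - move=> w; apply: (le_trans (expR_top_eigenvalue_le w t0 mK)).
    by rewrite -t'E.
under eq_integral do rewrite EFinD.
rewrite ge0_integralD; [|by []|by []|by []|..]; last 2 first.
- by move=> w _; rewrite lee_fin; apply: sumr_ge0.
- exact/measurable_EFinP.
rewrite integral_cst//= probability_setT mule1.
rewrite integral_EFin_sum; [|exact: mF|exact: F0].
set E := expR (_ + _).
have E1 : 1 <= E.
  have /andP[h0 _] := t'4.
  by rewrite -[leLHS]expR0 ler_expR addr_ge0// !mulr_ge0// exprn_ge0.
have N1 : 1 <= p%:R ^+ m * (K.*2.+1)%:R ^+ m :> R.
  rewrite -!natrX -natrM ler1n muln_gt0 !expn_gt0/= andbT.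
  by rewrite (leq_trans m_gt0 mp).
apply: (@le_trans _ _ (1%:E + (p%:R ^+ m * (K.*2.+1)%:R ^+ m * (2 * E))%:E)%E).
  apply: leeD => //.
  apply: (@le_trans _ _ (\sum_(fg : {ffun 'I_m -> 'I_p} * {ffun 'I_m -> 'I_(K.*2.+1)}) (2 * E)%:E)%E).
    rewrite big_mkcond/=; apply: lee_sum => fg _; case: ifPn => [fgA|_].
      exact: expR_dform_le.
    by rewrite lee_fin mulr_ge0// (le_trans ler01).
  rewrite sumEFin lee_fin sumr_const card_prod !card_ffun !card_ord.
  by rewrite -[leLHS]mulr_natl natrM !natrX.
(* The additive 1 is absorbed by the product of the count and [E], both at least 1, whence the
   constant 3 = 1 + 2. *)
rewrite -EFinD lee_fin.
have : 1 <= p%:R ^+ m * (K.*2.+1)%:R ^+ m * E by rewrite (le_trans N1)// ler_peMr// (le_trans ler01).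
lra.
Qed.

End statistic.

Section finite_bound.
Context d (T : measurableType d) (R : realType) (P : probability T R).
Context (n p m : nat) (x : 'I_n -> 'I_p -> {RV P >-> R}).
Context (m_ge2 : (2 <= m)%N) (mp : (m <= p)%N) (n_ge : (4096 <= n)%N).
Notation X := (fun ij : 'I_n * 'I_p => x ij.1 ij.2).
Context (Hnormal : forall i j, standard_normal (x i j)).
Context (Hindep : mutually_independent X).

Let m_gt0 : (0 < m)%N. Proof. exact: leq_trans m_ge2. Qed.
Let s : R := Num.sqrt n%:R.
Let L : R := Num.sqrt (m%:R * ln p%:R).
Let Z (w : T) : R := centered_statistic m (\matrix_(i < n, j < p) x i j w).

Lemma p_gt1 : 1 < p%:R :> R.
Proof. by rewrite ltr1n (leq_trans m_ge2). Qed.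

Lemma sqrtn_sqr : s ^+ 2 = n%:R.
Proof. by rewrite sqr_sqrtr// ler0n. Qed.

Lemma sqrtn_gt0 : 0 < s.
Proof. by have := sqrtn_ge64 R n_ge; rewrite -/s; lra. Qed.

Lemma scale_gt0 : 0 < L.
Proof. by rewrite sqrtr_gt0 mulr_gt0 ?ltr0n// ln_gt0// p_gt1. Qed.

Lemma scale_sqr : L ^+ 2 = m%:R * ln p%:R.
Proof. by rewrite sqr_sqrtr// mulr_ge0 ?ler0n// ln_ge0// ltW// p_gt1. Qed.

Lemma centered_statisticE w : Z w = (top_eigenvalue m x w - n%:R) / s - 2 * L.
Proof. by []. Qed.

Lemma measurable_centered_statistic : measurable_fun setT Z.
Proof.
apply: measurable_funB => //; apply: measurable_funM => //.
by apply: measurable_funB => //; exact: measurable_top_eigenvalue.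
Qed.

Lemma measurable_expR_Z (a : R) : measurable_fun setT (fun w => expR (a * Z w)).
Proof.
apply: measurableT_comp => //; apply: measurable_funM => //.
exact: measurable_centered_statistic.
Qed.

Lemma integral_expR_Z_le (K : nat) : (8 * m <= K)%N -> 6 * L <= s ->
  (\int[P]_w (expR (L * Z w))%:E <=
   (3 * expR (m%:R * ln (K.*2.+1)%:R + 8 * m%:R * L ^+ 2 / K%:R + 16 * L ^+ 3 / s))%:E)%E.
Proof.
move=> mK Ls; have L0 := scale_gt0; have s0 := sqrtn_gt0; have s2 := sqrtn_sqr.
have m0' : 0 < m%:R :> R by rewrite ltr0n.
have K0 : 0 < K%:R :> R by rewrite ltr0n (leq_trans _ mK)// muln_gt0.
pose e := 2 * (m%:R / K%:R) : R.
have e0 : 0 < e by rewrite mulr_gt0// divr_gt0.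
have e1 : e <= 4^-1.
  rewrite /e mulrA ler_pdivrMr//.
  have : (8 * m)%:R <= K%:R :> R by rewrite ler_nat.
  by rewrite natrM; lra.
pose t := L / s.
have t0 : 0 < t by rewrite divr_gt0.
have t6 : t <= 6^-1 by rewrite /t ler_pdivrMr//; lra.
(* [c] is the loss due to the grid. Its square multiplies the main term [L ^+ 2] and is bounded by
   [1 + 4 e]; its cube multiplies an error term, for which the constant 4 suffices. *)
pose c := (1 - e)^-1.
have c0 : 0 < c by rewrite invr_gt0; lra.
have c43 : c <= 4 / 3 by rewrite /c -[leRHS]invrK lef_pV2 ?posrE//; lra.
have ce : c * (1 - e) = 1 by rewrite mulVf// gt_eqF//; lra.
have c2 : c ^+ 2 <= 1 + 4 * e.
  have h : 1 <= (1 + 4 * e) * (1 - e) ^+ 2 by nra.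
  have := ler_wpM2l (sqr_ge0 c) h.
  by rewrite mulr1 mulrCA -exprMn ce expr1n mulr1.
have c3 : c ^+ 3 <= 4.
  have : c ^+ 3 <= (4 / 3) ^+ 3 by rewrite ler_pXn2r ?nnegrE//; lra.
  by lra.
have t'4 : 0 <= t * c <= 4^-1.
  rewrite mulr_ge0 ?(ltW t0) ?(ltW c0)//=; apply: (@le_trans _ _ (6^-1 * (4 / 3))); last lra.
  by apply: ler_pM => //; exact: ltW.
have t'E : t * c = t / (1 - 2 * (m%:R / K%:R)) by [].
have main := integral_expR_top_le m_gt0 mp Hnormal Hindep t0 mK t'E t'4.
under eq_integral => w _.
  rewrite (_ : L * Z w = - (2 * L ^+ 2) + t * (top_eigenvalue m x w - n%:R)); last first.
    by rewrite centered_statisticE /t; field; rewrite gt_eqF.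
  rewrite expRD EFinM; over.
rewrite integral_EFinZl; last 3 first.
- apply: measurableT_comp => //; apply: measurable_funM => //.
  by apply: measurable_funB => //; exact: measurable_top_eigenvalue.
- by move=> w; exact: expR_ge0.
- exact: expR_ge0.
apply: (le_trans (lee_wpmul2l _ main)); first by rewrite lee_fin expR_ge0.
rewrite -EFinM lee_fin.
have pE : p%:R ^+ m = expR (L ^+ 2) :> R.
  by rewrite scale_sqr expRM_natl lnK// posrE; have := p_gt1; lra.
have KE : (K.*2.+1)%:R ^+ m = expR (m%:R * ln (K.*2.+1)%:R) :> R.
  by rewrite expRM_natl lnK// posrE ltr0n.
have swap (a b c' e' : R) : a * (3 * (b * c') * e') = 3 * (a * (b * (c' * e'))) by ring.
rewrite pE KE swap ler_pM2l// -!expRD ler_expR.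
have -> : n%:R * (t * c) ^+ 2 = L ^+ 2 * c ^+ 2.
  by rewrite -s2 /t; field; rewrite gt_eqF.
have -> : 4 * n%:R * (t * c) ^+ 3 = 4 * (L ^+ 3 / s) * c ^+ 3.
  by rewrite -s2 /t; field; rewrite gt_eqF.
have h1 := ler_wpM2l (sqr_ge0 L) c2.
have Ls0 : 0 <= L ^+ 3 / s by rewrite divr_ge0 ?exprn_ge0// ltW.
have h2 := ler_wpM2l Ls0 c3.
have -> : 8 * m%:R * L ^+ 2 / K%:R = 4 * (L ^+ 2 * e).
  by rewrite /e; field; rewrite gt_eqF.
by lra.
Qed.

(** The top eigenvalue dominates the square norm of a single column. The bound is crude, of size exp
    (2 a L), and [finite_bound] compensates it by the rarity of lower deviations. *)
Lemma integral_expRN_Z_le (a : R) : 0 <= a ->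
  (\int[P]_w (expR (- a * Z w))%:E <= (expR (2 * a * L + a ^+ 2))%:E)%E.
Proof.
move=> a0; have s0 := sqrtn_gt0; have s2 := sqrtn_sqr.
pose j0 := widen_ord mp (Ordinal m_gt0).
pose S : {set 'I_p} := [set widen_ord mp l | l : 'I_m]%SET.
have Sm : #|S| = m.
  rewrite card_imset ?card_ord//.
  by move=> l l' /(congr1 val)/= ll'; exact: val_inj.
pose u (j : 'I_p) : R := (j == j0)%:R.
have uS j : j \notin S -> u j = 0.
  by rewrite /u; case: eqP => // ->; rewrite imset_f.
have u1 : sqnorm u = 1.
  rewrite /sqnorm (bigD1 j0)//= big1 ?addr0 /u ?eqxx ?expr1n// => j /negbTE ->.
  by rewrite expr0n.
pose t := a / s.
have t0 : 0 <= t by rewrite divr_ge0// ltW.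
apply: (@le_trans _ _ (\int[P]_w ((expR (2 * a * L + t * n%:R))%:E * (expR (- t * quad x u w))%:E))%E).
  under [X in (_ <= X)%E]eq_integral do rewrite -EFinM.
  apply: le_integral_fun.
  - exact: measurable_expR_Z.
  - by apply: measurable_funM => //; exact: measurable_expR_quad.
  - by move=> w; exact: expR_ge0.
  - move=> w; rewrite -expRD ler_expR.
    have Tu := quad_le_top_eigenvalue x m_gt0 mp w Sm uS; rewrite u1 mulr1 in Tu.
    rewrite (_ : - a * Z w = 2 * a * L + t * n%:R - t * top_eigenvalue m x w); last first.
      by rewrite centered_statisticE /t; field; rewrite gt_eqF.
    by have := ler_wpM2l t0 Tu; lra.
rewrite integral_EFinZl; [|exact: measurable_expR_quad|by move=> w; exact: expR_ge0|exact: expR_ge0].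
apply: (le_trans (lee_wpmul2l _ (quad_expRN_le Hnormal Hindep u1 t0))).
  by rewrite lee_fin expR_ge0.
rewrite -EFinM -expRD lee_fin ler_expR.
have -> : n%:R * t ^+ 2 = a ^+ 2 by rewrite -s2 /t; field; rewrite gt_eqF.
lra.
Qed.

Lemma lower_tail_Z (B q K : nat) (delta z : R) :
  (B * m * q <= p)%N -> (0 < q)%N -> (0 < K)%N ->
  4 <= z -> z <= s / 4 -> z ^+ 2 <= 4 * m%:R * ln q%:R -> 2 * L - delta < z ->
  2 * K%:R * expR (z ^+ 2 / 4 + 8 * (z + 4) / K%:R - m%:R * ln q%:R) +
    2 ^+ m * ((2 * K%:R) ^+ 2 * expR (4 * z ^+ 3 / s
       + 16 * (z + 4) / K%:R - ln q%:R / (4 * m%:R))) <= 2^-1 ->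
  (P [set w | (Z w <= - delta)%R] <= ((2^-1) ^+ B)%:E)%E.
Proof.
move=> Bp q0 K0 z4 zs zq zL small; have s0 := sqrtn_gt0.
have card_le : (#|{: 'I_B * 'I_m * 'I_q}| <= p)%N by rewrite !card_prod !card_ord.
(* Triples of a family, a block and a position are numbered and embedded in the columns, so that all
   blocks of all families are disjoint. *)
pose iota b l c := widen_ord card_le (enum_rank (b, l, c)).
have iota_inj b l c b' l' c' : iota b l c = iota b' l' c' -> [/\ b = b', l = l' & c = c'].
  move=> /(congr1 val)/= h.
  by have [-> -> ->] : (b, l, c) = (b', l', c') by apply: enum_rank_inj; exact: val_inj.
have fail b : (P (block_count x (iota b) (n%:R + s * z) @^-1` [set 0%R]) <= (2^-1)%:E)%E.
  apply: (le_trans (block_failure Hnormal Hindep _ m_ge2 q0 K0 n_ge z4 zs zq)).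
    by move=> l c l' c' /iota_inj[].
  by rewrite lee_fin.
have b_inj b l a b' l' a' : iota b l a = iota b' l' a' -> b = b' by move=> /iota_inj[].
have half0 : 0 <= 2^-1 :> R by rewrite invr_ge0.
apply: le_trans (blocks_failure Hindep b_inj half0 fail).
have mcount b : measurable (block_count x (iota b) (n%:R + s * z) @^-1` [set 0%R]).
  have dc : depends_on X [set ij | ij.2 \in [set: 'I_p]%SET] (block_count x (iota b) (n%:R + s * z)).
    by apply: depends_on_block_count => ? ?; rewrite inE.
  have /= := depends_on_measurable dc measurableT (measurable_set1 0).
  by rewrite setTI.
apply: le_measure; rewrite ?inE.
- rewrite (_ : [set w | _] = setT `&` Z @^-1` `]-oo, - delta]%classic).
    by apply: measurable_centered_statistic => //; exact: measurable_itv.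
  by rewrite setTI; apply/seteqP; split => w /=; rewrite in_itv.
- rewrite (_ : [set w | _] = \bigcap_b block_count x (iota b) (n%:R + s * z) @^-1` [set 0%R]).
    by apply: fin_bigcap_measurable => // b _; exact: mcount.
  by apply/seteqP; split => w /=; [move=> h b _; exact: h|move=> h b; exact: (h b Logic.I)].
move=> w /= Zw b; apply/block_count_eq0 => f.
have i_inj l c l' c' : iota b l c = iota b l' c' -> l = l' /\ c = c'.
  by move=> /iota_inj[].
have u1 := sqnorm_block_vec R i_inj m_gt0 f.
have Sm : #|block_support (iota b) f| = m.
  rewrite /block_support card_imset ?card_ord// => l l' /i_inj[] //.
have Tu := quad_le_top_eigenvalue x m_gt0 mp w Sm (@block_vec_support _ _ _ _ _ f).
rewrite u1 mulr1 in Tu; apply: (le_lt_trans Tu).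
move: Zw; rewrite centered_statisticE lerBlDr ler_pdivrMr// => h.
have : s * (2 * L - delta) < s * z by rewrite ltr_pM2l.
lra.
Qed.

Lemma finite_bound (B q K K' : nat) (alpha delta z : R) :
  0 < alpha -> 0 < delta -> alpha <= L -> 6 * L <= s -> (8 * m <= K')%N ->
  (B * m * q <= p)%N -> (0 < q)%N -> (0 < K)%N ->
  4 <= z -> z <= s / 4 -> z ^+ 2 <= 4 * m%:R * ln q%:R -> 2 * L - delta < z ->
  2 * K%:R * expR (z ^+ 2 / 4 + 8 * (z + 4) / K%:R - m%:R * ln q%:R) +
    2 ^+ m * ((2 * K%:R) ^+ 2 * expR (4 * z ^+ 3 / s
       + 16 * (z + 4) / K%:R - ln q%:R / (4 * m%:R))) <= 2^-1 ->
  (\int[P]_w (expR (alpha * `|Z w|) * \1_[set w' | (delta <= `|Z w'|)%R] w)%:E <=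
   (3 * expR (m%:R * ln (K'.*2.+1)%:R + 8 * m%:R * L ^+ 2 / K'%:R + 16 * L ^+ 3 / s
      - (L - alpha) * delta) +
    (expR (4 * alpha ^+ 2 - alpha * L) + expR (5 * alpha * L) * (2^-1) ^+ B))%:E)%E.
Proof.
move=> a0 d0 aL Ls mK' Bp q0 K0 z4 zs zq zL small.
have mZ := measurable_centered_statistic.
have mA : measurable [set w | Z w <= - delta].
  rewrite (_ : [set w | _] = setT `&` Z @^-1` `]-oo, - delta]%classic).
    by apply: mZ => //; exact: measurable_itv.
  by rewrite setTI; apply/seteqP; split => w /=; rewrite in_itv.
have mD : measurable [set w | delta <= `|Z w|].
  rewrite (_ : [set w | _] = setT `&` (fun w => `|Z w|) @^-1` `[delta, +oo[%classic).
    by apply: measurableT_comp => //; exact: measurable_itv.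
  by rewrite setTI; apply/seteqP; split => w /=; rewrite in_itv/= andbT.
(* The last two terms treat [Z <= - delta]. The weight [5 * alpha * L] exceeds the loss
   [4 * alpha * L] of the moment of order [2 * alpha], which leaves [exp (4 alpha^2 - alpha L)]; the
   inverse weight is paid only on an event of probability at most [2^-B]. *)
pose G w : R := expR (- ((L - alpha) * delta)) * expR (L * Z w) +
  (expR (- (5 * alpha * L)) * expR (- (2 * alpha) * Z w) +
   expR (5 * alpha * L) * \1_[set w' | (Z w' <= - delta)%R] w).
have m1 : measurable_fun setT (fun w => expR (- ((L - alpha) * delta)) * expR (L * Z w)).
  by apply: measurable_funM => //; exact: measurable_expR_Z.
have m2 : measurable_fun setT (fun w => expR (- (5 * alpha * L)) * expR (- (2 * alpha) * Z w)).
  by apply: measurable_funM => //; exact: measurable_expR_Z.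
have m3 : measurable_fun setT (fun w => expR (5 * alpha * L) * \1_[set w' | (Z w' <= - delta)%R] w).
  by apply: measurable_funM => //; exact: measurable_indic.
have g1 w : 0 <= expR (- ((L - alpha) * delta)) * expR (L * Z w).
  by rewrite mulr_ge0 ?expR_ge0.
have g2 w : 0 <= expR (- (5 * alpha * L)) * expR (- (2 * alpha) * Z w).
  by rewrite mulr_ge0 ?expR_ge0.
have g3 w : 0 <= expR (5 * alpha * L) * \1_[set w' | (Z w' <= - delta)%R] w.
  by rewrite mulr_ge0 ?expR_ge0// indicE.
apply: (@le_trans _ _ (\int[P]_w (G w)%:E)%E).
  apply: le_integral_fun.
  - apply: measurable_funM; last exact: measurable_indic.
    apply: measurableT_comp => //; apply: measurable_funM => //.
    exact: measurableT_comp.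
  - by apply: measurable_funD => //; exact: measurable_funD.
  - by move=> w; rewrite mulr_ge0 ?expR_ge0// indicE.
  - move=> w; rewrite indicE; case: (boolP (w \in _)) => [|_]; last first.
      by rewrite mulr0 /G !addr_ge0.
    rewrite inE/= mulr1 => dZ.
    have [Z0|Z0] := leP 0 (Z w).
      rewrite ger0_norm// in dZ *.
      apply: (@le_trans _ _ (expR (- ((L - alpha) * delta)) * expR (L * Z w))).
        rewrite -expRD ler_expR.
        have La : 0 <= L - alpha by lra.
        by have := ler_wpM2l La dZ; lra.
      by rewrite /G lerDl addr_ge0.
    rewrite ltr0_norm// in dZ *.
    apply: (@le_trans _ _ (expR (- (5 * alpha * L)) * expR (- (2 * alpha) * Z w) + expR (5 * alpha * L))); last first.
      rewrite /G indicE mem_set/=; last by lra.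
      by rewrite mulr1 ler_wpDl.
    (* AM-GM, with weights exp (-5 alpha L) and exp (5 alpha L) *)
    set b := expR (5 * alpha * L); set y := expR (alpha * - Z w).
    have b0 : 0 < b := expR_gt0 _.
    have -> : expR (- (5 * alpha * L)) = b^-1 by rewrite expRN.
    have -> : expR (- (2 * alpha) * Z w) = y ^+ 2.
      by rewrite expr2 -expRD; congr expR; ring.
    rewrite -(ler_pM2l b0) mulrDr mulrA mulfV ?gt_eqF// mul1r.
    by have := sqr_ge0 (y - b); have := sqr_ge0 y; have := sqr_ge0 b; nra.
under eq_integral do rewrite EFinD [X in (_ + X)%E]EFinD.
rewrite ge0_integralD; [|by []|..]; last 4 first.
- by move=> w _; rewrite lee_fin.
- exact/measurable_EFinP.
- by move=> w _; rewrite -EFinD lee_fin addr_ge0.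
- by under eq_fun do rewrite -EFinD; apply/measurable_EFinP; exact: measurable_funD.
rewrite EFinD; apply: leeD.
  under eq_integral do rewrite EFinM.
  rewrite integral_EFinZl; [|exact: measurable_expR_Z|by move=> w; exact: expR_ge0|exact: expR_ge0].
  apply: (le_trans (lee_wpmul2l _ (integral_expR_Z_le mK' Ls))); first by rewrite lee_fin expR_ge0.
  by rewrite -EFinM lee_fin mulrCA ler_pM2l// -expRD ler_expR; lra.
rewrite ge0_integralD; [|by []|..]; last 4 first.
- by move=> w _; rewrite lee_fin.
- exact/measurable_EFinP.
- by move=> w _; rewrite lee_fin.
- exact/measurable_EFinP.
rewrite EFinD; apply: leeD.
  under eq_integral do rewrite EFinM.
  rewrite integral_EFinZl; [|exact: measurable_expR_Z|by move=> w; exact: expR_ge0|exact: expR_ge0].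
  have a2 : 0 <= 2 * alpha by lra.
  apply: (le_trans (lee_wpmul2l _ (integral_expRN_Z_le a2))); first by rewrite lee_fin expR_ge0.
  by rewrite -EFinM lee_fin -expRD ler_expR; lra.
under eq_integral do rewrite EFinM.
rewrite integral_EFinZl; last 3 first.
- exact: measurable_indic.
- by move=> w; rewrite indicE.
- exact: expR_ge0.
rewrite integral_indic_prob// EFinM; apply: lee_wpmul2l; first by rewrite lee_fin expR_ge0.
exact: (lower_tail_Z Bp q0 K0 z4 zs zq zL small).
Qed.

End finite_bound.

(** * Choice of the parameters *)

Section parameters.
Context (R : realType).
Implicit Types (alpha delta eps L : R).

(** Follows from [exp x >= x]; it converts each smallness requirement into a lower bound on [L]. *)
Lemma expRN_small (c A eps L : R) : 0 < c -> 0 < A -> 0 < eps -> A / (c * eps) <= L ->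
  A * expR (- (c * L)) <= eps.
Proof.
move=> c0 A0 e0 AL; have ce0 : 0 < c * eps by rewrite mulr_gt0.
have cL : A / eps <= c * L.
  rewrite ler_pdivrMr//; move: AL; rewrite ler_pdivrMr//; lra.
rewrite expRN ler_pdivrMr ?expR_gt0//.
have : A / eps <= expR (c * L).
  by apply: (le_trans cL); apply: le_trans (expR_ge1Dx _); lra.
by rewrite ler_pdivrMr// mulrC.
Qed.

Lemma expr2_le_expR (m : nat) : 2 ^+ m <= expR (m%:R : R).
Proof.
rewrite -[m%:R]mulr1 expRM_natl; apply: lerXn2r; rewrite ?nnegrE ?expR_ge0//.
by apply: le_trans (expR_ge1Dx _); lra.
Qed.

(** [D] stands for the loss caused by splitting the columns. The margin [3 / 4 * eta] lowers
    [z ^+ 2 / 4] by [3/4 eta L] to first order, while [D] and the square of the margin together cost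
    less than [eta L / 4]. *)
Lemma level_square_gap (eta L D e z : R) : 0 < eta -> eta <= 1 -> 4 <= L ->
  z = 2 * L - 3 / 4 * eta -> D <= eta * L / 8 -> L ^+ 2 - D <= e ->
  z ^+ 2 / 4 - e <= - (eta * L / 2).
Proof.
move=> eta0 eta1 L4 zE DL mlam.
have ee : eta * eta <= eta * L / 4.
  have h : eta <= L / 4 by move: eta1 L4; clear; lra.
  by have := ler_wpM2l (ltW eta0) h; rewrite mulrA.
have -> : z ^+ 2 / 4 = L ^+ 2 - 3 / 4 * (eta * L) + 9 / 64 * (eta * eta) by rewrite zE; field.
have : 0 <= eta * L by apply: mulr_ge0; [exact: ltW|exact: le_trans L4].
by move: ee mlam DL; clear; lra.
Qed.

Lemma lower_parameters_small (m K : nat) (eta L l lam s z D : R) :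
  0 < eta -> eta <= 1 -> 4 <= L -> 0 < s -> 1 <= m%:R :> R -> m%:R <= L ->
  z = 2 * L - 3 / 4 * eta -> D <= eta * L / 8 -> L ^+ 2 - D <= m%:R * lam -> l / 2 <= lam ->
  32 * (L * m%:R) <= l -> 32 * (32 * L ^+ 2) <= s -> 0 < K%:R :> R -> 128 <= eta * K%:R ->
  (2 * K%:R) / (eta / 4 * 4^-1) <= L -> ((2 * K%:R) ^+ 2) / (1 * 4^-1) <= L ->
  2 * K%:R * expR (z ^+ 2 / 4 + 8 * (z + 4) / K%:R - m%:R * lam) +
    2 ^+ m * ((2 * K%:R) ^+ 2 * expR (4 * z ^+ 3 / s
       + 16 * (z + 4) / K%:R - lam / (4 * m%:R))) <= 2^-1.
Proof.
move=> eta0 eta1 L4 s0 m1 mL zE DL mlam lam2 Lm Ls K0 Keta q1 q2.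
have L0 : 0 <= L by move: L4; clear; lra.
have m0 : 0 < m%:R :> R by exact: lt_le_trans m1.
have etaL : eta * L <= L by rewrite ler_piMl.
have eL0 : 0 <= eta * L by apply: mulr_ge0 => //; exact: ltW.
have z4 : 4 <= z by move: zE eta1 L4; clear; lra.
have z2L : z <= 2 * L by move: zE eta0; clear; lra.
have zlam := level_square_gap eta0 eta1 L4 zE DL mlam.
(* [z + 4 <= 3 L], and [128 <= eta K] keeps the window error below the gap [zlam]. *)
have zK : (z + 4) / K%:R <= 3 / 128 * (eta * L).
  rewrite ler_pdivrMr// (_ : _ * K%:R = 3 / 128 * L * (eta * K%:R)); last by ring.
  have h : 3 / 128 * L * 128 <= 3 / 128 * L * (eta * K%:R).
    by apply: ler_wpM2l => //; move: L0; clear; lra.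
  by apply: le_trans h; move: z2L L4; clear; lra.
have h1 : 2 * K%:R * expR (z ^+ 2 / 4 + 8 * (z + 4) / K%:R - m%:R * lam) <= 4^-1.
  apply: (@le_trans _ _ (2 * K%:R * expR (- (eta / 4 * L)))).
    rewrite ler_pM2l ?mulr_gt0// ler_expR -[8 * _ / _]mulrA.
    by move: zlam zK eL0; clear; lra.
  apply: expRN_small => //; first exact: divr_gt0.
  exact: mulr_gt0.
have h2 : 2 ^+ m * ((2 * K%:R) ^+ 2 * expR (4 * z ^+ 3 / s + 16 * (z + 4) / K%:R - lam / (4 * m%:R))) <= 4^-1.
  have z3 : 4 * z ^+ 3 / s <= L.
    rewrite ler_pdivrMr//.
    have h : z ^+ 3 <= (2 * L) ^+ 3.
      by rewrite ler_pXn2r ?nnegrE//; [exact: le_trans z4|exact: mulr_ge0].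
    have h' := ler_wpM2l L0 Ls.
    rewrite (_ : L * (32 * (32 * L ^+ 2)) = 32 * (32 * L ^+ 3)) in h'; last by ring.
    have L3 : 0 <= L ^+ 3 by exact: exprn_ge0.
    rewrite (_ : (2 * L) ^+ 3 = 8 * L ^+ 3) in h; last by ring.
    by move: h h' L3; clear; lra.
  (* The bound [m^3 <= kap ln p] acts here, in the form [32 L m <= ln p]: the gain from partial
     overlaps beats [2 ^+ m] and all errors, which are at most of order [L]. *)
  have lm : 4 * L <= lam / (4 * m%:R).
    rewrite ler_pdivlMr ?mulr_gt0//.
    rewrite (_ : 4 * L * (4 * m%:R) = 16 * (L * m%:R)); last by ring.
    by move: Lm lam2; clear; lra.
  apply: (@le_trans _ _ (expR m%:R * ((2 * K%:R) ^+ 2 * expR (- (2 * L))))).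
    apply: ler_pM.
    - exact: exprn_ge0.
    - by rewrite mulr_ge0 ?sqr_ge0 ?expR_ge0.
    - exact: expr2_le_expR.
    - rewrite ler_pM2l ?exprn_gt0 ?mulr_gt0// ler_expR -[16 * _ / _]mulrA.
      by move: z3 lm zK etaL L0; clear; lra.
  rewrite mulrCA -expRD.
  apply: (@le_trans _ _ ((2 * K%:R) ^+ 2 * expR (- (1 * L)))).
    by rewrite ler_pM2l ?exprn_gt0 ?mulr_gt0// ler_expR; move: mL; clear; lra.
  by apply: expRN_small => //; rewrite exprn_gt0// mulr_gt0.
by move: h1 h2; clear; lra.
Qed.

Lemma upper_parameters_small (m B : nat) (alpha delta eps eta L s W D : R) :
  0 < alpha -> 0 < delta -> 0 < eps -> 0 < eta -> eta <= delta -> 4 <= L -> 0 < s ->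
  (1 <= m)%N -> (0 < B)%N -> W = (2 * (B * m))%:R -> D = m%:R * ln W ->
  D <= eta * L / 8 -> L ^+ 2 <= B%:R -> m%:R <= B%:R :> R ->
  32 * (32 * L ^+ 2) <= eta * s -> 10 * alpha + 2 <= L ->
  3 * expR (8 + alpha * delta) / (delta / 2 * (eps / 3)) <= L ->
  expR (4 * alpha ^+ 2) / (alpha * (eps / 3)) <= L -> 1 / (1 * (eps / 3)) <= L ->
  3 * expR (m%:R * ln ((B * B).*2.+1)%:R + 8 * m%:R * L ^+ 2 / (B * B)%:R + 16 * L ^+ 3 / s
    - (L - alpha) * delta) +
  (expR (4 * alpha ^+ 2 - alpha * L) + expR (5 * alpha * L) * (2^-1) ^+ B) <= eps.
Proof.
move=> a0 d0 e0 eta0 etad L4 s0 m1 B0 WE DE DL LB mB Ls a10L q3 q4 q5.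
have L0 : 0 <= L by move: L4; clear; lra.
have m0 : 0 < m%:R :> R by rewrite ltr0n.
have e30 : 0 < eps / 3 by exact: divr_gt0.
have W0 : 0 < W by rewrite WE ltr0n !muln_gt0 B0.
have f1 : 3 * expR (m%:R * ln ((B * B).*2.+1)%:R + 8 * m%:R * L ^+ 2 / (B * B)%:R + 16 * L ^+ 3 / s - (L - alpha) * delta) <= eps / 3.
  (* The grid parameter is [B * B]: its entropy is at most twice the splitting loss [D], and it is
     large enough for the discretisation error [g2] to be bounded, as both [m] and [L ^+ 2] are at
     most [B]. *)
  have g1 : m%:R * ln ((B * B).*2.+1)%:R <= 2 * D.
    rewrite DE mulrCA ler_pM2l// (_ : 2 * ln W = ln (W ^+ 2)); last by rewrite lnXn// mulr_natl.
    rewrite ler_ln ?posrE ?ltr0n ?exprn_gt0// WE -natrX ler_nat.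
    apply: (@leq_trans (4 * (B * B))).
      have -> : (4 * (B * B) = (B * B).*2 + (B * B).*2)%N.
        by rewrite addnn -[in RHS]mul2n -[in RHS]mul2n [in RHS]mulnA.
      by rewrite -[leqLHS]addn1 leq_add2l double_gt0 muln_gt0 B0.
    rewrite !expnMn -[(B * B)%N]/(B ^ 2)%N mulnA leq_pmulr// expn_gt0.
    by rewrite m1.
  have g2 : 8 * m%:R * L ^+ 2 / (B * B)%:R <= 8.
    rewrite ler_pdivrMr ?ltr0n ?muln_gt0 ?B0// natrM -mulrA ler_pM2l//.
    by apply: ler_pM => //; exact: sqr_ge0.
  have g3 : 16 * L ^+ 3 / s <= eta * L / 4.
    rewrite ler_pdivrMr//.
    have h := ler_wpM2l L0 Ls.
    rewrite (_ : L * (32 * (32 * L ^+ 2)) = 32 * (32 * L ^+ 3)) in h; last by ring.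
    have : 0 <= L ^+ 3 by exact: exprn_ge0.
    by move: h; clear; lra.
  have g4 : eta * L <= delta * L by rewrite ler_wpM2r.
  have dL : 0 <= delta * L by rewrite mulr_ge0// ltW.
  apply: (@le_trans _ _ (3 * expR (8 + alpha * delta) * expR (- (delta / 2 * L)))).
    rewrite -[leRHS]mulrA -expRD ler_pM2l// ler_expR.
    by move: g1 g2 g3 g4 DL dL; clear; lra.
  apply: expRN_small => //; first exact: divr_gt0.
  by apply: mulr_gt0 => //; exact: expR_gt0.
have f2 : expR (4 * alpha ^+ 2 - alpha * L) <= eps / 3.
  by rewrite expRD; apply: expRN_small => //; exact: expR_gt0.
(* Since [2^-1 <= exp (- 1/2)] and [L ^+ 2 <= B], the exponent is at most [5 alpha L - L^2 / 2],
   which [10 alpha + 2 <= L] brings below [- L]. *)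
have f3 : expR (5 * alpha * L) * (2^-1) ^+ B <= eps / 3.
  apply: (@le_trans _ _ (1 * expR (- (1 * L)))); last by apply: expRN_small.
  have h : (2^-1) ^+ B <= expR (- (B%:R / 2)) :> R.
    rewrite (_ : - (B%:R / 2) = B%:R * (- 2^-1) :> R); last by field.
    rewrite expRM_natl ler_pXn2r ?nnegrE ?expR_ge0 ?invr_ge0//.
    by apply: le_trans (expR_ge1Dx _); clear; lra.
  apply: (@le_trans _ _ (expR (5 * alpha * L) * expR (- (B%:R / 2)))).
    by rewrite ler_pM2l ?expR_gt0.
  rewrite mul1r -expRD ler_expR.
  have h' := ler_wpM2r L0 a10L.
  by move: h' LB; rewrite expr2; clear; lra.
by move: f1 f2 f3; clear; lra.
Qed.

(** [Lam] and [kap] depend on [alpha], [delta], [eps] alone, and so does the number [K] of windows;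
    [B], [q] and the grid parameter [K'] vary with [m] and [p]. All margins are measured by
    [eta = min delta 1]. *)
Lemma parameter_choice alpha delta eps : 0 < alpha -> 0 < delta -> 0 < eps ->
  exists2 Lam : R, 0 < Lam & exists2 kap : R, 0 < kap &
  forall (s : R) (m p : nat), 0 < s -> (2 <= m)%N -> (0 < p)%N -> Lam <= ln p%:R ->
    m%:R ^+ 3 <= kap * ln p%:R -> m%:R * ln p%:R <= kap * s ->
  let L := Num.sqrt (m%:R * ln p%:R) in
  exists (B q K K' : nat) (z : R),
    [/\ [/\ alpha <= L, 6 * L <= s, (8 * m <= K')%N & (B * m * q <= p)%N],
      [/\ (0 < q)%N, (0 < K)%N, 4 <= z & z <= s / 4],
      z ^+ 2 <= 4 * m%:R * ln q%:R, 2 * L - delta < z &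
      2 * K%:R * expR (z ^+ 2 / 4 + 8 * (z + 4) / K%:R - m%:R * ln q%:R) +
        2 ^+ m * ((2 * K%:R) ^+ 2 * expR (4 * z ^+ 3 / s
           + 16 * (z + 4) / K%:R - ln q%:R / (4 * m%:R))) <= 2^-1 /\
      3 * expR (m%:R * ln (K'.*2.+1)%:R + 8 * m%:R * L ^+ 2 / K'%:R + 16 * L ^+ 3 / s
        - (L - alpha) * delta) +
      (expR (4 * alpha ^+ 2 - alpha * L) + expR (5 * alpha * L) * (2^-1) ^+ B) <= eps].
Proof.
move=> a0 d0 e0; pose eta := Num.min delta 1.
have eta0 : 0 < eta by rewrite lt_min d0 ltr01.
have eta1 : eta <= 1 by rewrite ge_min lexx orbT.
have etad : eta <= delta by rewrite ge_min lexx.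
have [K K0 Keta] : exists2 K : nat, 0 < K%:R :> R & 128 <= eta * K%:R.
  exists (Num.trunc (128 / eta)).+1; first by rewrite ltr0n.
  have /truncn_itv/andP[_ h] : 0 <= 128 / eta by apply: divr_ge0; [exact: ler0n|exact: ltW].
  by rewrite -ler_pdivrMl// mulrC ltW.
have [L0 [[L04 L0a L010] [L01 L02] [L03 L0e L05]]] : exists L0 : R, [/\
    [/\ 4 <= L0, alpha <= L0 & 10 * alpha + 2 <= L0],
    (2 * K%:R) / (eta / 4 * 4^-1) <= L0 /\ ((2 * K%:R) ^+ 2) / (1 * 4^-1) <= L0 &
    [/\ 3 * expR (8 + alpha * delta) / (delta / 2 * (eps / 3)) <= L0,
      expR (4 * alpha ^+ 2) / (alpha * (eps / 3)) <= L0 & 1 / (1 * (eps / 3)) <= L0]].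
  set t1 := _ / (eta / 4 * _); set t2 := _ / (1 * 4^-1); set t3 := _ / (delta / 2 * _).
  set t4 := _ / (alpha * _); set t5 := 1 / (1 * _).
  exists (Num.max 4 (Num.max alpha (Num.max (10 * alpha + 2)
    (Num.max t1 (Num.max t2 (Num.max t3 (Num.max t4 t5))))))).
  by rewrite !le_max !lexx !orbT.
(* [Y] forces [y >= 192 / eta] for the [y] introduced below. The constant is 8 times 24:
   [D <= 24 m y] must be at most [eta L / 8], and [L >= m y^2]. *)
have [Y Y0 etaY] : exists2 Y, 0 < Y & (192 / eta) ^+ 2 <= Y.
  exists ((192 / eta) ^+ 2) => //.
  by apply: exprn_gt0; apply: divr_gt0; [rewrite ltr0n|exact: eta0].
have L0Y : 0 <= L0 ^+ 2 /\ 0 <= Y ^+ 3 by split; [exact: sqr_ge0|exact/exprn_ge0/ltW].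
exists (L0 ^+ 2 + Y ^+ 3 + 8); first by move: L0Y; clear; lra.
(* The same constant serves [32 L m <= ln p], proved after squaring, and [1024 L^2 <= eta s]. *)
exists (eta / 32 / 32); first by rewrite !divr_gt0.
move=> s m p s0 m2 p0 Laml m3 ml L; set l := ln p%:R in Laml m3 ml L *.
have m0' : 0 < m%:R :> R by rewrite ltr0n (leq_trans _ m2).
have m1' : 1 <= m%:R :> R by rewrite ler1n (leq_trans _ m2).
have p0' : 0 < p%:R :> R by rewrite ltr0n.
have [Ll2 Yl l8] : [/\ L0 ^+ 2 <= l, Y ^+ 3 <= l & 8 <= l].
  by move: L0Y Laml; clear; move: (L0 ^+ 2) (Y ^+ 3) => a b; split; lra.
have l0 : 0 < l by move: l8; clear; lra.
have pE : p%:R = expR l by rewrite lnK// posrE.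
have L2 : L ^+ 2 = m%:R * l by rewrite sqr_sqrtr// mulr_ge0// ltW.
have Lpos : 0 <= L by exact: sqrtr_ge0.
have LL0 : L0 <= L.
  have h : 0 <= L0 by move: L04; clear; lra.
  suff : L0 ^+ 2 <= L ^+ 2 by rewrite ler_pXn2r.
  by apply: (le_trans Ll2); rewrite L2 ler_peMl// ltW.
have L4 := le_trans L04 LL0; have aL := le_trans L0a LL0; have a10L := le_trans L010 LL0.
have q1 := le_trans L01 LL0; have q2 := le_trans L02 LL0; have q3 := le_trans L03 LL0.
have q4 := le_trans L0e LL0; have q5 := le_trans L05 LL0.
clear LL0 Ll2 Laml L0Y L04 L0a L010 L01 L02 L03 L0e L05 L0.
(* [y ^ 6 = ln p], so that [m <= y ^ 2] and [ln (ln p) <= 6 y] *)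
pose y := expR (ln l / 6).
have y0 : 0 < y := expR_gt0 _.
have y6 : y ^+ 6 = l.
  by rewrite /y -expRM_natl (_ : 6%:R * (ln l / 6) = ln l) ?lnK ?posrE//; field.
have y23 : (y ^+ 2) ^+ 3 = l by rewrite -y6 -exprM.
have lny : ln l <= 6 * y.
  have : ln y < y by apply: ln_sublinear.
  by rewrite /y expRK -/y; clear; lra.
have yY : Y <= y ^+ 2.
  by rewrite -(@ler_pXn2r _ 3) ?nnegrE ?sqr_ge0 ?(ltW Y0)// y23.
have my : m%:R <= y ^+ 2.
  rewrite -(@ler_pXn2r _ 3) ?nnegrE ?sqr_ge0// y23; apply: (le_trans m3).
  by rewrite mulrC ler_piMr ?(ltW l0)//; move: eta1; clear; lra.
have y1 : 1 <= y.
  by rewrite -(@ler_pXn2r _ 6) ?nnegrE ?(ltW y0)// expr1n y6; move: l8; clear; lra.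
have y4 : y ^+ 4 <= l.
  by rewrite -y6; apply: ler_weXn2l.
have m_le : m%:R ^+ 2 <= l.
  apply: le_trans y4; rewrite (_ : y ^+ 4 = (y ^+ 2) ^+ 2); last by rewrite -exprM.
  by rewrite ler_pXn2r ?nnegrE ?sqr_ge0 ?(ltW m0').
have ml' : m%:R <= l by apply: le_trans m_le; rewrite expr2 ler_peMl// ltW.
have mL : m%:R <= L.
  by rewrite -(@ler_pXn2r _ 2) ?nnegrE ?(ltW m0')// L2 expr2 ler_pM2l.
have Ll : L <= l.
  by rewrite -(@ler_pXn2r _ 2) ?nnegrE ?(ltW l0)// L2 expr2 ler_pM2r.
have Lm : 32 * (L * m%:R) <= l.
  rewrite -(@ler_pXn2r _ 2) ?nnegrE ?(ltW l0)//; last by rewrite !mulr_ge0// ltW.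
  have -> : (32 * (L * m%:R)) ^+ 2 = 32 * (32 * m%:R ^+ 3) * l.
    by rewrite !exprMn L2; ring.
  rewrite expr2 ler_pM2r//.
  have : eta * l <= l by rewrite ler_piMl// ltW.
  by move: m3; clear; lra.
have Ls : 32 * (32 * L ^+ 2) <= eta * s by rewrite L2; move: ml; clear; lra.
have etas : eta * s <= s by rewrite ler_piMl// ltW.
have L2s := le_trans Ls etas.
have LL : L <= L ^+ 2 by rewrite expr2 ler_peMl//; move: L4; clear; lra.
(* An integer just above [ln p], so that [B = m c] lies between [L ^+ 2] and [2 L ^+ 2]. *)
pose c := (Num.trunc l).+1.
have /andP[c1 c2] := truncn_itv (ltW l0).
have lc : l < c%:R by [].
have cl : c%:R <= 2 * l by rewrite /c -natr1; move: c1 l8; clear; lra.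
have c8 : (8 <= c)%N by rewrite -(ler_nat R); move: l8 lc; clear; lra.
pose B := (m * c)%N.
have BE : B%:R = m%:R * c%:R :> R by rewrite natrM.
have LB : L ^+ 2 <= B%:R by rewrite L2 BE ler_pM2l// ltW.
have B0 : (0 < B)%N by rewrite muln_gt0 (leq_trans _ m2)// (leq_trans _ c8).
have Bm0 : (0 < B * m)%N by rewrite muln_gt0 B0 (leq_trans _ m2).
(* Twice the number of blocks: the factor 2 pays for the integer division in [q], giving [p <= q W]
   and hence [ln q >= ln p - ln W]. *)
pose W : R := (2 * (B * m))%:R.
have W0 : 0 < W by rewrite ltr0n muln_gt0.
have Wl : W <= l ^+ 4.
  rewrite /W !natrM.
  have h1 : m%:R ^+ 2 * c%:R <= l * (2 * l) by apply: ler_pM => //; exact: sqr_ge0.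
  have h2 : 2 * 2 <= l * l by apply: ler_pM => //; apply: le_trans l8; rewrite ler_nat.
  have h3 : 2 * 2 * l ^+ 2 <= l ^+ 2 * l ^+ 2 by apply: ler_wpM2r; [exact: sqr_ge0|rewrite expr2].
  have -> : l ^+ 4 = l ^+ 2 * l ^+ 2 by rewrite -exprD.
  by apply: le_trans h3; move: h1; clear; rewrite !expr2; lra.
have lnW : ln W <= 4 * ln l.
  rewrite (_ : 4 * ln l = ln (l ^+ 4)); last by rewrite lnXn// mulr_natl.
  by rewrite ler_ln ?posrE// exprn_gt0.
have lnW0 : 0 <= ln W by apply: ln_ge0; rewrite /W ler1n muln_gt0.
pose D := m%:R * ln W.
have D0 : 0 <= D by rewrite mulr_ge0// ltW.
have DL : D <= eta * L / 8.
  have : ln W <= 24 * y by move: lnW lny; clear; lra.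
  move=> /(ler_wpM2l (ltW m0')); rewrite mulrCA -/D => h1.
  have ey : 192 <= eta * y.
    have h0 : 0 <= 192 / eta by apply: divr_ge0; [exact: ler0n|exact: ltW].
    have : 192 / eta <= y by rewrite -(@ler_pXn2r _ 2 isT) ?nnegrE ?(ltW y0)// (le_trans etaY).
    by rewrite ler_pdivrMr// mulrC.
  have myL : m%:R * y ^+ 2 <= L.
    have h0 : 0 <= m%:R * y ^+ 2 by apply: mulr_ge0; [exact: ltW|exact: sqr_ge0].
    suff : (m%:R * y ^+ 2) ^+ 2 <= L ^+ 2 by rewrite ler_pXn2r.
    rewrite L2 -y6 (_ : (m%:R * y ^+ 2) ^+ 2 = m%:R * (m%:R * y ^+ 4)); last by ring.
    rewrite ler_pM2l// (_ : y ^+ 6 = y ^+ 2 * y ^+ 4); last by rewrite -exprD.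
    by rewrite ler_pM2r// exprn_gt0.
  have h2 : 192 * (m%:R * y) <= eta * y * (m%:R * y).
    by apply: ler_wpM2r; [apply: mulr_ge0; exact: ltW|exact: ey].
  have h3 := ler_wpM2l (ltW eta0) myL.
  rewrite (_ : eta * y * (m%:R * y) = eta * (m%:R * y ^+ 2)) in h2; last by ring.
  by move: h1 h2 h3; clear; lra.
have etaL : eta * L <= L by rewrite ler_piMl.
have lnWl : ln W <= l / 8.
  have h : ln W <= D.
    by apply: ler_peMl; [exact: lnW0|exact: m1'].
  have h' : eta * L <= l by exact: le_trans etaL Ll.
  by move: h DL h'; clear; lra.
have Wp : W <= p%:R by rewrite -ler_ln ?posrE// -/l; move: lnWl l0; clear; lra.
have Bmp : (B * m <= p)%N.
  by move: Wp; rewrite /W ler_nat; apply: leq_trans; rewrite leq_pmull.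
pose q := (p %/ (B * m))%N.
have q0 : (0 < q)%N by rewrite divn_gt0.
have q0' : 0 < q%:R :> R by rewrite ltr0n.
have Bmq : (B * m * q <= p)%N by rewrite mulnC leq_trunc_div.
have lamW : l <= ln q%:R + ln W.
  rewrite -lnM ?posrE// /l ler_ln ?posrE ?mulr_gt0//.
  rewrite /W -natrM ler_nat; apply: (@leq_trans (q.+1 * (B * m))).
    by rewrite ltnW// ltn_ceil.
  by rewrite [leqRHS]mulnA; apply: leq_mul => //; rewrite muln2 -addnn -addn1 leq_add2l.
set lam := ln q%:R in lamW *.
have mlam : L ^+ 2 - D <= m%:R * lam.
  by rewrite /D L2 -mulrBr ler_wpM2l ?(ltW m0')// lerBlDr.
have lam2 : l / 2 <= lam by move: lamW lnWl l0; clear; lra.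
pose z := 2 * L - 3 / 4 * eta.
have z4 : 4 <= z by move: L4 eta1; rewrite /z; clear; lra.
have z2L : z <= 2 * L by move: eta0; rewrite /z; clear; lra.
exists B, q, K, (B * B)%N, z; split.
- split.
  + exact: aL.
  + by move: L2s LL L4; clear; lra.
  + rewrite mulnC {1}/B -mulnA leq_mul2l; apply/orP; right.
    by apply: leq_trans c8 _; rewrite leq_pmulr.
  + exact: Bmq.
- split; [exact: q0|by rewrite -(ltr0n R)|exact: z4|rewrite ler_pdivlMr//].
  by move: z2L L2s LL L4; clear; lra.
- have zlam : z ^+ 2 / 4 - m%:R * lam <= - (eta * L / 2).
    exact: (level_square_gap eta0 eta1 L4 _ DL mlam).
  have eL0 : 0 <= eta * L by apply: mulr_ge0; [exact: ltW|exact: Lpos].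
  rewrite -[leRHS]mulrA; move: zlam eL0; clear.
  by move: (z ^+ 2) (m%:R * lam) (eta * L) => u v w; lra.
- by rewrite /z; move: etad d0 eta0; clear; lra.
have mB : m%:R <= B%:R :> R by rewrite ler_nat leq_pmulr.
split.
  exact: (lower_parameters_small eta0 eta1 L4 s0 m1' mL _ DL mlam lam2 Lm L2s K0 Keta q1 q2).
exact: (upper_parameters_small a0 d0 e0 eta0 etad L4 s0 (ltnW m2) B0 _ _ DL LB mB Ls a10L q3 q4 q5).
Qed.

End parameters.

(** * Asymptotic consequences of the growth condition *)

Section growth.
Context (R : realType).

Lemma ge0_cvge0 (u : nat -> \bar R) : (forall n, (0 <= u n)%E) ->
  (forall eps : R, 0 < eps -> \forall n \near \oo, (u n <= eps%:E)%E) -> u @ \oo --> 0%E.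
Proof.
move=> u0 ueps; apply/fine_cvgP; split.
  near=> n; rewrite ge0_fin_numE//; apply: (@le_lt_trans _ _ 1%:E); last exact: ltry.
  by near: n; apply: ueps.
apply/cvgrPdist_le => e e0; near=> n.
have une : (u n <= e%:E)%E by near: n; exact: ueps.
have uf : u n \is a fin_num by rewrite ge0_fin_numE// (le_lt_trans une)// ltry.
rewrite /= sub0r normrN ger0_norm ?fine_ge0//.
by rewrite -lee_fin fineK.
Unshelve. all: by end_near.
Qed.

Lemma near_ln_ge (p : nat -> nat) (A : R) : p @ \oo --> \oo ->
  \forall n \near \oo, A <= ln (p n)%:R.
Proof.
move=> /cvgnyPge /(_ (Num.trunc (expR A)).+1); apply: filterS => n pn.
have /andP[_ h] := truncn_itv (ltW (expR_gt0 A)).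
have h' : expR A <= (p n)%:R by apply: (le_trans (ltW h)); rewrite ler_nat.
by rewrite -[A]expRK ler_ln ?posrE ?expR_gt0// (lt_le_trans _ h')// expR_gt0.
Qed.

Lemma powR_invn_expn (a : R) k : 0 <= a -> (0 < k)%N -> (a `^ k%:R^-1) ^+ k = a.
Proof.
move=> a0 k0; rewrite -powR_mulrn ?powR_ge0// -powRrM mulVf ?powRr1//.
by rewrite pnatr_eq0 -lt0n.
Qed.

(** For fixed [m] both bounds are direct. Otherwise they come from the two members of the minimum,
    raised to the powers 3 and 2, after dropping from the denominators logarithmic factors that are
    eventually at least 1. *)
Lemma growth_bounds (m p : nat -> nat) (kap : R) : 0 < kap ->
  (forall n, (2 <= m n)%N) -> p @ \oo --> \oo -> growth_condition R m p ->
  \forall n \near \oo, (m n)%:R ^+ 3 <= kap * ln (p n)%:R /\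
    (m n)%:R * ln (p n)%:R <= kap * Num.sqrt n%:R.
Proof.
move=> k0 m2 pT [[[m0 [m02 mE]] /eqoP lnp]|[_ /eqoP mo]].
  have m0' : 0 < m0%:R :> R by rewrite ltr0n (leq_trans _ m02).
  have km : 0 < kap / m0%:R by exact: divr_gt0.
  near=> n; rewrite mE; split.
    rewrite -ler_pdivrMl//; near: n; exact: near_ln_ge.
  have : `|ln (p n)%:R : R| <= kap / m0%:R * `|Num.sqrt n%:R : R|.
    by near: n; exact: lnp.
  rewrite (ger0_norm (sqrtr_ge0 _)) => h; have := le_trans (ler_norm _) h.
  by rewrite -mulrA mulrCA ler_pdivlMl.
(* The constant gets raised to the powers 2 and 3; with [c <= 1] both powers stay below [kap]. *)
pose c : R := Num.min kap 1.
have c0 : 0 < c by rewrite lt_min k0 ltr01.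
have ck : c <= kap by rewrite ge_min lexx.
have c1 : c <= 1 by rewrite ge_min lexx orbT.
near=> n; set l : R := ln (p n)%:R.
have l0 : 1 <= l by rewrite /l; near: n; exact: near_ln_ge.
have lnl : 1 <= ln l.
  rewrite -[leLHS]expRK ler_ln ?posrE ?expR_gt0//; last exact: lt_le_trans l0.
  by rewrite /l; near: n; exact: near_ln_ge.
have n0 : 0 < n%:R :> R by near: n; exact: nbhs_infty_gtr.
have lnn : 1 <= ln n%:R :> R.
  by rewrite -[leLHS]expRK ler_ln ?posrE ?expR_gt0//; near: n; exact: nbhs_infty_ger.
have m1 : 1 <= (m n)%:R :> R by rewrite ler1n (leq_trans _ (m2 n)).
have l0' : 0 < l by exact: lt_le_trans l0.
set a : R := l `^ 3^-1 / ln l.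
set b : R := n%:R `^ 4^-1 / (ln n%:R `^ (3 / 2) * l `^ 2^-1).
have mab : `|(m n)%:R : R| <= c * `|Num.min a b| by rewrite /a /b /l; near: n; exact: mo.
have lnn32 : 1 <= ln n%:R `^ (3 / 2) :> R.
  by rewrite -[leLHS](powRr0 (ln n%:R)) ler_powR// divr_ge0.
have lhalf : 0 < l `^ 2^-1 by exact: powR_gt0.
have a0 : 0 <= a by rewrite divr_ge0 ?powR_ge0// (le_trans _ lnl).
have b0 : 0 <= b by rewrite divr_ge0 ?powR_ge0// mulr_ge0 ?powR_ge0.
rewrite normr_nat ger0_norm ?le_min ?a0// in mab.
have ma : (m n)%:R <= c * l `^ 3^-1.
  apply: (le_trans mab); rewrite ler_pM2l// ge_min; apply/orP; left.
  by rewrite ler_pdivrMr ?(lt_le_trans _ lnl)// ler_peMr// powR_ge0.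
have mb : (m n)%:R * l `^ 2^-1 <= c * n%:R `^ 4^-1.
  rewrite -ler_pdivlMr// -mulrA; apply: (le_trans mab); rewrite ler_pM2l// ge_min.
  apply/orP; right; rewrite /b ler_wpM2l ?powR_ge0// lef_pV2 ?posrE ?mulr_gt0//.
    by rewrite ler_peMl// ltW.
  exact: lt_le_trans lnn32.
have c3 : c ^+ 3 <= kap.
  by apply: le_trans ck; rewrite exprS ler_piMr ?(ltW c0)// exprn_ile1// ltW.
have c2 : c ^+ 2 <= kap.
  by apply: le_trans ck; rewrite exprS ler_piMr ?(ltW c0)//.
split.
  apply: (@le_trans _ _ ((c * l `^ 3^-1) ^+ 3)).
    by rewrite lerXn2r ?nnegrE// mulr_ge0 ?powR_ge0// ltW.
  by rewrite exprMn powR_invn_expn ?(ltW l0')// ler_wpM2r ?(ltW l0').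
have h : ((m n)%:R * l `^ 2^-1) ^+ 2 <= (c * n%:R `^ 4^-1) ^+ 2.
  by rewrite lerXn2r ?nnegrE// mulr_ge0 ?powR_ge0// ltW.
rewrite !exprMn powR_invn_expn ?(ltW l0')// in h.
have n4 : (n%:R `^ 4^-1) ^+ 2 = Num.sqrt n%:R :> R.
  rewrite -powR12_sqrt ?ler0n// -powR_mulrn ?powR_ge0// -powRrM; congr (_ `^ _).
  by field.
rewrite n4 in h.
apply: (@le_trans _ _ ((m n)%:R ^+ 2 * l)).
  by rewrite ler_wpM2r ?(ltW l0')// expr2 ler_peMr.
by apply: (le_trans h); rewrite ler_wpM2r ?sqrtr_ge0.
Unshelve. all: by end_near.
Qed.

End growth.

Theorem theorem1 (R : realType) (m p : nat -> nat)
    (d : nat -> measure_display) (Omega : forall n, measurableType (d n))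
    (P : forall n, probability (Omega n) R)
    (x : forall n, 'I_n -> 'I_(p n) -> {RV (P n) >-> R})
    (Hmp : forall n, (2 <= m n <= p n)%N)
    (Hp : p @ \oo --> \oo)
    (Hnormal : forall n i j, standard_normal (x n i j))
    (Hindep : forall n,
      mutually_independent (fun ij : 'I_n * 'I_(p n) => x n ij.1 ij.2))
    (Hgrowth : growth_condition R m p) :
  let Z n (w : Omega n) : R :=
    centered_statistic (m n) (\matrix_(i < n, j < p n) x n i j w) in
  cvg_in_probability P Z 0 /\
  forall alpha delta : R, 0 < alpha -> 0 < delta ->
    ('E_(P n)[fun w => (expR (alpha * `|Z n w|)
        * \1_[set w' | (delta <= `|Z n w'|)%R] w)%R])%E @[n --> \oo] --> 0%E.
Proof.
move=> Z.
have m2 n : (2 <= m n)%N by have /andP[] := Hmp n.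
have mp n : (m n <= p n)%N by have /andP[] := Hmp n.
(* This single estimate yields both claims: the second directly, the first by taking [alpha = 1],
   because exp |Z| is at least 1 on the event whose probability is sought. *)
have tail (alpha delta eps : R) : 0 < alpha -> 0 < delta -> 0 < eps ->
    \forall n \near \oo, (\int[P n]_w (expR (alpha * `|Z n w|)
       * \1_[set w' | (delta <= `|Z n w'|)%R] w)%:E <= eps%:E)%E.
  move=> a0 d0 e0; have [Lam Lam0 [kap kap0 choice]] := parameter_choice a0 d0 e0.
  near=> n; have n_ge : (4096 <= n)%N by near: n; exact: nbhs_infty_ge.
  have [m3 ml] : (m n)%:R ^+ 3 <= kap * ln (p n)%:R /\
      (m n)%:R * ln (p n)%:R <= kap * Num.sqrt n%:R.
    by near: n; exact: growth_bounds.
  have Laml : Lam <= ln (p n)%:R by near: n; exact: near_ln_ge.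
  have s0 : 0 < Num.sqrt n%:R :> R by rewrite sqrtr_gt0 ltr0n (leq_trans _ n_ge).
  have p0 : (0 < p n)%N by rewrite (leq_trans _ (mp n))// (leq_trans _ (m2 n)).
  have [B [q [K [K' [z [[h1 h2 h3 h4] [h5 h6 h7 h8] h9 h10 [h11 h12]]]]]]] :=
    choice _ _ _ s0 (m2 n) p0 Laml m3 ml.
  have := finite_bound (m2 n) (mp n) n_ge (Hnormal n) (Hindep n)
    a0 d0 h1 h2 h3 h4 h5 h6 h7 h8 h9 h10 h11.
  by move=> h; apply: (le_trans h); rewrite lee_fin.
split.
  move=> e e0; apply: ge0_cvge0 => // eps eps0.
  near=> n; have n_ge : (4096 <= n)%N by near: n; exact: nbhs_infty_ge.
  have h : (\int[P n]_w (expR (1 * `|Z n w|)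
       * \1_[set w' | (e <= `|Z n w'|)%R] w)%:E <= eps%:E)%E.
    by near: n; exact: tail.
  apply: le_trans h.
  have mZ : measurable_fun setT (fun w => `|Z n w|).
    apply: measurableT_comp => //.
    exact: (measurable_centered_statistic (x n) (m2 n) (mp n)).
  have mA : measurable [set w | e <= `|Z n w|].
    rewrite (_ : [set w | _] = setT `&` (fun w => `|Z n w|) @^-1` `[e, +oo[%classic).
      by apply: mZ => //; exact: measurable_itv.
    by rewrite setTI; apply/seteqP; split => w /=; rewrite in_itv/= andbT.
  under [X in P n X]eq_set do rewrite subr0.
  apply: prob_le_integral => //.
  - apply: measurable_funM; last exact: measurable_indic.
    by apply: measurableT_comp => //; apply: measurable_funM.
  - move=> w Aw; rewrite indicE mem_set// mulr1 mul1r -[leLHS]expR0 ler_expR.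
    exact: normr_ge0.
move=> alpha delta a0 d0; rewrite unlock; apply: ge0_cvge0.
  by move=> n; apply: integral_ge0 => w _; rewrite lee_fin mulr_ge0 ?expR_ge0.
by move=> eps e0; exact: tail.
Unshelve. all: by end_near.
Qed.
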